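(* Let $(L_t)_{t\ge0}$ be the Markov semigroup on $\mathbb R$ generated by the pure-jump Lévy operator $\mathcal I$ with Lévy measure $\nu$. For all $0<s\le t$ and $0<q_2\le q_1<1$ such that $$q_2-1=\frac{q_2}{q_1}\,\frac ts\,(q_1-1),$$ one has $$L_t(f^{q_1})^{1/q_1}\le L_s\big((L_{t-s}f)^{q_2}\big)^{1/q_2}$$ for all positive functions $f$. If now $0<s\le t$ and $0<q_2\le q_1<1$ satisfy $q_2-1=\frac ts(q_1-1)$ and if moreover $\nu(\mathbb R)=C<\infty$, then $$L_t(f^{q_1})^{1/q_1}\le L_s\big((L_{t-s}f)^{q_2}\big)^{1/q_2}\exp\left[C\,\frac{s(t-s)(1-q_2)^2}{q_2(sq_2+t-s)}\right]$$ for all positive functions $f$.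
   Context: $\nu$ is a positive measure on $\mathbb R$ with $\nu(\{0\})=0$ and $\int_{\mathbb R}\min(1,|z|^2)\,d\nu(z)<\infty$. The associated Lévy operator is $\mathcal I(f)(x)=\int\big(f(x+z)-f(x)-\nabla f(x)\cdot z\,h(z)\big)d\nu(z)$ with $h(z)=1/(1+|z|^2)$; it is the infinitesimal generator of a pure-jump Lévy process, and $(L_t)_{t\ge0}$ is the Markov semigroup with generator $\mathcal I$. Inequalities between functions are pointwise, and $L_t(g)^{1/q}$ means $(L_t(g))^{1/q}$. *)

(* Defs.v *)
From HB Require Import structures.
From mathcomp Require Import all_boot all_order all_algebra.
From mathcomp Require Import all_classical all_reals all_analysis.
Set Implicit Arguments.
Unset Strict Implicit.
Unset Printing Implicit Defensive.
Import Order.TTheory GRing.Theory Num.Theory.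
Import numFieldNormedType.Exports.
Local Open Scope classical_set_scope.
Local Open Scope ring_scope.

Definition levy_measure (R : realType)
    (nu : {measure set (measurableTypeR R) -> \bar R}) : Prop :=
  nu [set 0] = 0%E /\
  (\int[nu]_z (Num.min 1 (`|z| ^+ 2))%:E < +oo)%E.

Definition levy_trunc (R : realType) (z : R) : R := (1 + `|z| ^+ 2)^-1.

(* On C_0^2 functions the integrand is bounded by a multiple of min(1, |z|^2),
   so the real-valued integral is a genuine (absolutely convergent) one. *)
Definition levy_op (R : realType)
    (nu : {measure set (measurableTypeR R) -> \bar R}) (f : R -> R) (x : R) : R :=
  \int[nu]_z (f (x + z) - f x - derive1 f x * z * levy_trunc z).

Definition vanishing (R : realType) (f : R -> R) : Prop :=
  (f y @[y --> +oo] --> (0 : R)) /\ (f y @[y --> -oo] --> (0 : R)).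

Definition C02 (R : realType) (f : R -> R) : Prop :=
  [/\ forall x, derivable f x 1,
      forall x, derivable (derive1 f) x 1,
      continuous (derive1n 2 f) &
      [/\ vanishing f, vanishing (derive1 f) & vanishing (derive1n 2 f)]].

(* Extended values, so that it makes sense for every nonnegative measurable f. *)
Definition semigroup_op (R : realType)
    (P : R -> R.-pker (measurableTypeR R) ~> (measurableTypeR R))
    (t : R) (f : R -> \bar R) (x : R) : \bar R :=
  (\int[P t x]_y f y)%E.

(* The family is indexed by R; only times t >= 0 are meaningful. *)
Definition markov_semigroup (R : realType)
    (P : R -> R.-pker (measurableTypeR R) ~> (measurableTypeR R)) : Prop :=
  (forall (x : R) (A : set (measurableTypeR R)), measurable A ->
     P 0 x A = \d_x A) /\
  (forall (s t : R), 0 <= s -> 0 <= t ->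
     forall (x : R) (A : set (measurableTypeR R)), measurable A ->
       P (s + t) x A = (\int[P s x]_y P t y A)%E).

(* f is in the domain of the infinitesimal generator, with value g:
   (P_t f - f) / t converges to g in the uniform norm as t -> 0+. *)
Definition generator_maps (R : realType)
    (P : R -> R.-pker (measurableTypeR R) ~> (measurableTypeR R))
    (f g : R -> R) : Prop :=
  forall e : R, 0 < e -> \forall t \near (0 : R)^'+, forall x : R,
    `| (fine (semigroup_op P t (EFin \o f) x) - f x) / t - g x | < e.

(* C_0^2 is the usual explicit part of the domain of a Levy generator; as it
   contains the core C_c^oo, this determines P_t for all t >= 0. *)
Definition has_generator (R : realType)
    (P : R -> R.-pker (measurableTypeR R) ~> (measurableTypeR R))
    (A : (R -> R) -> R -> R) : Prop :=
  forall f : R -> R, C02 f -> generator_maps P f (A f).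

(* Main.v *)
Require Import Defs.
From HB Require Import structures.
From mathcomp Require Import all_boot all_order all_algebra.
From mathcomp Require Import all_classical all_reals all_analysis.
From mathcomp Require Import measurable_realfun ring lra.
Import Order.TTheory GRing.Theory Num.Theory.
Import numFieldNormedType.Exports.
Local Open Scope classical_set_scope.
Local Open Scope ring_scope.
Set Implicit Arguments.
Unset Strict Implicit.
Unset Printing Implicit Defensive.

(** Why the theorem holds.  Write [L_t f x] for the expectation of [f] under
    [P t x].  What is wanted is a lower bound for [L_s ((L_(t-s) f)^q2)], and the
    Gibbs variational inequality provides lower bounds:
      [ln E phi >= E_Q (ln phi) - Ent (Q)]
    for any probability [Q], with [Ent (Q)] its relative entropy.

    First inequality.  Put [g = f^q1] and [Z = L_t g x], and let [Q] be the law
    of the path started at [x] and reweighted by [g (X_t) / Z].  Let [h u] be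
    the entropy of its restriction to times up to [u].  The Gibbs inequality
    at time [s], followed by the one conditional on [X_s] applied to
    [L_(t-s) f], gives
      [ln L_s ((L_(t-s) f)^q2) >= (q2/q1) ln Z
         + (q2 (1/q1 - 1) h t - (1 - q2) h s)].
    The bracket is nonnegative.  Increments of the process are independent,
    so the entropies of [Q] on two disjoint intervals add up to at most the
    entropy on their union; they are also stationary, so two adjacent intervals
    of equal length can be exchanged.  Hence [h] is convex ([entropy_exchange]),
    and as [h 0 = 0], [h s <= (s/t) h t] ([entropy_chord]); the relation between
    the exponents says exactly that [(1 - q2) s / t = q2 (1/q1 - 1)].  The
    computation is [variational_core].

    Second inequality.  The exponent relation is now the one for which [q1] is
    the mean of [1] and [q2] with weights [1 - s/t] and [s/t].  The same chain
    is run with [s' = (q2/q1) s] in place of [s] as the time at which [Q] is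
    cut, because [s'] satisfies the relation of the first part.  The time
    intervals of lengths [s'] and [t - s' = (t - s)/q1] of [Q] are compared with
    intervals of lengths [s] and [t - s] of the reference process; for a
    compound Poisson process of intensity [C] this change of clock costs
    [C (s - s')] up to a multiple of the number of jumps ([tilted_gibbs]).  The
    terms in the number of jumps have the favourable sign because
    [s ln q2 <= t ln q1], which is concavity of the logarithm, and the constant
    left over, [C (s - s') (1 - q2) / q2], is the one of the theorem.

    Both arguments use that [P t x] is the translate by [x] of a convolution
    semigroup and, for finite [nu], that this semigroup is compound Poisson
    with a drift.  Neither is assumed: only the action of the generator on
    [C_0^2] is known.  They follow from the formula
      [L_t (cos (xi . + c)) x = exp (a t) cos (xi x + c + b t)],
    where [a + i b] is the Levy exponent at [xi] ([characteristic_function]),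
    together with the fact that trigonometric integrals determine a law
    ([trig_unique]).  The cosine being outside [C_0^2], it is first damped by
    [1 / (1 + (delta x)^2)], and [delta] tends to [0] at the end.

    All this is done for functions bounded away from zero and infinity;
    [extend_to_positive] passes to every positive measurable function. *)

(** * Expectations of bounded measurable functions *)

(** The class over which integrals are taken: against a probability, linearity,
    monotonicity and Fubini hold on it with no integrability side condition. *)
Definition bounded_mfun {d} {T : measurableType d} {R : realType} (f : T -> R) : Prop :=
  measurable_fun [set: T] f /\ exists M : R, forall x, `|f x| <= M.

Section bounded_mfun.
Context d (T : measurableType d) (R : realType).
Implicit Types f g : T -> R.

Lemma bmf_cst (c : R) : bounded_mfun (fun=> c : R) (T := T).
Proof. by split; [exact: measurable_cst|exists `|c|]. Qed.

Lemma bmfD f g : bounded_mfun f -> bounded_mfun g -> bounded_mfun (fun x => f x + g x).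
Proof.
move=> [mf [M hM]] [mg [N hN]]; split; first exact: measurable_funD.
exists (M + N) => x; rewrite (le_trans (ler_normD _ _))//.
by rewrite lerD.
Qed.

Lemma bmfM f g : bounded_mfun f -> bounded_mfun g -> bounded_mfun (fun x => f x * g x).
Proof.
move=> [mf [M hM]] [mg [N hN]]; split; first exact: measurable_funM.
by exists (M * N) => x; rewrite normrM ler_pM.
Qed.

Lemma bmfN f : bounded_mfun f -> bounded_mfun (fun x => - f x).
Proof.
move=> [mf [M hM]]; split; last by exists M => x; rewrite normrN.
exact: measurableT_comp.
Qed.

Lemma bmfB f g : bounded_mfun f -> bounded_mfun g -> bounded_mfun (fun x => f x - g x).
Proof. by move=> bf /bmfN; exact: bmfD. Qed.

Lemma bmf_comp d' (T' : measurableType d') (h : T' -> T) f :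
  measurable_fun [set: T'] h -> bounded_mfun f -> bounded_mfun (fun x => f (h x)).
Proof.
move=> mh [mf [M hM]]; split; last by exists M.
exact: (measurableT_comp mf mh).
Qed.

Lemma bmf_integrable (mu : probability T R) f :
  bounded_mfun f -> mu.-integrable setT (EFin \o f).
Proof.
move=> [mf [M hM]]; apply: measurable_bounded_integrable => //.
  by rewrite [ltLHS]probability_setT ltry.
exists M; split; first exact: num_real.
by move=> N MN x _ /=; rewrite (le_trans (hM x))// ltW.
Qed.

End bounded_mfun.

Section expectation.
Context d (T : measurableType d) (R : realType) (mu : probability T R).
Implicit Types f g : T -> R.

Lemma Ecst (c : R) : \int[mu]_x c = c.
Proof. by rewrite Rintegral_cst//= probability_setT mulr1. Qed.

Lemma ED f g : bounded_mfun f -> bounded_mfun g ->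
  \int[mu]_x (f x + g x) = \int[mu]_x f x + \int[mu]_x g x.
Proof. by move=> bf bg; rewrite RintegralD//; exact: bmf_integrable. Qed.

Lemma EB f g : bounded_mfun f -> bounded_mfun g ->
  \int[mu]_x (f x - g x) = \int[mu]_x f x - \int[mu]_x g x.
Proof. by move=> bf bg; rewrite RintegralB//; exact: bmf_integrable. Qed.

Lemma EZ c f : bounded_mfun f -> \int[mu]_x (c * f x) = c * \int[mu]_x f x.
Proof. by move=> bf; rewrite RintegralZl//; exact: bmf_integrable. Qed.

Lemma E_le f g : bounded_mfun f -> bounded_mfun g -> (forall x, f x <= g x) ->
  \int[mu]_x f x <= \int[mu]_x g x.
Proof. by move=> bf bg fg; apply: le_Rintegral => //; exact: bmf_integrable. Qed.

Lemma E_ge_cst f c : bounded_mfun f -> (forall x, c <= f x) -> c <= \int[mu]_x f x.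
Proof. by move=> bf h; rewrite -[leLHS]Ecst; apply: E_le => //; exact: bmf_cst. Qed.

Lemma E_le_cst f c : bounded_mfun f -> (forall x, f x <= c) -> \int[mu]_x f x <= c.
Proof. by move=> bf h; rewrite -[leRHS]Ecst; apply: E_le => //; exact: bmf_cst. Qed.

Lemma E_norm_le f c : bounded_mfun f -> (forall x, `|f x| <= c) -> `|\int[mu]_x f x| <= c.
Proof.
move=> bf h; rewrite ler_norml; apply/andP; split.
  by apply: E_ge_cst => // x; have := h x; rewrite ler_norml => /andP[].
by apply: E_le_cst => // x; have := h x; rewrite ler_norml => /andP[].
Qed.

Lemma EFin_expectation f : bounded_mfun f -> (\int[mu]_x (f x)%:E)%E = (\int[mu]_x f x)%:E.
Proof.
by move=> bf; rewrite /Rintegral fineK//; apply: integrable_fin_num => //; exact: bmf_integrable.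
Qed.

Lemma Edominated_cvg (f_ : nat -> T -> R) f (M : R) :
  (forall n, measurable_fun setT (f_ n)) -> (forall n x, `|f_ n x| <= M) ->
  (forall x, f_ n x @[n --> \oo] --> f x) ->
  bounded_mfun f /\ \int[mu]_x f_ n x @[n --> \oo] --> \int[mu]_x f x.
Proof.
move=> mf_ hM cf.
have mf : measurable_fun setT f.
  apply: (@measurable_fun_cvg _ _ _ setT f_ f mf_).
  by move=> x _; exact: cf.
have bf : bounded_mfun f.
  split => //; exists M => x.
  by apply: (cvgr_to_le (cvg_norm (cf x))); exact: nearW.
split => //.
have iM : mu.-integrable setT (EFin \o (fun=> M)).
  exact/bmf_integrable/bmf_cst.
have [||||_ _] := @dominated_convergence _ T R mu setT measurableT
   (fun n => EFin \o f_ n) (EFin \o f) (EFin \o (fun=> M)) _ _ _ iM _.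
- by move=> n; exact/measurable_EFinP.
- exact/measurable_EFinP.
- by apply: aeW => x _; apply/cvg_EFin; [exact: nearW|exact: cf].
- by apply: aeW => x n _; rewrite lee_fin; exact: hM.
move=> h; have := h; rewrite EFin_expectation// => /fine_cvg h'; exact: h'.
Qed.

End expectation.

Section Efubini.
Context d1 d2 (T1 : measurableType d1) (T2 : measurableType d2) (R : realType)
  (m1 : probability T1 R) (m2 : probability T2 R).

Lemma bmf_integrable_prod (f : T1 * T2 -> R) : bounded_mfun f ->
  (m1 \x m2)%E.-integrable setT (EFin \o f).
Proof.
move=> [mf [M hM]]; apply: measurable_bounded_integrable => //.
  rewrite -setXTT [ltLHS]product_measure1E//.
  rewrite [X in (X * _)%E](probability_setT m1) [X in (_ * X)%E](probability_setT m2).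
  by rewrite mule1 ltry.
exists M; split; first exact: num_real.
by move=> N MN x _ /=; rewrite (le_trans (hM x))// ltW.
Qed.

Lemma bmf_integral2 (f : T1 * T2 -> R) : bounded_mfun f ->
  bounded_mfun (fun x => \int[m2]_y f (x, y)).
Proof.
move=> bf; have [mf [M hM]] := bf.
have mfx x : measurable_fun [set: T2] (fun y => f (x, y)).
  by apply: measurableT_comp => //; exact: measurable_pair1.
split; last first.
  exists M => x; apply: E_norm_le => //; split=> //; by exists M.
have := measurable_fubini_F (bmf_integrable_prod bf).
by apply: measurableT_comp; exact: fine_measurable.
Qed.

Lemma Efubini (f : T1 * T2 -> R) : bounded_mfun f ->
  \int[m1]_x \int[m2]_y f (x, y) = \int[m2]_y \int[m1]_x f (x, y).
Proof.
move=> bf; have im := bmf_integrable_prod bf.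
have h1 x : (\int[m2]_y (f (x, y))%:E)%E = (\int[m2]_y f (x, y))%:E.
  by rewrite EFin_expectation//; apply: (@bmf_comp _ _ _ _ _ (pair x)) bf;
    exact: pair1_measurable.
have h2 y : (\int[m1]_x (f (x, y))%:E)%E = (\int[m1]_x f (x, y))%:E.
  rewrite (@EFin_expectation _ _ _ m1 (fun x => f (x, y)))//.
  by apply: (@bmf_comp _ _ _ _ _ (fun x => (x, y))) bf; exact: pair2_measurable.
have := Fubini im; rewrite /= => H; rewrite /Rintegral; congr fine.
transitivity (\int[m1]_x (\int[m2]_y (f (x, y))%:E))%E.
  by apply: eq_integral => x _; rewrite h1.
by rewrite H; apply: eq_integral => y _; rewrite h2.
Qed.

End Efubini.

Section kernel.
Context d1 d2 (T1 : measurableType d1) (T2 : measurableType d2) (R : realType).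

(** A Markov kernel at a given point, under a name of its own so that it can
    carry the structure of a probability. *)
Definition kernel_law (k : R.-pker T1 ~> T2) (x : T1) : set T2 -> \bar R := k x.

HB.instance Definition _ k x := Measure.on (kernel_law k x).
HB.instance Definition _ k x :=
  Measure_isProbability.Build _ _ _ (kernel_law k x) (prob_kernel x).

(** Measurability in the base point is available for nonnegative integrands,
    and adding a bound of [f] brings it to that case. *)
Lemma bmf_kernel_law (k : R.-pker T1 ~> T2) (f : T2 -> R) : bounded_mfun f ->
  bounded_mfun (fun x => \int[kernel_law k x]_y f y).
Proof.
move=> bf; have [mf [M hM]] := bf.
split; last by exists M => x; exact: E_norm_le.
rewrite (_ : (fun x => _) =
    (fun x => fine (\int[k x]_y (f y + M)%:E)%E - M)); last first.
  apply/funext => x.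
  have := ED (kernel_law k x) bf (bmf_cst _ M); rewrite Ecst => h.
  by rewrite -[LHS](addrK M) -h.
apply: measurable_funB => //; apply: measurableT_comp => //.
apply: (@measurable_fun_integral_kernel _ _ _ _ _ k _ (fun y => (f y + M)%:E)).
- by move=> U mU; exact: measurable_kernel.
- by move=> y; rewrite lee_fin -lerBlDr sub0r; have := hM y; rewrite ler_norml => /andP[].
- by apply/measurable_EFinP; exact: measurable_funD.
Qed.

End kernel.

Section chapman.
Context (R : realType) (P : R -> R.-pker (measurableTypeR R) ~> (measurableTypeR R)).
Hypothesis hP : markov_semigroup P.

Lemma expectation_at0 (f : R -> R) x : bounded_mfun (f : measurableTypeR R -> _) ->
  \int[kernel_law (P 0) x]_y f y = f x.
Proof.
move=> bf; rewrite /Rintegral.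
rewrite (eq_measure_integral (dirac x)); last by move=> A mA _; rewrite hP.1.
rewrite integral_dirac//.
  by rewrite diracT mul1e.
by case: bf => mf _; exact/measurable_EFinP.
Qed.

(** The semigroup property is given on sets, where it says that [P (s + t)] is
    the composition of the kernels [P s] and [P t]; integration against a
    composition of kernels extends it to nonnegative functions, here [f + M]. *)
Lemma chapman_kolmogorov (f : R -> R) s t x : 0 <= s -> 0 <= t ->
  bounded_mfun (f : measurableTypeR R -> _) ->
  \int[kernel_law (P (s + t)) x]_y f y =
  \int[kernel_law (P s) x]_y \int[kernel_law (P t) y]_z f z.
Proof.
move=> s0 t0 bf; have [mf [M hM]] := bf.
have b2 := bmf_kernel_law (P t) bf.
have bfM : bounded_mfun (fun y => f y + M) by apply: bmfD => //; exact: bmf_cst.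
suff : \int[kernel_law (P (s + t)) x]_y (f y + M) =
       \int[kernel_law (P s) x]_y \int[kernel_law (P t) y]_z (f z + M).
  rewrite ED//; last exact: bmf_cst.
  rewrite Ecst; under [in RHS]eq_Rintegral.
    by move=> y _; rewrite ED//; [rewrite Ecst; over|exact: bmf_cst].
  by rewrite ED//; [rewrite Ecst => /addIr|exact: bmf_cst].
rewrite /Rintegral; congr fine.
rewrite (eq_measure_integral (kcomp (P s) (kernel.kernel_snd (P t)) x)); last first.
  by move=> A mA _; rewrite hP.2.
rewrite integral_kcomp//.
- by apply: eq_integral => y _; rewrite -EFin_expectation.
- by move=> y; rewrite lee_fin -lerBlDr sub0r; have := hM y; rewrite ler_norml => /andP[].
- by apply/measurable_EFinP; exact: measurable_funD.
Qed.

End chapman.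

(** * Trigonometric integrals determine a law *)

Section trigonometric_polynomials.
Context (R : realType).

(** The phases make sines superfluous: this family of cosines alone is closed
    under products. *)
Definition trigpoly (f : R -> R) : Prop :=
  exists s : seq (R * R * R),
    forall x, f x = \sum_(p <- s) p.1.1 * cos (p.1.2 * x + p.2).

Lemma trigpoly_cos xi c : trigpoly (fun x => cos (xi * x + c)).
Proof. by exists [:: (1, xi, c)] => x; rewrite big_seq1 mul1r. Qed.

Lemma trigpolyD f g : trigpoly f -> trigpoly g -> trigpoly (fun x => f x + g x).
Proof. by move=> [s hs] [t ht]; exists (s ++ t) => x; rewrite big_cat hs ht. Qed.

Lemma trigpolyZ c f : trigpoly f -> trigpoly (fun x => c * f x).
Proof.
move=> [s hs]; exists [seq (c * p.1.1, p.1.2, p.2) | p <- s] => x.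
by rewrite hs big_map mulr_sumr; apply: eq_bigr => p _; rewrite mulrA.
Qed.

Lemma trigpoly_cst c : trigpoly (fun=> c).
Proof.
by exists [:: (c, 0, 0)] => x; rewrite big_seq1/= mul0r addr0 cos0 mulr1.
Qed.

Lemma trigpolyM f g : trigpoly f -> trigpoly g -> trigpoly (fun x => f x * g x).
Proof.
move=> [s hs] [t ht].
suff h : forall s t : seq (R * R * R), trigpoly (fun x =>
    (\sum_(p <- s) p.1.1 * cos (p.1.2 * x + p.2)) *
    (\sum_(p <- t) p.1.1 * cos (p.1.2 * x + p.2))).
  by have [u hu] := h s t; exists u => x; rewrite hs ht hu.
move=> {f g hs ht t} {}s t; elim: s => [|[[a xi] c] s IHs].
  have [u hu] := trigpoly_cst 0; exists u => x.
  by rewrite big_nil mul0r -hu.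
suff h1 : trigpoly (fun x => a * cos (xi * x + c) *
    (\sum_(p <- t) p.1.1 * cos (p.1.2 * x + p.2))).
  have [u hu] := trigpolyD h1 IHs; exists u => x.
  by rewrite big_cons mulrDl -hu.
elim: t {IHs} => [|[[a' xi'] c'] t IHt].
  have [u hu] := trigpoly_cst 0; exists u => x.
  by rewrite big_nil mulr0 -hu.
have h2 := trigpolyD (trigpolyZ (a * a' / 2) (trigpoly_cos (xi + xi') (c + c')))
  (trigpolyZ (a * a' / 2) (trigpoly_cos (xi - xi') (c - c'))).
have [u hu] := trigpolyD h2 IHt; exists u => x.
rewrite -hu big_cons mulrDr/=; congr (_ + _).
rewrite (_ : (xi + xi') * x + _ = (xi * x + c) + (xi' * x + c')); last by ring.
rewrite (_ : (xi - xi') * x + _ = (xi * x + c) - (xi' * x + c')); last by ring.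
by move: (xi * x + c) (xi' * x + c') => u' v'; rewrite cosD cosB; field.
Qed.

Lemma trigpolyX f n : trigpoly f -> trigpoly (fun x => f x ^+ n).
Proof.
move=> hf; elim: n => [|n IHn].
  have [u hu] := trigpoly_cst 1; exists u => x; by rewrite expr0 -hu.
have [u hu] := trigpolyM hf IHn; exists u => x; by rewrite exprS -hu.
Qed.

(** Polynomials converging boundedly, for [|y| <= 1], to the indicator of [y < 0].
    With [v = (1 + y) / 2], the factor [(1 - v^n)^(2^n)] tends to [1] or [0]
    according to whether [2 v < 1] or [2 v > 1], by the Bernoulli inequality.  The
    last factor settles the threshold [y = 0], where it vanishes, and tends to
    [1] everywhere else. *)
Definition step_poly (n : nat) (y : R) : R :=
  (1 - ((1 + y) / 2) ^+ n) ^+ (2 ^ n) * (1 - (1 - y ^+ 2) ^+ n).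

Lemma bernoulli_inequality (u : R) n : -1 <= u -> 1 + n%:R * u <= (1 + u) ^+ n.
Proof.
move=> u1; elim: n => [|n IHn]; first by rewrite mul0r addr0 expr0.
rewrite exprS; apply: (@le_trans _ _ ((1 + u) * (1 + n%:R * u))).
  rewrite -subr_ge0 [X in 0 <= X](_ : _ = n%:R * u ^+ 2); last first.
    by rewrite -natr1; ring.
  by rewrite mulr_ge0// sqr_ge0.
by rewrite ler_wpM2l// -lerBlDl sub0r.
Qed.

Lemma step_poly_itv n y : -1 <= y <= 1 -> 0 <= step_poly n y <= 1.
Proof.
move=> /andP[y1 y2].
have v01 : 0 <= (1 + y) / 2 <= 1 by lra.
have w01 : 0 <= 1 - y ^+ 2 <= 1.
  by rewrite -[y]opprK; apply/andP; split; nra.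
have vn : 0 <= ((1 + y) / 2) ^+ n <= 1.
  by case/andP: v01 => v0 v1; rewrite exprn_ge0//= exprn_ile1.
have wn : 0 <= (1 - y ^+ 2) ^+ n <= 1.
  by case/andP: w01 => v0 v1; rewrite exprn_ge0//= exprn_ile1.
have p0 : 0 <= 1 - ((1 + y) / 2) ^+ n <= 1 by lra.
have q0 : 0 <= 1 - (1 - y ^+ 2) ^+ n <= 1 by lra.
case/andP: p0 => p0 p1; case/andP: q0 => q0 q1.
rewrite /step_poly mulr_ge0//= ?exprn_ge0//.
by rewrite mulr_ile1// ?exprn_ge0// exprn_ile1.
Qed.

Lemma step_poly_cvg (y : R) : -1 <= y <= 1 ->
  step_poly n y @[n --> \oo] --> ((y < 0)%R%:R : R).
Proof.
move=> /andP[y1 y2]; have [y0|y0|->] := ltgtP y 0; last 1 first.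
- rewrite (_ : (fun n => _) = cst (0 : R)); first exact: cvg_cst.
  by apply/funext => n; rewrite /step_poly expr0n/= subr0 expr1n subrr mulr0.
- rewrite -[X in _ --> X](_ : 1 * (1 - 0) = 1); last by rewrite subr0 mulr1.
  apply: cvgM.
    apply: (@squeeze_cvgr _ _ _ _ (fun n => 1 - (1 + y) ^+ n) (cst 1)); last 2 first.
    + rewrite -[X in _ --> X](subr0 1); apply: cvgB; first exact: cvg_cst.
      by apply: cvg_expr; rewrite ger0_norm; lra.
    + exact: cvg_cst.
    apply: nearW => n.
    have v01 : 0 <= ((1 + y) / 2) ^+ n <= 1.
      by rewrite exprn_ge0/= ?exprn_ile1//; lra.
    apply/andP; split; last by rewrite exprn_ile1//; lra.
    have := @bernoulli_inequality (- ((1 + y) / 2) ^+ n) (2 ^ n) _.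
    rewrite mulrN natrX -exprMn (_ : 2 * _ = 1 + y); last by field.
    apply; lra.
  apply: cvgB; first exact: cvg_cst.
  apply: cvg_expr; rewrite ger0_norm; nra.
- pose r := (1 + y)^-1.
  have r0 : 0 < r by rewrite invr_gt0; lra.
  have r1 : r < 1 by rewrite invf_lt1; lra.
  apply: (@squeeze_cvgr _ _ _ _ (cst 0) (fun n => r ^+ n)); last 2 first.
  + exact: cvg_cst.
  + by apply: cvg_expr; rewrite ger0_norm// ltW.
  apply: nearW => n.
  have /andP[s0 _] : 0 <= step_poly n y <= 1 by apply: step_poly_itv; rewrite y1.
  rewrite s0/=.
  have v01 : 0 <= ((1 + y) / 2) ^+ n <= 1.
    by rewrite exprn_ge0/= ?exprn_ile1//; lra.
  have w01 : 0 <= (1 - y ^+ 2) ^+ n <= 1.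
    by rewrite exprn_ge0/= ?exprn_ile1//; nra.
  set v := (_ / 2) ^+ n in v01 *.
  apply: (@le_trans _ _ ((1 - v) ^+ (2 ^ n))).
    rewrite /step_poly -/v ler_piMr// ?exprn_ge0//; lra.
  rewrite /r exprVn -[leRHS]mul1r ler_pdivlMr ?exprn_gt0//; last lra.
  apply: (@le_trans _ _ ((1 - v) ^+ (2 ^ n) * (1 + v) ^+ (2 ^ n))).
    rewrite ler_wpM2l ?exprn_ge0//; first lra.
    have := @bernoulli_inequality v (2 ^ n) _.
    rewrite natrX /v -exprMn (_ : 2 * _ = 1 + y); last by field.
    by move=> h; apply: le_trans (h _); [lra|rewrite -/v; lra].
  rewrite -exprMn exprn_ile1//; nra.
Qed.

End trigonometric_polynomials.

Section uniqueness.
Context (R : realType) (m1 m2 : probability (measurableTypeR R) R).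
Hypothesis trig12 : forall xi c : R,
  \int[m1]_x cos (xi * x + c) = \int[m2]_x cos (xi * x + c).

Let agree (f : measurableTypeR R -> R) := bounded_mfun f /\ \int[m1]_x f x = \int[m2]_x f x.

Lemma bmf_cos xi c : bounded_mfun (fun x : measurableTypeR R => cos (xi * x + c)).
Proof.
split; last by exists 1 => x; exact: cos_max.
apply: continuous_measurable_fun => x.
apply: continuous_comp; last exact: continuous_cos.
by apply: cvgD; [apply: cvgM; [exact: cvg_cst|exact: cvg_id]|exact: cvg_cst].
Qed.

Let agree_trigpoly f : trigpoly f -> agree f.
Proof.
move=> [s hs]; rewrite (_ : f = fun x => \sum_(p <- s) p.1.1 * cos (p.1.2 * x + p.2)); last first.
  by apply/funext => x; rewrite hs.
elim: s {hs} => [|[[a xi] c] s [b IHs]].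
  rewrite (_ : (fun x => _) = fun=> 0); last by apply/funext => x; rewrite big_nil.
  by split; [exact: bmf_cst|rewrite !Ecst].
rewrite (_ : (fun x => _) = fun x => a * cos (xi * x + c) +
   \sum_(p <- s) p.1.1 * cos (p.1.2 * x + p.2)); last first.
  by apply/funext => x; rewrite big_cons.
have b1 : bounded_mfun (fun x : measurableTypeR R => a * cos (xi * x + c)).
  by apply: bmfM; [exact: bmf_cst|exact: bmf_cos].
split; first exact: bmfD.
by rewrite !ED// IHs !EZ ?trig12//; exact: bmf_cos.
Qed.

Let agree_cvg (f_ : nat -> R -> R) f :
  (forall n, agree (f_ n)) -> (forall n x, `|f_ n x| <= 1) ->
  (forall x, f_ n x @[n --> \oo] --> f x) -> agree f.
Proof.
move=> af f1 cf.
have mf n : measurable_fun [set: measurableTypeR R] (f_ n) by have [[]] := af n.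
have [bf c1] := @Edominated_cvg _ _ _ m1 f_ f 1 mf f1 cf.
have [_ c2] := @Edominated_cvg _ _ _ m2 f_ f 1 mf f1 cf.
split => //.
have e : (fun n => \int[m1]_x f_ n x) = (fun n => \int[m2]_x f_ n x).
  by apply/funext => n; exact: (af n).2.
by rewrite e in c1; exact: (cvg_unique _ c1 c2).
Qed.

(** A polynomial in a sine is a trigonometric polynomial, so that the step
    polynomials lead to the indicator of the set where the sine is negative. *)
Let agree_sin_lt0 (a : R) (N : nat) :
  agree (fun x => (sin ((x - a) / N.+1%:R) < 0)%R%:R).
Proof.
apply: (@agree_cvg (fun n x => step_poly n (sin ((x - a) / N.+1%:R)))).
- move=> n; apply: agree_trigpoly.
  have ts : trigpoly (fun x : R => sin ((x - a) / N.+1%:R)).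
    have [u hu] := trigpoly_cos (N.+1%:R^-1 : R) (- a / N.+1%:R - pi / 2).
    exists u => x; rewrite -hu -cosBpihalf; congr cos; ring.
  rewrite /step_poly; apply: trigpolyM.
    apply: (@trigpolyX _ (fun x => 1 - ((1 + sin ((x - a) / N.+1%:R)) / 2) ^+ n)).
    have h1 := trigpolyZ (2^-1) (trigpolyD (trigpoly_cst 1) ts).
    have := trigpolyD (trigpoly_cst 1) (trigpolyZ (-1) (trigpolyX n h1)).
    move=> [u hu]; exists u => x; rewrite -hu mulN1r; congr (1 - _ ^+ _).
    by rewrite mulrC.
  have h1 := trigpolyD (trigpoly_cst 1) (trigpolyZ (-1) (trigpolyX 2 ts)).
  have := trigpolyD (trigpoly_cst 1) (trigpolyZ (-1) (trigpolyX n h1)).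
  by move=> [u hu]; exists u => x; rewrite -hu !mulN1r.
- move=> n x; have /andP[h1 h2] : 0 <= step_poly n (sin ((x - a) / N.+1%:R)) <= 1.
    by apply: step_poly_itv; rewrite sin_geN1 sin_le1.
  by rewrite ger0_norm.
- by move=> x; apply: step_poly_cvg; rewrite sin_geN1 sin_le1.
Qed.

(** As [N] grows, [(x - a) / N.+1] enters the interval around [0] on which the
    sine has the sign of its argument. *)
Let agree_ray (a : R) : agree (fun x => (x < a)%R%:R).
Proof.
apply: (@agree_cvg (fun N x => (sin ((x - a) / N.+1%:R) < 0)%R%:R)).
- by move=> N; exact: agree_sin_lt0.
- by move=> N x; case: (_ < _); rewrite ?normr1 ?normr0.
- move=> x; apply: cvg_near_cst.
  near=> N.
  have N0 : 0 < N.+1%:R :> R by [].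
  have hN : `|x - a| / N.+1%:R < 2.
    rewrite ltr_pdivrMr// (@lt_le_trans _ _ (N.+1%:R))//; last first.
      by rewrite ler_peMl// ler1n.
    near: N; have := nbhs_infty_gtr `|x - a|; apply: filterS => k /lt_le_trans.
    by apply; rewrite ler_nat.
  have [xa|xa|->] := ltgtP x a; last by rewrite subrr mul0r sin0 ltxx.
  - rewrite -[x - a]opprB mulNr sinN oppr_lt0 sin2_gt0// divr_gt0 ?subr_gt0//=.
    by move: hN; rewrite distrC gtr0_norm// subr_gt0.
  - apply/eqP; rewrite eqr_nat eqb0 -leNgt ltW// sin2_gt0// divr_gt0 ?subr_gt0//=.
    by move: hN; rewrite gtr0_norm// subr_gt0.
Unshelve. all: by end_near. Qed.

(** The functions with the same integral under both laws include the
    trigonometric polynomials and are stable under bounded pointwise limits.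
    They thus include the indicators of open half-lines, a pi-system that
    generates the Borel sets. *)
Lemma trig_unique (A : set (measurableTypeR R)) : measurable A -> m1 A = m2 A.
Proof.
apply: (@measure_unique _ R (measurableTypeR R) (@RGenInftyO.G R)
  (fun n => `]-oo, n%:R[%classic) _ _ _ _ m1 m2).
- exact: RGenInftyO.measurableE.
- move=> _ _ [x ->] [y ->]; exists (Num.min x y).
  by apply/seteqP; split => z /=; rewrite !in_itv/= lt_min => /andP.
- by move=> n; exists n%:R.
- apply/seteqP; split => // x _; near \oo => n; exists n => //=.
  by rewrite in_itv/=; near: n; exact: nbhs_infty_gtr.
- move=> _ [a ->].
  have [_ h] := agree_ray a.
  have e (m : probability (measurableTypeR R) R) :
      m `]-oo, a[%classic = (\int[m]_x (x < a)%R%:R)%:E.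
    rewrite -EFin_expectation.
      rewrite (_ : (fun x => _) = (fun x => (\1_(`]-oo, a[%classic : set R) x)%:E)).
        by rewrite integral_indic// setIT.
      apply/funext => x; rewrite indicE; congr ((nat_of_bool _)%:R%:E).
      by apply/idP/idP; rewrite inE/= in_itv/=.
    exact: (agree_ray a).1.
  exact: etrans (e m1) (etrans (congr1 EFin h) (esym (e m2))).
- move=> n; rewrite (@le_lt_trans _ _ 1%E) ?ltry//.
  exact: probability_le1.
Unshelve. all: by end_near. Qed.

End uniqueness.

(** * Trigonometric bounds and the damping factor *)

Section trig_bounds.
Context (R : realType).
Implicit Types x y xi c z delta : R.

Lemma normsq x : `|x| ^+ 2 = x ^+ 2.
Proof. by rewrite real_normK// num_real. Qed.

Lemma mvt_from0 (f df : R -> R) x : (forall y, is_derive y 1 f (df y)) ->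
  exists2 c, `|c| <= `|x| & f x - f 0 = df c * x.
Proof.
move=> h.
have ct : continuous f.
  by move=> y; apply/differentiable_continuous/derivable1_diffP; case: (h y).
have [x0|x0] := leP 0 x.
  have [c|c xc ->] := @MVT_segment R f df 0 x x0 (fun y _ => h y).
    exact: continuous_subspaceT.
  rewrite subr0; exists c => //.
  by move: xc; rewrite in_itv/= => /andP[c0 cx]; rewrite !ger0_norm.
have [c|c xc] := @MVT_segment R f df x 0 (ltW x0) (fun y _ => h y).
  exact: continuous_subspaceT.
rewrite sub0r mulrN => e; exists c; last by rewrite -[LHS]opprB e opprK.
move: xc; rewrite in_itv/= => /andP[cx c0].
by rewrite !ler0_norm ?lerN2// ltW.
Qed.

Lemma ler_norm_sin x : `|sin x| <= `|x|.
Proof.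
have [c _] := @mvt_from0 sin cos x (fun y => is_derive_sin y).
rewrite sin0 subr0 => ->; rewrite normrM ler_piMl//; exact: cos_max.
Qed.

Lemma cosB1_le x : `|cos x - 1| <= x ^+ 2.
Proof.
have e : cos x - 1 = - (sin (x / 2) ^+ 2 *+ 2).
  rewrite {1}(_ : x = (x / 2) *+ 2); last by rewrite -mulr_natr; field.
  by rewrite cos_mulr2n sin2cos2; ring.
rewrite e normrN ger0_norm ?mulrn_wge0 ?sqr_ge0//.
rewrite -(normsq (sin _)) -[x ^+ 2]normsq.
have := ler_norm_sin (x / 2).
rewrite normrM [`|2^-1|]ger0_norm ?invr_ge0//.
have := normr_ge0 (sin (x / 2)); have := normr_ge0 x; rewrite mulr2n.
move: `|sin _| `|x| => a b b0 a0 h.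
have : a ^+ 2 <= (b / 2) ^+ 2 by rewrite lerXn2r ?nnegrE ?divr_ge0.
by rewrite exprMn exprVn; nra.
Qed.

Lemma cosB1_norm_le x : `|cos x - 1| <= `|x|.
Proof.
have [c _] := @mvt_from0 cos (fun y => - sin y) x (fun y => is_derive_cos y).
rewrite cos0 => ->; rewrite normrM ler_piMl// normrN; exact: sin_max.
Qed.

Lemma sinBid_le x : `|sin x - x| <= x ^+ 2.
Proof.
have [c cx] := @mvt_from0 (fun y => sin y - y) (fun y => cos y - 1) x
  (fun y => is_deriveB (is_derive_sin y) (is_derive_id y 1)).
rewrite sin0 !subr0 => ->; rewrite normrM -[leRHS]normsq expr2.
by rewrite ler_wpM2r// (le_trans (cosB1_norm_le c)).
Qed.

Lemma ler_cosB x y : `|cos x - cos y| <= `|x - y|.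
Proof.
have h (t : R) : is_derive t 1 (fun t => cos (t + y)) (- sin (t + y)).
  have := @is_derive1_comp _ cos (fun t => t + y) t (- sin (t + y)) 1.
  by rewrite mulr1; apply; exact: is_derive_shift.
have [c _] := mvt_from0 (x - y) h.
by rewrite subrK add0r => ->; rewrite normrM ler_piMl// normrN sin_max.
Qed.

End trig_bounds.

Section damped_cosine.
Context (R : realType).
Implicit Types x y xi c z delta : R.

(** The factor that brings a cosine into [C_0^2].  It tends to [1] as [delta]
    tends to [0], and its first two derivatives are at most [delta] and
    [4 * delta ^+ 2] times the factor itself, so that they disappear in the
    limit, uniformly in [x]. *)
Definition damping delta x : R := (1 + (delta * x) ^+ 2)^-1.

Lemma damping_den delta x : 1 <= 1 + (delta * x) ^+ 2.
Proof. by rewrite lerDl sqr_ge0. Qed.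

Lemma damping_gt0 delta x : 0 < damping delta x.
Proof. by rewrite invr_gt0 (lt_le_trans _ (damping_den delta x)). Qed.

Lemma damping_le1 delta x : damping delta x <= 1.
Proof. by rewrite invf_le1 ?damping_den// (lt_le_trans _ (damping_den delta x)). Qed.

(** [2 |y| <= 1 + y^2] at [y = delta * x]; all bounds on the increments of the
    damping factor reduce to this one. *)
Lemma damping_lin delta x : `|2 * (delta * x) * damping delta x| <= 1.
Proof.
rewrite !normrM (ger0_norm (ltW (damping_gt0 _ _))) ger0_norm//.
rewrite ler_pdivrMr ?mul1r; last by rewrite (lt_le_trans _ (damping_den delta x)).
rewrite -normrM -normsq; have : 0 <= (`|delta * x| - 1) ^+ 2 by rewrite sqr_ge0.
nra.
Qed.

Definition damping' delta x : R := - (2 * delta ^+ 2 * x) * damping delta x ^+ 2.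

Definition damping'' delta x : R :=
  - (2 * delta ^+ 2) * damping delta x ^+ 2
  + 8 * delta ^+ 4 * x ^+ 2 * damping delta x ^+ 3.

Lemma is_derive_damping delta x : is_derive x 1 (damping delta) (damping' delta x).
Proof.
have h : is_derive x 1 (fun y => 1 + (delta * y) ^+ 2) (2 * delta ^+ 2 * x).
  apply: is_derive_eq; rewrite /GRing.scale/= ?mulr1 ?add0r ?expr1; ring.
have nz : 1 + (delta * x) ^+ 2 != 0.
  by rewrite gt_eqF// (lt_le_trans _ (damping_den delta x)).
have := @is_deriveV _ (fun y => 1 + (delta * y) ^+ 2) x _ _ nz h.
rewrite /damping' /damping /GRing.scale/= exprVn => H.
apply: is_derive_eq; ring.
Qed.

Lemma is_derive_damping' delta x : is_derive x 1 (damping' delta) (damping'' delta x).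
Proof.
have h := is_derive_damping delta x.
rewrite /damping'; apply: is_derive_eq.
rewrite /damping'' /GRing.scale/= /damping'; ring.
Qed.

Lemma damping'_le delta x : 0 <= delta -> `|damping' delta x| <= delta * damping delta x.
Proof.
move=> d0.
rewrite (_ : damping' delta x =
   - (delta * damping delta x * (2 * (delta * x) * damping delta x))); last first.
  rewrite /damping'; ring.
have p0 := damping_gt0 delta x.
rewrite normrN normrM ger0_norm; last by rewrite mulr_ge0// ltW.
by rewrite ler_piMr ?damping_lin// mulr_ge0// ltW.
Qed.

Lemma damping''_le delta x : 0 <= delta -> `|damping'' delta x| <=
  4 * delta ^+ 2 * damping delta x.
Proof.
move=> d0.
rewrite (_ : damping'' delta x = 2 * delta ^+ 2 * damping delta x *
   ((2 * (delta * x) * damping delta x) ^+ 2 - damping delta x)); last first.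
  rewrite /damping''; ring.
have p0 := damping_gt0 delta x; have p1 := damping_le1 delta x.
have d2 : 0 <= delta ^+ 2 by rewrite sqr_ge0.
have l : (2 * (delta * x) * damping delta x) ^+ 2 <= 1.
  rewrite -normsq -[leRHS](expr1n _ 2) lerXn2r ?nnegrE//; exact: damping_lin.
have l0 : 0 <= (2 * (delta * x) * damping delta x) ^+ 2 by rewrite sqr_ge0.
rewrite normrM ger0_norm; last by rewrite !mulr_ge0// ltW.
rewrite [leRHS](_ : _ = 2 * delta ^+ 2 * damping delta x * 2); last ring.
rewrite ler_wpM2l//; first by rewrite !mulr_ge0// ltW.
rewrite ler_norml; lra.
Qed.

Lemma damping_vanishing delta : 0 < delta -> vanishing (damping delta).
Proof.
move=> d0.
have h e x : 0 < e -> e^-1 / delta <= `|x| -> `|0 - damping delta x| <= e.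
  move=> e0 hx; rewrite sub0r normrN (ger0_norm (ltW (damping_gt0 _ _))).
  have x0 : 0 < `|x| by rewrite (lt_le_trans _ hx)// divr_gt0 ?invr_gt0.
  have h1 : 1 <= e * delta * `|x|.
    rewrite -[X in X <= _](_ : e * delta * (e^-1 / delta) = 1); last by field; rewrite !gt_eqF.
    by rewrite ler_wpM2l// mulr_ge0// ltW.
  have := damping_lin delta x; rewrite -mulrA normrM ger0_norm//.
  rewrite !normrM (gtr0_norm d0) (gtr0_norm (damping_gt0 delta x)).
  have := damping_gt0 delta x; move: (damping delta x) `|x| x0 h1 => p y y0 h1 p0 h2.
  rewrite -subr_ge0 -(pmulr_rge0 _ (mulr_gt0 d0 y0)).
  have : delta * y * p <= 1 / 2 by lra.
  nra.
split; apply/cvgrPdist_le => e e0.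
  near=> x; apply: h => //; rewrite ger0_norm; near: x; apply: nbhs_pinfty_ge; exact: num_real.
near=> x; apply: h => //; rewrite ler0_norm.
  rewrite -lerN2 opprK; near: x; apply: nbhs_ninfty_le; exact: num_real.
near: x; apply: nbhs_ninfty_le; exact: num_real.
Unshelve. all: by end_near. Qed.

Lemma dampingB_le delta x z : 0 <= delta ->
  `|damping delta (x + z) - damping delta x| <= delta * `|z|.
Proof.
move=> d0.
have e : damping delta (x + z) - damping delta x = - (delta * z) *
   (2^-1 * (damping delta (x + z) * (2 * (delta * x) * damping delta x) +
            damping delta x * (2 * (delta * (x + z)) * damping delta (x + z)))).
  rewrite /damping; field.
  by rewrite !gt_eqF// (lt_le_trans _ (damping_den _ _)).
rewrite e normrM normrN normrM (ger0_norm d0) ler_piMr ?mulr_ge0//.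
have h1 : `|damping delta (x + z) * (2 * (delta * x) * damping delta x)| <= 1.
  rewrite normrM mulr_ile1// ?damping_lin// ger0_norm ?damping_le1// ltW//.
  exact: damping_gt0.
have h2 : `|damping delta x * (2 * (delta * (x + z)) * damping delta (x + z))| <= 1.
  rewrite normrM mulr_ile1// ?damping_lin// ger0_norm ?damping_le1// ltW//.
  exact: damping_gt0.
by move: h1 h2; rewrite !ler_norml; lra.
Qed.

Lemma damping_taylor delta x z : 0 <= delta ->
  `|damping delta (x + z) - damping delta x - damping' delta x * z| <= 2 * (delta * z) ^+ 2.
Proof.
move=> d0.
have e : damping delta (x + z) - damping delta x - damping' delta x * z =
   (delta * z) * (2 * (delta * x) * damping delta x *
     (damping delta x - damping delta (x + z))) - (delta * z) ^+ 2 *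
     (damping delta x * damping delta (x + z)).
  rewrite /damping' /damping; field.
  by rewrite !gt_eqF// (lt_le_trans _ (damping_den _ _)).
rewrite e.
rewrite (le_trans (ler_normB _ _))//
  [leRHS](_ : _ = `|delta * z| * `|delta * z| + (delta * z) ^+ 2); last first.
  by rewrite -normsq; ring.
rewrite lerD//.
  rewrite normrM ler_wpM2l// normrM (le_trans (ler_piMl _ (damping_lin _ _)))//.
  by rewrite distrC (le_trans (dampingB_le _ _ _))// normrM (ger0_norm d0).
rewrite normrM ger0_norm ?sqr_ge0// ler_piMr ?sqr_ge0//.
rewrite ger0_norm; last by rewrite mulr_ge0// ltW// damping_gt0.
by rewrite mulr_ile1 ?damping_le1// ltW// damping_gt0.
Qed.

End damped_cosine.

(** * The Levy operator on damped cosines *)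

Section damped_cosine_C02.
Context (R : realType).
Implicit Types x y xi c z delta : R.

Definition damped_cos xi c delta x : R := cos (xi * x + c) * damping delta x.

Definition damped_cos' xi c delta x : R :=
  - xi * sin (xi * x + c) * damping delta x + cos (xi * x + c) * damping' delta x.

Definition damped_cos'' xi c delta x : R :=
  - xi ^+ 2 * cos (xi * x + c) * damping delta x
  - 2 * xi * sin (xi * x + c) * damping' delta x
  + cos (xi * x + c) * damping'' delta x.

Lemma is_derive_cosaff xi c x :
  is_derive x 1 (fun x => cos (xi * x + c)) (- xi * sin (xi * x + c)).
Proof.
have h : is_derive x 1 (fun y => xi * y + c) xi.
  by apply: is_derive_eq; rewrite /GRing.scale/= mulr1 addr0.
have := @is_derive1_comp _ cos (fun y => xi * y + c) x (- sin (xi * x + c)) xi _ h.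
by move=> H; apply: is_derive_eq; ring.
Qed.

Lemma is_derive_sinaff xi c x :
  is_derive x 1 (fun x => sin (xi * x + c)) (xi * cos (xi * x + c)).
Proof.
have h : is_derive x 1 (fun y => xi * y + c) xi.
  by apply: is_derive_eq; rewrite /GRing.scale/= mulr1 addr0.
have := @is_derive1_comp _ sin (fun y => xi * y + c) x (cos (xi * x + c)) xi _ h.
by move=> H; apply: is_derive_eq; ring.
Qed.

Lemma is_derive_damped_cos xi c delta x :
  is_derive x 1 (damped_cos xi c delta) (damped_cos' xi c delta x).
Proof.
have h1 := is_derive_cosaff xi c x; have h2 := is_derive_damping delta x.
rewrite /damped_cos; apply: is_derive_eq; rewrite /damped_cos' /GRing.scale/=; ring.
Qed.

Lemma is_derive_damped_cos' xi c delta x :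
  is_derive x 1 (damped_cos' xi c delta) (damped_cos'' xi c delta x).
Proof.
have h1 := is_derive_cosaff xi c x; have h2 := is_derive_damping delta x.
have h3 := is_derive_sinaff xi c x; have h4 := is_derive_damping' delta x.
rewrite /damped_cos'; apply: is_derive_eq; rewrite /damped_cos'' /GRing.scale/=; ring.
Qed.

Lemma derivable_damped_cos'' xi c delta x : derivable (damped_cos'' xi c delta) x 1.
Proof.
have h1 := is_derive_cosaff xi c x; have h2 := is_derive_damping delta x.
have h3 := is_derive_sinaff xi c x; have h4 := is_derive_damping' delta x.
have [v h5] : exists v, is_derive x 1 (damping'' delta) v.
  by eexists; rewrite /damping''; apply: is_derive_eq.
have [w h6] : exists w, is_derive x 1 (damped_cos'' xi c delta) w.
  by eexists; rewrite /damped_cos''; apply: is_derive_eq.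
by case: h6.
Qed.

Lemma derive1_damped_cos xi c delta : derive1 (damped_cos xi c delta) = damped_cos' xi c delta.
Proof.
apply/funext => x; rewrite derive1E.
exact: (@derive_val _ _ _ _ _ _ _ (is_derive_damped_cos xi c delta x)).
Qed.

Lemma derive1_damped_cos' xi c delta : derive1 (damped_cos' xi c delta) = damped_cos'' xi c delta.
Proof.
apply/funext => x; rewrite derive1E.
exact: (@derive_val _ _ _ _ _ _ _ (is_derive_damped_cos' xi c delta x)).
Qed.

Lemma vanishing_dominated delta (K : R) (g : R -> R) : 0 < delta ->
  (forall x, `|g x| <= K * damping delta x) -> vanishing g.
Proof.
move=> d0 gK; have [vp vn] := damping_vanishing d0.
have KD (F : set_system R) : Filter F -> damping delta y @[y --> F] --> (0 : R) ->
    g y @[y --> F] --> (0 : R).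
  move=> FF h; apply: (@squeeze_cvgr _ _ _ _ (fun y => - (K * damping delta y))
    (fun y => K * damping delta y)).
  - by apply: nearW => y; rewrite -ler_norml.
  - by rewrite -oppr0 -[X in - X](mulr0 K); apply: cvgN; apply: cvgM => //; exact: cvg_cst.
  - by rewrite -[X in _ --> X](mulr0 K); apply: cvgM => //; exact: cvg_cst.
by split; apply: KD.
Qed.

Lemma C02_damped_cos xi c delta : 0 < delta -> C02 (damped_cos xi c delta).
Proof.
move=> d0.
have e2 : derive1n 2 (damped_cos xi c delta) = damped_cos'' xi c delta.
  by rewrite /derive1n/= derive1_damped_cos derive1_damped_cos'.
have d0' := ltW d0.
split.
- by move=> x; by case: (is_derive_damped_cos xi c delta x).
- by move=> x; rewrite derive1_damped_cos; by case: (is_derive_damped_cos' xi c delta x).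
- rewrite e2 => x; apply/differentiable_continuous/derivable1_diffP.
  exact: derivable_damped_cos''.
rewrite e2 derive1_damped_cos.
have p0 x := damping_gt0 delta x.
have hcos x : `|cos (xi * x + c)| <= 1 by exact: cos_max.
have hsin x : `|sin (xi * x + c)| <= 1 by exact: sin_max.
have hcs (a k : R) t : `|t| <= 1 -> `|a| <= k -> `|t * a| <= k.
  by move=> t1 ak; rewrite normrM (le_trans _ ak)// ler_piMl.
split.
- apply: (@vanishing_dominated delta 1) => // x; rewrite mul1r; apply: hcs => //.
  by rewrite ger0_norm// ltW.
- apply: (@vanishing_dominated delta (`|xi| + delta)) => // x.
  rewrite (le_trans (ler_normD _ _))// [leRHS]mulrDl lerD//.
    rewrite mulrAC mulrC; apply: hcs => //.
    by rewrite normrM normrN (gtr0_norm (p0 x)).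
  by apply: hcs => //; exact: damping'_le.
- apply: (@vanishing_dominated delta (xi ^+ 2 + 2 * `|xi| * delta + 4 * delta ^+ 2)) => // x.
  rewrite (le_trans (ler_normD _ _))// [leRHS]mulrDl lerD//.
    rewrite (le_trans (ler_normB _ _))// [leRHS]mulrDl lerD//.
      rewrite mulrAC mulrC; apply: hcs => //.
      by rewrite normrM normrN (gtr0_norm (p0 x)) ger0_norm// sqr_ge0.
    rewrite mulrAC mulrC; apply: hcs => //.
    by rewrite normrM (normrM 2 xi) [`|2|]ger0_norm// -!mulrA !ler_wpM2l// damping'_le.
  by apply: hcs => //; exact: damping''_le.
Qed.

Definition jump_weight z : R := Num.min 1 (`|z| ^+ 2).

(** The order of the error made, for a jump [z], when the damping factor is
    treated as a constant: [delta z^2] for small jumps, where the compensator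
    leaves second-order terms only, and for large ones the smaller of the
    trivial bound and the Lipschitz bound. *)
Definition cutoff_weight delta z : R := jump_weight z * Num.min 1 (delta * (1 + `|z|)).

Lemma levy_trunc_gt0 z : 0 < levy_trunc z.
Proof. by rewrite invr_gt0 ltr_wpDr// sqr_ge0. Qed.

(** Once the damping factor is frozen at [x], the addition formula splits the
    increment of the cosine into even and odd parts in [z], whose integrals
    are the real and imaginary parts of the Levy exponent.  What remains is an
    increment of the damping factor: Taylor expansion for [|z| <= 1], the
    Lipschitz bound for [|z| > 1]. *)
Lemma damped_cos_increment xi c delta x z : 0 <= delta <= 1 ->
  `| (damped_cos xi c delta (x + z) - damped_cos xi c delta x -
    damped_cos' xi c delta x * z * levy_trunc z)
     - damping delta x * (cos (xi * x + c) * (cos (xi * z) - 1)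
                          - sin (xi * x + c) * (sin (xi * z) - xi * z * levy_trunc z)) |
  <= (3 + `|xi|) * cutoff_weight delta z.
Proof.
move=> /andP[d0 d1].
have e : xi * (x + z) + c = (xi * x + c) + xi * z by ring.
rewrite [X in `|X|](_ : _ = cos (xi * (x + z) + c) * (damping delta (x + z) - damping delta x)
    - cos (xi * x + c) * (damping' delta x * z * levy_trunc z)); last first.
  by rewrite /damped_cos /damped_cos' e cosD; ring.
have dmp' : `|damping' delta x| <= delta.
  by rewrite (le_trans (damping'_le _ _))// ler_piMr// damping_le1.
have h0 := levy_trunc_gt0 z.
have hz : levy_trunc z * (1 + `|z| ^+ 2) = 1.
  by rewrite mulVf// gt_eqF// ltr_wpDr// sqr_ge0.
rewrite /cutoff_weight.
have z0 := normr_ge0 z; have xi0 := normr_ge0 xi.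
have [z1|z1] := leP `|z| 1.
- have -> : jump_weight z = `|z| ^+ 2 by rewrite /jump_weight; apply/min_idPr; rewrite exprn_ile1.
  have dmin : delta <= Num.min 1 (delta * (1 + `|z|)).
    by rewrite le_min d1/= ler_peMr// lerDl.
  apply: (@le_trans _ _ ((3 + `|xi|) * (`|z| ^+ 2 * delta))); last first.
    by rewrite ler_wpM2l ?addr_ge0// ler_wpM2l ?sqr_ge0.
  rewrite (_ : _ - _ = cos (xi * (x + z) + c) *
      (damping delta (x + z) - damping delta x - damping' delta x * z)
    + (cos (xi * (x + z) + c) - cos (xi * x + c)) * (damping' delta x * z)
    + cos (xi * x + c) * (damping' delta x * z * (1 - levy_trunc z))); last by ring.
  rewrite (_ : (3 + _) * _ = 2 * (delta * `|z| ^+ 2) + (`|xi| * `|z|) * (delta * `|z|)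
     + 1 * (delta * `|z| ^+ 2)); last by ring.
  rewrite (le_trans (ler_normD _ _))// lerD//; [rewrite (le_trans (ler_normD _ _))// lerD//|].
  + rewrite normrM (le_trans (ler_piMl _ (cos_max _)))//.
    rewrite (le_trans (damping_taylor _ _ _))// exprMn normsq ler_wpM2l//.
    by rewrite ler_wpM2r ?sqr_ge0// expr2 ler_piMl.
  + rewrite normrM ler_pM//.
      by rewrite (le_trans (ler_cosB _ _))// e addrAC subrr add0r normrM.
    by rewrite normrM ler_wpM2r.
  + rewrite normrM ler_pM// ?cos_max//.
    rewrite (_ : 1 - levy_trunc z = `|z| ^+ 2 * levy_trunc z); last first.
      by rewrite -{1}hz; ring.
    have z2 : 0 <= `|z| ^+ 2 by rewrite sqr_ge0.
    have h1 : 0 <= `|z| ^+ 2 * levy_trunc z by rewrite mulr_ge0// ltW.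
    have h2 : `|z| * (`|z| ^+ 2 * levy_trunc z) <= `|z| ^+ 2.
      by rewrite (le_trans (ler_piMl h1 z1))//; nra.
    by rewrite normrM (ger0_norm h1) normrM -mulrA ler_pM// mulr_ge0.
- have -> : jump_weight z = 1 by rewrite /jump_weight; apply/min_idPl; rewrite exprn_ege1// ltW.
  set k := Num.min _ _.
  have k0 : 0 <= k by rewrite /k le_min ler01/= mulr_ge0// addr_ge0.
  apply: (@le_trans _ _ (k + k)); last first.
    by rewrite mul1r; nra.
  rewrite (le_trans (ler_normB _ _))// lerD//.
    rewrite normrM (le_trans (ler_piMl _ (cos_max _)))//.
    rewrite /k le_min; apply/andP; split.
      have := damping_gt0 delta (x + z); have := damping_le1 delta (x + z).
      have := damping_gt0 delta x; have := damping_le1 delta x.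
      by rewrite ler_norml; lra.
    by rewrite (le_trans (dampingB_le _ _ _))// ler_wpM2l// lerDr.
  rewrite normrM (le_trans (ler_piMl _ (cos_max _)))//.
  rewrite normrM (gtr0_norm h0) normrM -mulrA.
  have zh : `|z| * levy_trunc z <= 1 by nra.
  have zh0 : 0 <= `|z| * levy_trunc z by rewrite mulr_ge0// ltW.
  apply: (@le_trans _ _ delta).
    by rewrite -[leRHS]mulr1 ler_pM.
  by rewrite /k le_min d1/= ler_peMr// lerDl.
Qed.

Lemma cosB1_jump_weight xi z : `|cos (xi * z) - 1| <= (2 + xi ^+ 2) * jump_weight z.
Proof.
have x2 : 0 <= xi ^+ 2 by rewrite sqr_ge0.
rewrite /jump_weight minr_pMr ?addr_ge0// le_min; apply/andP; split.
  rewrite mulr1; have := cos_max (xi * z); rewrite !ler_norml; lra.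
rewrite (le_trans (cosB1_le _))// exprMn normsq.
by rewrite ler_wpM2r ?sqr_ge0// lerDr.
Qed.

Lemma sinB_jump_weight xi z :
  `|sin (xi * z) - xi * z * levy_trunc z| <= (1 + `|xi| + xi ^+ 2) * jump_weight z.
Proof.
have h0 := levy_trunc_gt0 z.
have hz : levy_trunc z * (1 + `|z| ^+ 2) = 1.
  by rewrite mulVf// gt_eqF// ltr_wpDr// sqr_ge0.
have z0 := normr_ge0 z; have xi0 := normr_ge0 xi.
have x2 : 0 <= xi ^+ 2 by rewrite sqr_ge0.
have z2 : 0 <= `|z| ^+ 2 by rewrite sqr_ge0.
have [z1|z1] := leP `|z| 1.
- have -> : jump_weight z = `|z| ^+ 2 by rewrite /jump_weight; apply/min_idPr; rewrite exprn_ile1.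
  rewrite (_ : _ - _ = (sin (xi * z) - xi * z) + xi * z * (`|z| ^+ 2 * levy_trunc z)); last first.
    by rewrite [X in _ + _ * X](_ : _ = 1 - levy_trunc z); [ring|rewrite -{1}hz; ring].
  rewrite (le_trans (ler_normD _ _))//.
  rewrite (_ : (_ + xi ^+ 2) * _ = xi ^+ 2 * `|z| ^+ 2 + (1 + `|xi|) * `|z| ^+ 2); last by ring.
  rewrite lerD//; first by rewrite (le_trans (sinBid_le _))// exprMn normsq.
  rewrite normrM normrM (ger0_norm (mulr_ge0 z2 (ltW h0))).
  apply: (@le_trans _ _ (`|xi| * 1 * (`|z| ^+ 2 * 1))).
    rewrite ler_pM ?mulr_ge0//; first exact: ltW.
      by rewrite ler_wpM2l.
    rewrite ler_wpM2l//; nra.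
  nra.
- have -> : jump_weight z = 1 by rewrite /jump_weight; apply/min_idPl; rewrite exprn_ege1// ltW.
  have zh : `|z| * levy_trunc z <= 1 by nra.
  rewrite (le_trans (ler_normB _ _))// mulr1 -addrA lerD ?sin_max//.
  rewrite normrM (gtr0_norm h0) normrM -mulrA.
  by rewrite (le_trans (ler_piMr _ zh))// lerDl.
Qed.

End damped_cosine_C02.

Section levy_symbol.
Context (R : realType) (nu : {measure set (measurableTypeR R) -> \bar R}).
Hypothesis hnu : levy_measure nu.
Implicit Types x y xi c z delta : R.

(** [symbol_re + i symbol_im] is the Levy exponent: formally, the operator
    multiplies [exp (i xi x)] by it. *)
Definition symbol_re xi : R := \int[nu]_z (cos (xi * z) - 1).
Definition symbol_im xi : R := \int[nu]_z (sin (xi * z) - xi * z * levy_trunc z).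

Lemma measurable_jump_weight : measurable_fun [set: measurableTypeR R] (@jump_weight R).
Proof.
apply: measurable_minr => //.
apply: measurable_funX; exact: (@normr_measurable R setT).
Qed.

Lemma jump_weight_ge0 z : 0 <= jump_weight z.
Proof. by rewrite /jump_weight le_min ler01 sqr_ge0. Qed.

Lemma integrable_jump_weight : nu.-integrable setT (EFin \o @jump_weight R).
Proof.
apply/integrableP; split.
  by apply/measurable_EFinP; exact: measurable_jump_weight.
case: hnu => _; apply: le_lt_trans.
rewrite le_eqVlt; apply/orP; left; apply/eqP; apply: eq_integral => z _ /=.
by rewrite ger0_norm ?jump_weight_ge0.
Qed.

Lemma integrable_le_jump_weight (g : R -> R) (K : R) :
  measurable_fun [set: measurableTypeR R] (g : measurableTypeR R -> _) ->
  (forall z, `|g z| <= K * jump_weight z) -> nu.-integrable setT (EFin \o g).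
Proof.
move=> mg gK.
have iK : nu.-integrable setT (EFin \o (fun z => K * jump_weight z)).
  have := integrableZl measurableT K integrable_jump_weight.
  by apply: eq_integrable => // z _ /=; rewrite EFinM.
apply: le_integrable iK => //; first exact/measurable_EFinP.
by move=> z _ /=; rewrite lee_fin (le_trans (gK z))// ler_norm.
Qed.

Lemma measurable_cosaff xi c :
  measurable_fun [set: measurableTypeR R] (fun z : measurableTypeR R => cos (xi * z + c)).
Proof. by case: (@bmf_cos R xi c). Qed.

Lemma measurable_sinaff xi c :
  measurable_fun [set: measurableTypeR R] (fun z : measurableTypeR R => sin (xi * z + c)).
Proof.
rewrite (_ : (fun z => _) = fun z => cos (xi * z + (c - pi / 2))); first exact: measurable_cosaff.
by apply/funext => z; rewrite -cosBpihalf addrA.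
Qed.

Lemma measurable_levy_trunc : measurable_fun [set: measurableTypeR R] (@levy_trunc R).
Proof.
rewrite (_ : @levy_trunc R = damping 1); last first.
  by apply/funext => z; rewrite /levy_trunc /damping mul1r normsq.
apply: continuous_measurable_fun => z.
apply/differentiable_continuous/derivable1_diffP.
by case: (is_derive_damping 1 z).
Qed.

Lemma integrable_symbol_re xi : nu.-integrable setT (EFin \o (fun z => cos (xi * z) - 1)).
Proof.
apply: (@integrable_le_jump_weight _ (2 + xi ^+ 2)); last exact: cosB1_jump_weight.
apply: measurable_funB => //.
by have := measurable_cosaff xi 0; under eq_fun do rewrite addr0.
Qed.

Lemma integrable_symbol_im xi :
  nu.-integrable setT (EFin \o (fun z => sin (xi * z) - xi * z * levy_trunc z)).
Proof.
apply: (@integrable_le_jump_weight _ (1 + `|xi| + xi ^+ 2)); last exact: sinB_jump_weight.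
apply: measurable_funB; first by have := measurable_sinaff xi 0; under eq_fun do rewrite addr0.
apply: measurable_funM; last exact: measurable_levy_trunc.
exact: measurable_funM.
Qed.

(** The damping parameter runs through [n.+1^-1], a sequence being what dominated
    convergence takes. *)
Definition cutoff_error (n : nat) : R := \int[nu]_z cutoff_weight (n.+1%:R^-1) z.

Lemma measurable_cutoff_weight delta : measurable_fun [set: measurableTypeR R]
  (@cutoff_weight R delta).
Proof.
apply: measurable_funM; first exact: measurable_jump_weight.
apply: measurable_minr => //; apply: measurable_funM => //.
by apply: measurable_funD => //; exact: (@normr_measurable R setT).
Qed.

Lemma cutoff_weight_itv delta z : 0 <= delta -> 0 <= cutoff_weight delta z <= jump_weight z.
Proof.
move=> d0; rewrite /cutoff_weight mulr_ge0 ?jump_weight_ge0//=.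
  by rewrite ler_piMr ?jump_weight_ge0// ge_min lexx.
by rewrite le_min ler01 mulr_ge0// addr_ge0.
Qed.

Lemma integrable_cutoff_weight delta : 0 <= delta ->
  nu.-integrable setT (EFin \o @cutoff_weight R delta).
Proof.
move=> d0; apply: (@integrable_le_jump_weight _ 1); first exact: measurable_cutoff_weight.
by move=> z; have /andP[j0 j1] := cutoff_weight_itv z d0; rewrite mul1r ger0_norm.
Qed.

Lemma cutoff_error_cvg : cutoff_error n @[n --> \oo] --> (0 : R).
Proof.
have d0 n : 0 <= n.+1%:R^-1 :> R by rewrite invr_ge0.
have [||||_ _] := @dominated_convergence _ _ R nu setT measurableT
   (fun n => EFin \o @cutoff_weight R n.+1%:R^-1) (EFin \o cst 0) (EFin \o @jump_weight R) _ _
     _ integrable_jump_weight _.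
- by move=> n; apply/measurable_EFinP; exact: measurable_cutoff_weight.
- exact/measurable_EFinP.
- apply: aeW => z _; apply/cvg_EFin; first exact: nearW.
  rewrite -[X in _ --> X](mulr0 (jump_weight z)); apply: cvgM; first exact: cvg_cst.
  apply: (@squeeze_cvgr _ _ _ _ (cst 0) (fun n => n.+1%:R^-1 * (1 + `|z|))).
  + apply: nearW => n; rewrite le_min ler01 mulr_ge0 ?addr_ge0//=.
    by rewrite ge_min lexx orbT.
  + exact: cvg_cst.
  + rewrite -[X in _ --> X](mul0r (1 + `|z|)); apply: cvgM; last exact: cvg_cst.
    exact: cvg_harmonic.
- apply: aeW => z n _ /=; have /andP[j0 j1] := cutoff_weight_itv z (d0 n).
  by rewrite lee_fin ger0_norm.
rewrite integral0 => /fine_cvg; exact.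
Qed.

(** Integration of [damped_cos_increment] in [z].  The bound is uniform in [x],
    as the comparison with the generator, a uniform limit, requires. *)
Lemma levy_op_damped_cos xi c n x :
  `| levy_op nu (damped_cos xi c (n.+1%:R^-1)) x
     - damping (n.+1%:R^-1) x * (symbol_re xi * cos (xi * x + c) -
       symbol_im xi * sin (xi * x + c)) |
  <= (3 + `|xi|) * cutoff_error n.
Proof.
set delta := n.+1%:R^-1.
have d01 : 0 <= delta <= 1 by rewrite invr_ge0 ler0n/= invf_le1// ler1n.
have /andP[d0 d1] := d01.
set F := fun z => damped_cos xi c delta (x + z) - damped_cos xi c delta x -
  damped_cos' xi c delta x * z * levy_trunc z.
set G := fun z => damping delta x * (cos (xi * x + c) * (cos (xi * z) - 1)
                          - sin (xi * x + c) * (sin (xi * z) - xi * z * levy_trunc z)).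
have iG1 := integrable_symbol_re xi; have iG2 := integrable_symbol_im xi.
have iZ (k : R) g : nu.-integrable setT (EFin \o g) ->
  nu.-integrable setT (EFin \o (fun z => k * g z)).
  by move=> /(integrableZl measurableT k); apply: eq_integrable.
have iB (f g : R -> R) : nu.-integrable setT (EFin \o f) -> nu.-integrable setT (EFin \o g) ->
    nu.-integrable setT (EFin \o (fun z => f z - g z)).
  by move=> h1 h2; have := integrableB measurableT h1 h2; apply: eq_integrable.
have iG : nu.-integrable setT (EFin \o G) by apply: (iZ); apply: iB; exact: iZ.
have eG : \int[nu]_z G z = damping delta x * (symbol_re xi * cos (xi * x + c) -
  symbol_im xi * sin (xi * x + c)).
  rewrite RintegralZl//; last by apply: iB; exact: iZ.
  rewrite RintegralB//; [|exact: iZ..].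
  by rewrite !RintegralZl// ![_ * cos _]mulrC ![_ * sin _]mulrC.
have hFG z : `|F z - G z| <= (3 + `|xi|) * cutoff_weight delta z by exact: damped_cos_increment.
have mF : measurable_fun [set: measurableTypeR R] (F : measurableTypeR R -> _).
  apply: measurable_funB; last first.
    by apply: measurable_funM; [exact: measurable_funM|exact: measurable_levy_trunc].
  apply: measurable_funB => //; apply: continuous_measurable_fun => z.
  apply: (@continuous_comp _ _ _ (fun z => x + z) (damped_cos xi c delta)).
    by apply: cvgD; [exact: cvg_cst|exact: cvg_id].
  apply/differentiable_continuous/derivable1_diffP.
  by case: (is_derive_damped_cos xi c delta (x + z)).
have iFG : nu.-integrable setT (EFin \o (fun z => F z - G z)).
  apply: (@integrable_le_jump_weight _ (3 + `|xi|)).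
    by apply: measurable_funB => //; apply/measurable_EFinP; exact: measurable_int iG.
  move=> z; rewrite (le_trans (hFG z))// ler_wpM2l ?addr_ge0//.
  by have /andP[] := cutoff_weight_itv z d0.
have iF : nu.-integrable setT (EFin \o F).
  have := integrableD measurableT iFG iG; apply: eq_integrable => // z _ /=.
  by rewrite -EFinD subrK.
rewrite -eG /levy_op derive1_damped_cos -/F -RintegralB//.
apply: (le_trans (le_normr_Rintegral measurableT iFG)).
rewrite /cutoff_error -RintegralZl//; last exact: integrable_cutoff_weight.
apply: le_Rintegral => //; first exact: integrable_norm.
by apply: iZ; exact: integrable_cutoff_weight.
Qed.

End levy_symbol.

(** * Trigonometric integrals of the semigroup *)

Section characteristic.
Context (R : realType).
Implicit Types x y xi c z delta a b s h : R.

Lemma discrete_gronwall (N : nat -> R) (q r : R) : 0 <= q -> 0 <= r ->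
  (forall k, N k.+1 <= (1 + q) * N k + r) ->
  forall k, N k <= (1 + q) ^+ k * (N 0%N + k%:R * r).
Proof.
move=> q0 r0 hN; elim=> [|k IHk]; first by rewrite expr0 mul1r mul0r addr0.
rewrite (le_trans (hN k))// exprS -mulrA.
apply: (@le_trans _ _ ((1 + q) * ((1 + q) ^+ k * (N 0%N + k%:R * r)) + r)).
  by rewrite lerD2r ler_wpM2l// addr_ge0.
rewrite -subr_ge0 [X in 0 <= X](_ : _ = r * ((1 + q) ^+ k.+1 - 1)); last first.
  by rewrite -natr1 exprS; ring.
by rewrite mulr_ge0// subr_ge0 exprn_ege1// lerDl.
Qed.

Lemma derive_near0 (f : R -> R) (df e : R) : is_derive (0 : R) 1 f df -> 0 < e ->
  \forall h \near (0 : R)^'+, `|f h - f 0 - h * df| <= e * h.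
Proof.
move=> [/cvg_ex[/= l fl] fdf] e0.
have El : l = df by rewrite -fdf; apply/esym/cvg_lim.
rewrite {}El in fl.
have : h^-1 *: (f (h *: 1 + 0) - f 0) @[h --> (0 : R)^'+] --> df.
  exact: cvg_dnbhs_at_right.
move=> /cvgrPdist_le /(_ e e0); apply: filter_app.
near=> h => H.
have h0 : 0 < h by near: h; exact: nbhs_right_gt.
move: H; rewrite addr0 /GRing.scale/= mulr1 => H.
rewrite (_ : _ - _ = - h * (df - h^-1 * (f h - f 0))); last by field; rewrite gt_eqF.
by rewrite normrM normrN (gtr0_norm h0) [leRHS]mulrC ler_wpM2l// ltW.
Unshelve. all: by end_near. Qed.

(** The real part of [exp (i y + s (a + i b))].  Adding [pi / 2] to the phase
    [y] amounts to multiplication by [i], which keeps the whole argument over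
    the reals: [(W_y)' = a W_y + b W_(y + pi/2)]. *)
Definition char_flow a b y s : R := expR (a * s) * cos (y + b * s).

(** The error of an Euler step does not depend on [y] or [s]: the flow is a
    contraction for [a <= 0], so it suffices to expand at [s = 0]. *)
Lemma char_flow_step a b (e : R) : a <= 0 -> 0 < e ->
  \forall h \near (0 : R)^'+, forall y s, 0 <= s ->
    `|char_flow a b y (s + h) - char_flow a b y s -
      h * (a * char_flow a b y s + b * char_flow a b (y + pi / 2) s)| <= e * h.
Proof.
move=> a0 e0.
have e2 : 0 < e / 2 by rewrite divr_gt0.
have d1 : is_derive (0 : R) 1 (fun h => expR (a * h) * cos (b * h)) a.
  apply: is_derive_eq; rewrite /GRing.scale/= !mulr0 cos0 sin0 expR0; ring.
have d2 : is_derive (0 : R) 1 (fun h => expR (a * h) * sin (b * h)) b.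
  apply: is_derive_eq; rewrite /GRing.scale/= !mulr0 cos0 sin0 expR0; ring.
have n1 := derive_near0 d1 e2; have n2 := derive_near0 d2 e2.
near=> h => y s s0.
have H1 : `|expR (a * h) * cos (b * h) - expR (a * 0) * cos (b * 0) - h * a| <= e / 2 * h.
  by near: h.
have H2 : `|expR (a * h) * sin (b * h) - expR (a * 0) * sin (b * 0) - h * b| <= e / 2 * h.
  by near: h.
move: H1 H2; rewrite !mulr0 expR0 cos0 sin0 mulr1 mulr0 subr0 => H1 H2.
have -> : char_flow a b y (s + h) - char_flow a b y s -
      h * (a * char_flow a b y s + b * char_flow a b (y + pi / 2) s) =
   expR (a * s) * (cos (y + b * s) * (expR (a * h) * cos (b * h) - 1 - h * a)
    - sin (y + b * s) * (expR (a * h) * sin (b * h) - h * b)).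
  rewrite /char_flow (_ : y + pi / 2 + b * s = y + b * s + pi / 2); last by ring.
  rewrite (_ : y + b * (s + h) = (y + b * s) + b * h); last by ring.
  rewrite cosDpihalf cosD (mulrDr a) expRD; ring.
rewrite normrM ger0_norm ?expR_ge0//.
have as0 : expR (a * s) <= 1 by rewrite expR_le1 mulr_le0_ge0.
rewrite (le_trans (ler_piMl _ as0))// (le_trans (ler_normB _ _))//.
rewrite [leRHS](_ : _ = e / 2 * h + e / 2 * h); last by field.
by rewrite lerD// normrM; [rewrite (le_trans (ler_piMl _ (cos_max _)))|rewrite
  (le_trans (ler_piMl _ (sin_max _)))].
Unshelve. all: by end_near. Qed.

End characteristic.

Section characteristic_function.
Context (R : realType) (nu : {measure set (measurableTypeR R) -> \bar R})
    (P : R -> R.-pker (measurableTypeR R) ~> (measurableTypeR R)).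
Hypotheses (hnu : levy_measure nu) (hP : markov_semigroup P)
    (hgen : has_generator P (levy_op nu)).
Implicit Types (x y xi c s t h : R).

Lemma bmf_damped_cos xi c delta : bounded_mfun (damped_cos xi c delta : measurableTypeR R -> R).
Proof.
split.
  apply: continuous_measurable_fun => z.
  apply/differentiable_continuous/derivable1_diffP.
  by case: (is_derive_damped_cos xi c delta z).
exists 1 => x; rewrite /damped_cos normrM mulr_ile1// ?cos_max//.
by rewrite ger0_norm ?damping_le1// ltW// damping_gt0.
Qed.

Lemma symbol_re_le0 xi : symbol_re nu xi <= 0.
Proof.
have -> : (0 : R) = \int[nu]_z 0 by rewrite Rintegral_cst// mul0r.
apply: le_Rintegral => //.
- exact: integrable_symbol_re.
- exact: integrable0.
Qed.

Let delta n : R := n.+1%:R^-1.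
Let delta_gt0 n : 0 < delta n. Proof. by rewrite invr_gt0. Qed.

(** The damped counterpart of the integral to be computed. *)
Let A n xi c x s := \int[kernel_law (P s) x]_y damped_cos xi c (delta n) y.

(** By the semigroup property, the increment of [A] over [h] is the expectation
    under [P s x] of a difference quotient that the generator controls
    uniformly in the starting point: [A] takes Euler steps of the same linear
    system as [char_flow], up to the cutoff error. *)
Let A_step n xi c (e : R) : 0 < e ->
  \forall h \near (0 : R)^'+, forall x s, 0 <= s ->
  `|A n xi c x (s + h) - A n xi c x s -
    h * (symbol_re nu xi * A n xi c x s + symbol_im nu xi * A n xi (c + pi / 2) x s)|
  <= (e + (3 + `|xi|) * cutoff_error nu n) * h.
Proof.
move=> e0.
have := hgen (C02_damped_cos xi c (delta_gt0 n)) e0.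
apply: filter_app; near=> h => H x s s0.
have h0 : 0 < h by near: h; exact: nbhs_right_gt.
have b1 := bmf_damped_cos xi c (delta n); have b2 := bmf_damped_cos xi (c + pi / 2) (delta n).
have bP := bmf_kernel_law (P h) b1.
rewrite /A (chapman_kolmogorov hP x s0 (ltW h0) b1).
have bZ k : bounded_mfun (fun y : measurableTypeR R => k * damped_cos xi c (delta n) y).
  by apply: bmfM => //; exact: bmf_cst.
have bZ' k : bounded_mfun (fun y : measurableTypeR R =>
  k * damped_cos xi (c + pi / 2) (delta n) y).
  by apply: bmfM => //; exact: bmf_cst.
have bT : bounded_mfun (fun y : measurableTypeR R =>
  symbol_re nu xi * damped_cos xi c (delta n) y +
     symbol_im nu xi * damped_cos xi (c + pi / 2) (delta n) y).
  exact: (bmfD (bZ _) (bZ' _)).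
set m := kernel_law (P s) x.
have -> : \int[m]_y \int[kernel_law (P h) y]_z damped_cos xi c (delta n) z -
  \int[m]_y damped_cos xi c (delta n) y -
    h * (symbol_re nu xi * \int[m]_y damped_cos xi c (delta n) y +
         symbol_im nu xi * \int[m]_y damped_cos xi (c + pi / 2) (delta n) y) =
  \int[m]_y (\int[kernel_law (P h) y]_z damped_cos xi c (delta n) z -
    damped_cos xi c (delta n) y -
    h * (symbol_re nu xi * damped_cos xi c (delta n) y +
     symbol_im nu xi * damped_cos xi (c + pi / 2) (delta n) y)).
  rewrite (EB m (bmfB bP b1) (bmfM (bmf_cst _ h) bT)) (EB m bP b1) (EZ m h bT).
  by rewrite (ED m (bZ _) (bZ' _)) (EZ m _ b1) (EZ m _ b2).
apply: E_norm_le; first exact: (bmfB (bmfB bP b1) (bmfM (bmf_cst _ h) bT)).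
move=> y.
have := H y; have := levy_op_damped_cos hnu xi c n y.
rewrite -/(delta n).
set I := levy_op _ _ _; set K := (3 + _) * _.
have -> : damping (delta n) y * (symbol_re nu xi * cos (xi * y + c) -
  symbol_im nu xi * sin (xi * y + c))
  = symbol_re nu xi * damped_cos xi c (delta n) y +
    symbol_im nu xi * damped_cos xi (c + pi / 2) (delta n) y.
  by rewrite /damped_cos addrA cosDpihalf; ring.
rewrite -[fine _]/(\int[kernel_law (P h) y]_z damped_cos xi c (delta n) z).
set U := \int[_]_z _; set T := (symbol_re nu xi * damped_cos xi c (delta n) y + _); move=> H1 H2.
rewrite [X in `|X| <= _](_ : _ = h * (((U - damped_cos xi c (delta n) y) / h - I) + (I - T)));
  last first.
  by field; rewrite gt_eqF.
rewrite normrM (gtr0_norm h0) [leRHS]mulrC ler_wpM2l ?(ltW h0)//.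
by rewrite (le_trans (ler_normD _ _))// lerD// ltW.
Unshelve. all: by end_near. Qed.

(** [A] and [char_flow] take almost the same Euler steps, so their difference is
    controlled by a discrete Gronwall inequality, without any differentiation
    of [A] in time.  The phases [c] and [c + pi / 2] form a closed system, a
    second quarter turn being a change of sign. *)
Let A_flow_le n xi c x t : 0 <= t ->
  `|A n xi c x t - char_flow (symbol_re nu xi) (symbol_im nu xi) (xi * x + c) t| <=
  expR ((`|symbol_re nu xi| + `|symbol_im nu xi|) * t) *
  (2 * (1 - damping (delta n) x) + t * (2 * (2 * delta n + (3 + `|xi|) * cutoff_error nu n))).
Proof.
move=> t0.
set a := symbol_re nu xi; set b := symbol_im nu xi.
set eta := 2 * (2 * delta n + (3 + `|xi|) * cutoff_error nu n).
have a0 : a <= 0 by exact: symbol_re_le0.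
have d0 := delta_gt0 n.
have a1 := A_step n xi c d0; have a2 := A_step n xi (c + pi / 2) d0.
have f1 := char_flow_step b a0 d0.
have [r /= r0 hr] : exists2 r : R, 0 < r & forall h, 0 < h -> h < r ->
  [/\ forall x s, 0 <= s -> `|A n xi c x (s + h) - A n xi c x s -
    h * (a * A n xi c x s + b * A n xi (c + pi / 2) x s)|
      <= (delta n + (3 + `|xi|) * cutoff_error nu n) * h,
    forall x s, 0 <= s -> `|A n xi (c + pi / 2) x (s + h) - A n xi (c + pi / 2) x s -
    h * (a * A n xi (c + pi / 2) x s + b * A n xi (c + pi / 2 + pi / 2) x s)|
      <= (delta n + (3 + `|xi|) * cutoff_error nu n) * h
   & forall y s, 0 <= s ->
    `|char_flow a b y (s + h) - char_flow a b y s -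
      h * (a * char_flow a b y s + b * char_flow a b (y + pi / 2) s)| <= delta n * h].
  have : \forall h \near (0 : R)^'+, [/\ forall x s, 0 <= s ->
    `|A n xi c x (s + h) - A n xi c x s -
    h * (a * A n xi c x s + b * A n xi (c + pi / 2) x s)|
      <= (delta n + (3 + `|xi|) * cutoff_error nu n) * h,
    forall x s, 0 <= s -> `|A n xi (c + pi / 2) x (s + h) - A n xi (c + pi / 2) x s -
    h * (a * A n xi (c + pi / 2) x s + b * A n xi (c + pi / 2 + pi / 2) x s)|
      <= (delta n + (3 + `|xi|) * cutoff_error nu n) * h
   & forall y s, 0 <= s ->
    `|char_flow a b y (s + h) - char_flow a b y s -
      h * (a * char_flow a b y s + b * char_flow a b (y + pi / 2) s)| <= delta n * h].
    by near=> h; split; near: h.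
  move=> [r /= r0 hr]; exists r => // h h0 hr'; apply: hr => //=.
  by rewrite sub0r normrN gtr0_norm.
have p1 := damping_le1 (delta n) x; have p0 := damping_gt0 (delta n) x.
have hD y : `|cos y * damping (delta n) x - cos y| <= 1 - damping (delta n) x.
  rewrite -{2}[cos y]mulr1 -mulrBr normrM (le_trans (ler_piMl _ (cos_max _)))//.
  by rewrite distrC ger0_norm// subr_ge0.
(* enough steps for their length [t / k] to be below the threshold [r] *)
pose k := Num.bound (t / r).
have k0 : 0 < k%:R :> R.
  by rewrite (le_lt_trans _ (archi_boundP _))// divr_ge0// ltW.
pose h := t / k%:R.
have [->|tn0] := eqVneq t 0.
  rewrite mulr0 expR0 mul1r mul0r addr0 /A (expectation_at0 hP); last exact: bmf_damped_cos.
  rewrite /char_flow mulr0 expR0 mul1r mulr0 addr0 (le_trans (hD _))//.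
  by rewrite mulrDl mul1r lerDl subr_ge0.
have tp : 0 < t by rewrite lt0r tn0.
have h0 : 0 < h by rewrite divr_gt0.
have hlt : h < r.
  rewrite /h ltr_pdivrMr// mulrC -ltr_pdivrMr//; apply: archi_boundP.
  by rewrite divr_ge0// ltW.
have [H1 H2 H3] := hr h h0 hlt.
have Api s : A n xi (c + pi / 2 + pi / 2) x s = - A n xi c x s.
  rewrite /A (_ : damped_cos xi (c + pi / 2 + pi / 2) (delta n) = fun y =>
    -1 * damped_cos xi c (delta n) y).
    by rewrite EZ ?mulN1r//; exact: bmf_damped_cos.
  apply/funext => y; rewrite /damped_cos.
  rewrite (_ : xi * y + _ = xi * y + c + pi / 2 + pi / 2); last by ring.
  by rewrite cosDpihalf sinDpihalf; ring.
pose Y := xi * x + c.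
have Wpi s : char_flow a b (Y + pi / 2 + pi / 2) s = - char_flow a b Y s.
  rewrite /char_flow (_ : Y + _ + _ + _ = Y + b * s + pi / 2 + pi / 2); last by ring.
  by rewrite cosDpihalf sinDpihalf mulrN.
pose D1 s := A n xi c x s - char_flow a b Y s.
pose D2 s := A n xi (c + pi / 2) x s - char_flow a b (Y + pi / 2) s.
pose N (j : nat) := `|D1 (j%:R * h)| + `|D2 (j%:R * h)|.
pose L := `|a| + `|b|.
have stp j : N j.+1 <= (1 + h * L) * N j + h * eta.
  have s0 : 0 <= j%:R * h by rewrite mulr_ge0// ltW.
  have {}H1 := H1 x _ s0; have {}H2 := H2 x _ s0.
  have H4 := H3 Y _ s0; have H5 := H3 (Y + pi / 2) _ s0.
  rewrite Api in H2; rewrite Wpi in H5.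
  have es : j.+1%:R * h = j%:R * h + h by rewrite -natr1 mulrDl mul1r.
  rewrite /N es; set s := j%:R * h in s0 H1 H2 H4 H5 *.
  set E1 := _ - h * _ in H1; set E2 := _ - h * _ in H2.
  set E4 := _ - h * _ in H4; set E5 := _ - h * _ in H5.
  have e1 : D1 (s + h) = D1 s + h * (a * D1 s + b * D2 s) + (E1 - E4).
    rewrite /E1 /E4 /D1 /D2; ring.
  have e2 : D2 (s + h) = D2 s + h * (a * D2 s - b * D1 s) + (E2 - E5).
    rewrite /E2 /E5 /D1 /D2; ring.
  have g1 : `|D1 (s + h)| <= `|D1 s| + h * (`|a| * `|D1 s| + `|b| * `|D2 s|) + (`|E1| + `|E4|).
    rewrite e1 (le_trans (ler_normD _ _))// lerD ?ler_normB//.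
    rewrite (le_trans (ler_normD _ _))// lerD// normrM (gtr0_norm h0) ler_wpM2l ?(ltW h0)//.
    by rewrite -!normrM ler_normD.
  have g2 : `|D2 (s + h)| <= `|D2 s| + h * (`|a| * `|D2 s| + `|b| * `|D1 s|) + (`|E2| + `|E5|).
    rewrite e2 (le_trans (ler_normD _ _))// lerD ?ler_normB//.
    rewrite (le_trans (ler_normD _ _))// lerD// normrM (gtr0_norm h0) ler_wpM2l ?(ltW h0)//.
    by rewrite -!normrM ler_normB.
  rewrite (le_trans (lerD g1 g2))// /L /eta.
  move: `|D1 s| `|D2 s| `|E1| `|E2| `|E4| `|E5| `|a| `|b| H1 H2 H4 H5 =>
    u1 u2 v1 v2 v4 v5 aa bb H1 H2 H4 H5.
  move: (cutoff_error _ _) (3 + _) H1 H2 => ce kk H1 H2.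
  rewrite -subr_ge0.
  rewrite [X in 0 <= X](_ : _ = ((delta n + kk * ce) * h - v1) + ((delta n + kk * ce) * h - v2)
     + (delta n * h - v4) + (delta n * h - v5)); last by ring.
  by apply: addr_ge0; [apply: addr_ge0; [apply: addr_ge0|]|]; rewrite subr_ge0.
have ce0 : 0 <= cutoff_error nu n.
  apply: Rintegral_ge0 => z _.
  by have /andP[] := @cutoff_weight_itv R (delta n) z (ltW d0).
have L0 : 0 <= L by rewrite addr_ge0.
have eta0 : 0 <= eta.
  have d0' := ltW d0; have x0 : 0 <= 3 + `|xi| by rewrite addr_ge0.
  by rewrite /eta mulr_ge0// addr_ge0// mulr_ge0.
have := discrete_gronwall (mulr_ge0 (ltW h0) L0) (mulr_ge0 (ltW h0) eta0) stp k.
have kh : k%:R * h = t by rewrite /h; field; rewrite gt_eqF.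
have N0 : N 0%N <= 2 * (1 - damping (delta n) x).
  rewrite /N mul0r /D1 /D2 /A !(expectation_at0 hP); [|exact: bmf_damped_cos..].
  rewrite /char_flow /damped_cos !mulr0 expR0 !mul1r !addr0 /Y addrA.
  by rewrite (le_trans (lerD (hD _) (hD _)))// mulrDl mul1r.
have NK : `|D1 t| <= N k by rewrite /N kh lerDl.
move=> G; rewrite (le_trans NK)// (le_trans G)//.
have -> : k%:R * (h * eta) = t * eta by rewrite mulrA kh.
rewrite ler_pM//.
- by rewrite exprn_ge0// addr_ge0// mulr_ge0// ltW.
- have h1 : 0 <= N 0%N by rewrite /N addr_ge0.
  have h2 : 0 <= t * eta by rewrite mulr_ge0.
  exact: addr_ge0.
- rewrite (_ : L * t = k%:R * (h * L)); last by rewrite mulrA kh mulrC.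
  rewrite expRM_natl lerXn2r ?nnegrE ?expR_ge0 ?expR_ge1Dx//.
  by rewrite addr_ge0// mulr_ge0// ltW.
- by rewrite lerD2r.
Unshelve. all: by end_near. Qed.

(** The limit of [A_flow_le] as the damping parameter tends to [0]: the damping
    factor tends boundedly to [1] and all the error terms vanish. *)
Lemma characteristic_function xi c x t : 0 <= t ->
  \int[kernel_law (P t) x]_y cos (xi * y + c) =
  expR (symbol_re nu xi * t) * cos (xi * x + c + symbol_im nu xi * t).
Proof.
move=> t0.
have dl : delta n @[n --> \oo] --> (0 : R) by exact: cvg_harmonic.
have dc y : damping (delta n) y @[n --> \oo] --> (1 : R).
  have h0 : delta n * y @[n --> \oo] --> (0 : R).
    by rewrite -[X in _ --> X](mul0r y); apply: cvgM => //; exact: cvg_cst.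
  have h1 : (delta n * y) ^+ 2 @[n --> \oo] --> (0 : R).
    by rewrite -[X in _ --> X](mulr0 0); exact: (cvgM h0 h0).
  rewrite -[X in _ --> X]invr1; apply: cvgV; first exact: oner_neq0.
  by rewrite -[X in _ --> X]addr0; apply: cvgD => //; exact: cvg_cst.
have [_ cA] : bounded_mfun (fun y : measurableTypeR R => cos (xi * y + c)) /\
    A n xi c x t @[n --> \oo] --> \int[kernel_law (P t) x]_y cos (xi * y + c).
  apply: (@Edominated_cvg _ _ _ (kernel_law (P t) x) (fun n => damped_cos xi c (delta n)) _ 1).
  - by move=> n; case: (bmf_damped_cos xi c (delta n)).
  - move=> n y; rewrite /damped_cos normrM mulr_ile1// ?cos_max//.
    by rewrite ger0_norm ?damping_le1// ltW// damping_gt0.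
  - move=> y; rewrite -[X in _ --> X]mulr1; apply: cvgM; first exact: cvg_cst.
    exact: dc.
apply: (cvg_unique _ cA) => //.
apply/subr_cvg0/norm_cvg0P.
pose B n := expR ((`|symbol_re nu xi| + `|symbol_im nu xi|) * t) *
  (2 * (1 - damping (delta n) x) + t * (2 * (2 * delta n + (3 + `|xi|) * cutoff_error nu n))).
apply: (@squeeze_cvgr _ _ _ _ (cst 0) B).
- by apply: nearW => n; rewrite normr_ge0/= /B; exact: A_flow_le.
- exact: cvg_cst.
- rewrite -[X in _ --> X](_ : expR ((`|symbol_re nu xi| + `|symbol_im nu xi|) * t) *
    (2 * (1 - 1) + t * (2 * (2 * 0 + (3 + `|xi|) * 0))) = 0); last by ring.
  have cc k : cst k n @[n --> \oo] --> (k : R) by exact: cvg_cst.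
  apply: cvgM; first exact: cc.
  apply: cvgD.
    by apply: cvgM; [exact: cc|apply: cvgB; [exact: cc|exact: dc]].
  apply: cvgM; first exact: cc.
  apply: cvgM; first exact: cc.
  apply: cvgD; first by apply: cvgM; [exact: cc|exact: dl].
  by apply: cvgM; [exact: cc|exact: cutoff_error_cvg].
Qed.

End characteristic_function.

(** * Convolution and translation invariance *)

Section product_convolution.
Context (R : realType).
Local Notation MR := (measurableTypeR R).

Section product.
Context d1 d2 (T1 : measurableType d1) (T2 : measurableType d2).

(** The product measure, under a name of its own so that it can carry the
    structure of a probability. *)
Definition product_law (m1 : probability T1 R) (m2 : probability T2 R) :
  set (T1 * T2) -> \bar R := (m1 \x m2)%E.

HB.instance Definition _ m1 m2 := Measure.on (product_law m1 m2).

Lemma product_law_setT m1 m2 : product_law m1 m2 setT = 1%E.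
Proof.
rewrite /product_law -setXTT [LHS]product_measure1E//.
by rewrite [X in (X * _)%E](probability_setT m1) [X in (_ * X)%E](probability_setT m2) mule1.
Qed.

HB.instance Definition _ m1 m2 :=
  Measure_isProbability.Build _ _ _ (product_law m1 m2) (product_law_setT m1 m2).

Lemma Eproduct_law m1 m2 (f : T1 * T2 -> R) : bounded_mfun f ->
  \int[product_law m1 m2]_p f p = \int[m1]_x \int[m2]_y f (x, y).
Proof.
move=> bf; have im := bmf_integrable (product_law m1 m2) bf.
rewrite /Rintegral; congr fine.
rewrite -[LHS](integral12_prod_meas1 im).
by apply: eq_integral => x _; rewrite -EFin_expectation//;
  apply: (@bmf_comp _ _ _ _ _ (pair x)) bf; exact: pair1_measurable.
Qed.

End product.

Definition pair_sum (p : MR * MR) : MR := p.1 + p.2.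

Lemma measurable_pair_sum : measurable_fun setT pair_sum.
Proof. by apply: measurable_funD; [exact: measurable_fst|exact: measurable_snd]. Qed.

HB.instance Definition _ := isMeasurableFun.Build _ _ _ _ pair_sum measurable_pair_sum.

Definition convolution (m1 m2 : probability MR R) : probability MR R :=
  distribution (product_law m1 m2) pair_sum.

Lemma Econv (m1 m2 : probability MR R) (f : MR -> R) : bounded_mfun f ->
  \int[convolution m1 m2]_x f x = \int[m1]_x \int[m2]_y f (x + y).
Proof.
move=> bf.
have bfa : bounded_mfun (f \o pair_sum) by apply: bmf_comp bf; exact: measurable_pair_sum.
rewrite -(@Eproduct_law _ _ _ _ m1 m2 (f \o pair_sum))//.
rewrite /Rintegral; congr fine.
have mf : measurable_fun setT (EFin \o f) by apply/measurable_EFinP; case: bf.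
exact: (integral_pushforward measurable_pair_sum mf (bmf_integrable (product_law m1 m2) bfa)
  measurableT).
Qed.

Lemma Edirac (x : MR) (f : MR -> R) : bounded_mfun f ->
  \int[dirac x : probability MR R]_y f y = f x.
Proof.
move=> [mf _]; rewrite /Rintegral integral_dirac//; last exact/measurable_EFinP.
by rewrite diracT mul1e.
Qed.

Lemma eq_law (m1 m2 : probability MR R) (f : MR -> R) :
  (forall A, measurable A -> m1 A = m2 A) ->
  \int[m1]_x f x = \int[m2]_x f x.
Proof.
by move=> h; rewrite /Rintegral; congr fine; apply: eq_measure_integral => A mA _; exact: h.
Qed.

Lemma bmf_shift (f : MR -> R) (x : R) : bounded_mfun f -> bounded_mfun (fun y : MR => f (x + y)).
Proof.
move=> bf; apply: (@bmf_comp _ _ _ _ _ (fun y : MR => (x + y : MR))) bf.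
exact: measurable_funD.
Qed.

Lemma bmf_Eshift (m : probability MR R) (f : MR -> R) : bounded_mfun f ->
  bounded_mfun (fun x : MR => \int[m]_y f (x + y)).
Proof.
move=> bf; have bfa : bounded_mfun (f \o pair_sum) by apply: bmf_comp bf;
  exact: measurable_pair_sum.
exact: (bmf_integral2 m m bfa).
Qed.

Section translation.
Context (nu : {measure set MR -> \bar R}) (P : R -> R.-pker MR ~> MR).
Hypotheses (hnu : levy_measure nu) (hP : markov_semigroup P)
    (hgen : has_generator P (levy_op nu)).

(** The trigonometric integrals of both laws are given by
    [characteristic_function], and moving the starting point by [x] only
    changes the phase by [xi x]. *)
Lemma translation_invariant t x (f : MR -> R) : 0 <= t -> bounded_mfun f ->
  \int[kernel_law (P t) x]_y f y = \int[kernel_law (P t) 0]_y f (x + y).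
Proof.
move=> t0 bf.
rewrite (@eq_law (kernel_law (P t) x) (convolution (dirac x) (kernel_law (P t) 0)) f).
  rewrite Econv//; apply: Edirac; exact: bmf_Eshift.
apply: trig_unique => xi c.
rewrite (characteristic_function hnu hP hgen)// Econv; last exact: bmf_cos.
rewrite Edirac; last by apply: (@bmf_Eshift _ (fun y => cos (xi * y + c))); exact: bmf_cos.
under eq_Rintegral do rewrite mulrDr -addrA addrCA.
rewrite (characteristic_function hnu hP hgen)// mulr0 add0r; congr (_ * cos _); ring.
Qed.

End translation.
End product_convolution.

(** * Entropy under a reweighting of the increments *)

Section positive_bounded.
Context d (T : measurableType d) (R : realType).
Implicit Types f g : T -> R.

(** The functions all of whose powers and logarithms are bounded, so that every
    entropy below is finite. *)
Definition pos_bounded_mfun f := measurable_fun [set: T] f /\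
  exists e M : R, 0 < e /\ forall x, e <= f x <= M.

Lemma pbf_gt0 f x : pos_bounded_mfun f -> 0 < f x.
Proof. by move=> [_ [e [M [e0 h]]]]; have /andP[h1 _] := h x; exact: lt_le_trans e0 h1. Qed.

Lemma pbf_bmf f : pos_bounded_mfun f -> bounded_mfun f.
Proof.
move=> [mf [e [M [e0 h]]]]; split => //; exists M => x.
by have /andP[h1 h2] := h x; rewrite ger0_norm// (le_trans _ h1)// ltW.
Qed.

Lemma pbf_ln f : pos_bounded_mfun f -> bounded_mfun (fun x => ln (f x)).
Proof.
move=> [mf [e [M [e0 h]]]]; split; first by apply: measurableT_comp => //; exact: measurable_ln.
exists (`|ln e| + `|ln M|) => x; have /andP[h1 h2] := h x.
have f0 := lt_le_trans e0 h1; have M0 := lt_le_trans f0 h2.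
have l1 : ln e <= ln (f x) by rewrite ler_ln ?posrE.
have l2 : ln (f x) <= ln M by rewrite ler_ln ?posrE.
have := ler_norm (ln M); have := ler_norm (- ln e); rewrite normrN.
have := normr_ge0 (ln M); have := normr_ge0 (ln e).
by rewrite ler_norml; lra.
Qed.

Lemma pbf_powR f q : pos_bounded_mfun f -> 0 < q -> pos_bounded_mfun (fun x => f x `^ q).
Proof.
move=> [mf [e [M [e0 h]]]] q0; split.
  exact: (measurableT_comp (measurable_powR q)).
exists (e `^ q), (M `^ q); split; first exact: powR_gt0.
move=> x; have /andP[h1 h2] := h x.
by rewrite !ge0_ler_powR ?nnegrE ?(ltW q0)// ?(le_trans (ltW e0))// (le_trans _ h2)//
  (le_trans (ltW e0)).
Qed.

End positive_bounded.

Lemma pbf_comp (R : realType) d d' (T : measurableType d) (T' : measurableType d')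
    (u : T' -> T) (f : T -> R) :
  measurable_fun [set: T'] u -> pos_bounded_mfun f -> pos_bounded_mfun (f \o u).
Proof.
move=> mu' [mf [e [M [e0 h]]]]; split; first exact: (measurableT_comp mf mu').
by exists e, M; split => // x; exact: h.
Qed.

Lemma ln_le_sub1 (R : realType) (y : R) : 0 < y -> ln y <= y - 1.
Proof.
move=> y0; have := @le_ln1Dx R (y - 1); rewrite (_ : 1 + (y - 1) = y); last by ring.
by apply; lra.
Qed.

Section entropy.
Context (R : realType).
Local Notation MR := (measurableTypeR R).
Variable pi : R -> probability MR R.

(** The Markov operator of the process with independent stationary increments of
    law [pi t]. *)
Definition convop t (f : MR -> R) (x : MR) : R := \int[pi t]_y f (x + y).

Hypothesis L0 : forall f x, bounded_mfun f -> convop 0 f x = f x.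
Hypothesis LD : forall s t f x, 0 <= s -> 0 <= t -> bounded_mfun f -> convop (s + t) f x =
  convop s (convop t f) x.

Lemma bmf_convop t f : bounded_mfun f -> bounded_mfun (convop t f).
Proof. exact: bmf_Eshift. Qed.

Lemma pbf_convop t f : pos_bounded_mfun f -> pos_bounded_mfun (convop t f).
Proof.
move=> pf; have bf := pbf_bmf pf; have [mL _] := bmf_convop t bf.
case: pf => mf [e [M [e0 h]]]; split => //; exists e, M; split => // x.
by apply/andP; split; [apply: E_ge_cst|apply: E_le_cst];
  rewrite //; [exact: bmf_shift|move=> y; have /andP[] := h (x + y)|
               exact: bmf_shift|move=> y; have /andP[] := h (x + y)].
Qed.

Lemma eq_convop_shift t f g x x' : (forall y, f (x + y) = g (x' + y)) ->
  convop t f x = convop t g x'.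
Proof. by move=> fg; apply: eq_Rintegral => y _; exact: fg. Qed.

Definition xlnx (y : R) : R := y * ln y.

Lemma bmf_xlnx d (T : measurableType d) (f : T -> R) : pos_bounded_mfun f ->
  bounded_mfun (fun x => xlnx (f x)).
Proof. by move=> pf; apply: bmfM; [exact: pbf_bmf|exact: pbf_ln]. Qed.

(** [ln z <= z - 1] at [z = v w / (u k)]. *)
Lemma entropy_pointwise (u v w k : R) : 0 < u -> 0 < v -> 0 < w -> 0 < k ->
  u - k^-1 * (v * w) <= u * ln u + u * ln k - u * ln v - u * ln w.
Proof.
move=> u0 v0 w0 k0.
have e : u * ln u + u * ln k - u * ln v - u * ln w = - (u * ln (v * w / (u * k))).
  rewrite ln_div ?posrE ?mulr_gt0// !lnM ?posrE//; ring.
rewrite e -lerN2 opprK opprB.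
have z0 : 0 < v * w / (u * k) by rewrite divr_gt0 ?mulr_gt0.
set X := v * w / (u * k) in z0 *.
have h := ln_le_sub1 z0.
apply: (@le_trans _ _ (u * (X - 1))); first by rewrite ler_pM2l.
rewrite (_ : u * _ = k^-1 * (v * w) - u)// /X; field.
by rewrite !gt_eqF.
Qed.

(** Let [Y] and [Y'] be independent increments over times [a] and [c], reweighted
    by [u = g (y + Y + Y')], of mean [k].  The conditional expectations of [u]
    given [Y] and given [Y'] are [v = convop c g (y + Y)] and
    [w = convop a g (y + Y')]; the second is again a value of the semigroup since
    the two increments may be taken in either order.  Up to the normalisation
    by [k], the claim is that the entropies of the two marginals add up to at
    most the joint entropy: the relative entropy of the joint density [u / k]
    with respect to [(v / k) * (w / k)] is nonnegative.  This is
    [entropy_pointwise] integrated, as [E (v w) = k^2] by independence. *)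
Lemma entropy_exchange a c g y : 0 <= a -> 0 <= c -> pos_bounded_mfun g ->
  convop a (fun z => xlnx (convop c g z)) y + convop c (fun z => xlnx (convop a g z)) y <=
  convop (a + c) (fun z => xlnx (g z)) y + xlnx (convop (a + c) g y).
Proof.
move=> a0 c0 pg.
have bg := pbf_bmf pg.
have pa := pbf_convop a pg; have pc := pbf_convop c pg.
set k := convop (a + c) g y.
have k0 : 0 < k by apply: pbf_gt0; exact: pbf_convop.
set m := product_law (pi a) (pi c).
have mA : measurable_fun [set: MR * MR] (fun p : MR * MR => y + p.1 : MR).
  by apply: measurable_funD => //; exact: measurable_fst.
have mC : measurable_fun [set: MR * MR] (fun p : MR * MR => y + p.2 : MR).
  by apply: measurable_funD => //; exact: measurable_snd.
have mAC : measurable_fun [set: MR * MR] (fun p : MR * MR => y + p.1 + p.2 : MR).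
  by apply: measurable_funD => //; exact: measurable_snd.
pose u (p : MR * MR) := g (y + p.1 + p.2).
pose v (p : MR * MR) := convop c g (y + p.1).
pose w (p : MR * MR) := convop a g (y + p.2).
have pu : pos_bounded_mfun u := pbf_comp mAC pg.
have pv : pos_bounded_mfun v := pbf_comp mA pc.
have pw : pos_bounded_mfun w := pbf_comp mC pa.
have bu := pbf_bmf pu; have bv := pbf_bmf pv; have bw := pbf_bmf pw.
have lu := pbf_ln pu; have lv := pbf_ln pv; have lw := pbf_ln pw.
have LC (f : MR -> R) : bounded_mfun f -> \int[pi a]_x \int[pi c]_z f (y + x + z) =
  convop (a + c) f y.
  by move=> bf; rewrite LD.
have CA (f : MR -> R) : bounded_mfun f -> \int[pi c]_z \int[pi a]_x f (y + x + z) =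
  convop (a + c) f y.
  move=> bf; rewrite [a + c]addrC (LD y c0 a0 bf); apply: eq_Rintegral => z _.
  by apply: eq_Rintegral => x _; rewrite addrAC.
have Ju : \int[m]_p u p = k by rewrite Eproduct_law// LC.
have Juu : \int[m]_p (u p * ln (u p)) = convop (a + c) (fun z => xlnx (g z)) y.
  rewrite Eproduct_law; last exact: bmfM.
  by rewrite -LC//; exact: bmf_xlnx.
have Juv : \int[m]_p (u p * ln (v p)) = convop a (fun z => xlnx (convop c g z)) y.
  rewrite Eproduct_law; last exact: bmfM.
  apply: eq_Rintegral => x _; rewrite /xlnx mulrC -EZ; last exact: bmf_shift.
  by apply: eq_Rintegral => z _; rewrite /u/= mulrC.
have Juw : \int[m]_p (u p * ln (w p)) = convop c (fun z => xlnx (convop a g z)) y.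
  rewrite Eproduct_law; last exact: bmfM.
  rewrite (Efubini (pi a) (pi c) (f := fun p => u p * ln (w p))); last exact: bmfM.
  apply: eq_Rintegral => z _; rewrite /xlnx mulrC -EZ; last exact: bmf_shift.
  by apply: eq_Rintegral => x _; rewrite /u/= mulrC addrAC.
have Jvw : \int[m]_p (v p * w p) = k * k.
  rewrite Eproduct_law; last exact: bmfM.
  rewrite (_ : (fun x => _) = (fun x => k * convop c g (y + x))); last first.
    apply/funext => x; rewrite /v/w/= EZ; last by apply: bmf_shift; exact: bmf_convop.
    rewrite mulrC; congr (_ * _); rewrite /k addrC LD//.
  by rewrite EZ; [rewrite /k LD|apply: bmf_shift; exact: bmf_convop].
have J : \int[m]_p (u p - k^-1 * (v p * w p)) <=
   \int[m]_p (u p * ln (u p) + u p * ln k - u p * ln (v p) - u p * ln (w p)).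
  apply: E_le.
  - by apply: bmfB => //; apply: bmfM; [exact: bmf_cst|exact: bmfM].
  - apply: bmfB; last exact: bmfM. apply: bmfB; last exact: bmfM.
    by apply: bmfD; [exact: bmfM|apply: bmfM => //; exact: bmf_cst].
  - by move=> p; apply: entropy_pointwise => //; exact: pbf_gt0.
move: J.
rewrite (EB m bu (bmfM (bmf_cst _ _) (bmfM bv bw))) (EZ m _ (bmfM bv bw)) Jvw Ju.
rewrite mulKf ?gt_eqF// subrr.
rewrite (EB m (bmfB (bmfD (bmfM bu lu) (bmfM bu (bmf_cst _ (ln k)))) (bmfM bu lv)) (bmfM bu lw)).
rewrite (EB m (bmfD (bmfM bu lu) (bmfM bu (bmf_cst _ (ln k)))) (bmfM bu lv)).
rewrite (ED m (bmfM bu lu) (bmfM bu (bmf_cst _ (ln k)))).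
rewrite Juu Juv Juw.
rewrite (_ : \int[m]_p (u p * ln k) = xlnx k); last first.
  by under eq_Rintegral do rewrite mulrC; rewrite EZ// Ju mulrC.
by move=> J; rewrite -subr_ge0 opprD addrA; exact: J.
Qed.

End entropy.

(** * Convexity of the entropy and the variational argument *)

(** The quotients [K j / j] are nondecreasing, by induction on [j]. *)
Lemma convex_seq_chord (R : realType) (K : nat -> R) (n : nat) : K 0%N = 0 ->
  (forall j, (j.+2 <= n)%N -> 2 * K j.+1 <= K j + K j.+2) ->
  forall m, (m <= n)%N -> n%:R * K m <= m%:R * K n.
Proof.
move=> K0 cvx.
have stp j : (j.+1 <= n)%N -> j.+1%:R * K j <= j%:R * K j.+1.
  elim: j => [|j IHj] jn; first by rewrite K0 mulr0 mul0r.
  have {}IHj := IHj (ltnW jn); have c := cvx j jn.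
  have j0 : 0 <= j.+1%:R :> R by [].
  have := ler_wpM2l j0 c; move: IHj; rewrite -!natr1; nra.
move=> m; elim: n {cvx} stp => [|n IHn] stp; first by rewrite leqn0 => /eqP ->; rewrite !mul0r.
rewrite leq_eqVlt => /orP[/eqP -> //|]; rewrite ltnS => mn.
have {}IHn := IHn (fun j jn => stp j (leqW jn)) mn.
case: n mn stp IHn => [|n] mn stp IHn.
  by move: mn; rewrite leqn0 => /eqP ->; rewrite K0 mulr0 mul0r.
have n0 : 0 < n.+1%:R :> R by [].
rewrite -(ler_pM2l n0) mulrCA (le_trans (ler_wpM2l _ IHn))//.
rewrite mulrCA [leRHS]mulrCA ler_wpM2l// stp//.
Qed.

Lemma ler_lnD_expR (R : realType) (k W V : R) : 0 < W -> expR k * W <= V -> ln W + k <= ln V.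
Proof.
move=> W0 h; rewrite -[k]expRK -lnM ?posrE ?expR_gt0// mulrC.
have KW0 : 0 < expR k * W by rewrite mulr_gt0 ?expR_gt0.
by rewrite ler_ln ?posrE// (lt_le_trans KW0).
Qed.

Section chord.
Context (R : realType).
Local Notation MR := (measurableTypeR R).

Definition conv_semigroup (pi : R -> probability MR R) : Prop :=
  (forall f x, bounded_mfun f -> convop pi 0 f x = f x) /\
  (forall s t f x, 0 <= s -> 0 <= t -> bounded_mfun f -> convop pi (s + t) f x =
    convop pi s (convop pi t f) x).

Variable pi : R -> probability MR R.
Hypothesis hpi : conv_semigroup pi.
Let L0 := hpi.1.
Let LD := hpi.2.

Lemma convop_le t f g x : bounded_mfun f -> bounded_mfun g -> (forall y, f y <= g y) ->
  convop pi t f x <= convop pi t g x.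
Proof. by move=> bf bg fg; apply: E_le => //; exact: bmf_shift. Qed.

Lemma convop_D t f g x : bounded_mfun f -> bounded_mfun g ->
  convop pi t (fun y => f y + g y) x = convop pi t f x + convop pi t g x.
Proof. by move=> bf bg; rewrite /convop ED//; exact: bmf_shift. Qed.

Lemma convop_B t f g x : bounded_mfun f -> bounded_mfun g ->
  convop pi t (fun y => f y - g y) x = convop pi t f x - convop pi t g x.
Proof. by move=> bf bg; rewrite /convop EB//; exact: bmf_shift. Qed.

Lemma convop_Z t k f x : bounded_mfun f -> convop pi t (fun y => k * f y) x = k * convop pi t f x.
Proof. by move=> bf; rewrite /convop EZ//; exact: bmf_shift. Qed.

Lemma convop_cst t k x : convop pi t (fun=> k) x = k.
Proof. by rewrite /convop Ecst. Qed.

Lemma xlnx_jensen t g x : pos_bounded_mfun g -> xlnx (convop pi t g x) <=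
  convop pi t (fun y => xlnx (g y)) x.
Proof.
move=> pg; have bg := pbf_bmf pg.
set v := convop pi t g x.
have v0 : 0 < v by apply: pbf_gt0; exact: pbf_convop.
have : convop pi t (fun y => g y - v) x <= convop pi t (fun y => xlnx (g y) - ln v * g y) x.
  apply: convop_le.
  - by apply: bmfB => //; exact: bmf_cst.
  - by apply: bmfB; [exact: bmf_xlnx|apply: bmfM => //; exact: bmf_cst].
  - move=> y; have g0 := pbf_gt0 y pg.
    have := entropy_pointwise g0 v0 v0 v0; rewrite mulKf ?gt_eqF// /xlnx; lra.
rewrite convop_B//; last exact: bmf_cst.
rewrite convop_B; [|exact: bmf_xlnx|by apply: bmfM => //; exact: bmf_cst].
by rewrite convop_cst convop_Z// -/v /xlnx; lra.
Qed.

Section entropy_path.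
Variables (g : MR -> R) (x t : R).
Hypothesis pg : pos_bounded_mfun g.
Let bg := pbf_bmf pg.

(** [H u - H 0] is [convop pi t g x] times the relative entropy, up to time [u], of
    the process reweighted by [g] at time [t]. *)
Let H u := convop pi u (fun z => xlnx (convop pi (t - u) g z)) x.

Let H_le u u' : 0 <= u -> u <= u' -> u' <= t -> H u <= H u'.
Proof.
move=> u0 uu' u't; rewrite /H.
have -> : convop pi (t - u) g = convop pi (u' - u) (convop pi (t - u') g).
  apply/funext => z; rewrite -LD ?subr_ge0//; congr (convop pi _ g z); ring.
have pG := pbf_convop pi (t - u') pg.
rewrite [in leRHS](_ : convop pi u' = convop pi (u + (u' - u))); last by congr (convop pi _);
  ring.
rewrite [leRHS]LD ?subr_ge0//; last exact: bmf_xlnx.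
apply: convop_le; [by apply: bmf_xlnx; exact: pbf_convop|by apply: bmf_convop; exact: bmf_xlnx|].
by move=> z; exact: xlnx_jensen.
Qed.

(** [entropy_exchange] for two increments of length [d] that follow a first one
    of length [b]. *)
Let H_convex b d : 0 <= b -> 0 <= d -> b + d + d <= t ->
  2 * H (b + d) <= H b + H (b + d + d).
Proof.
move=> b0 d0 bdt; rewrite /H.
pose G := convop pi (t - (b + d + d)) g.
have G0 : 0 <= t - (b + d + d) by rewrite subr_ge0.
have pG : pos_bounded_mfun G by exact: pbf_convop.
have e1 : convop pi (t - (b + d)) g = convop pi d G.
  apply/funext => z; rewrite /G -LD//; congr (convop pi _ g z); ring.
have e2 : convop pi (t - b) g = convop pi (d + d) G.
  apply/funext => z; rewrite /G -LD// ?addr_ge0//; congr (convop pi _ g z); ring.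
rewrite e1 e2 -/G.
have bGd : bounded_mfun (fun z => xlnx (convop pi d G z)) by apply: bmf_xlnx; exact: pbf_convop.
have bGdd : bounded_mfun (fun z => xlnx (convop pi (d + d) G z)) by apply: bmf_xlnx;
  exact: pbf_convop.
have bG : bounded_mfun (fun z => xlnx (G z)) by exact: bmf_xlnx.
rewrite -(addrA b) (LD x b0 d0 bGd) (LD x b0 (addr_ge0 d0 d0) bG).
rewrite addrC -convop_D//; last exact: bmf_convop.
rewrite mulrDl mul1r -convop_D; [|exact: bmf_convop..].
apply: convop_le; [by apply: bmfD; exact: bmf_convop|by apply: bmfD => //; exact: bmf_convop|].
by move=> z; exact: (entropy_exchange LD z d0 d0 pG).
Qed.

(** Convexity gives the inequality at the points of the grid of mesh
    [t / n.+1], and monotonicity replaces [s] by the next point of the grid, so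
    that no continuity in time is involved. *)
Lemma entropy_chord s : 0 < t -> 0 <= s -> s <= t ->
  convop pi s (fun z => xlnx (convop pi (t - s) g z)) x - xlnx (convop pi t g x) <=
  (s / t) * (convop pi t (fun z => xlnx (g z)) x - xlnx (convop pi t g x)).
Proof.
move=> t0 s0 st.
have H0 : H 0 = xlnx (convop pi t g x).
  by rewrite /H subr0 L0//; apply: bmf_xlnx; exact: pbf_convop.
have Ht : H t = convop pi t (fun z => xlnx (g z)) x.
  rewrite /H subrr; congr (convop pi t _ x); apply/funext => z; congr xlnx; exact: L0.
rewrite -H0 -Ht -/(H s).
move: st; rewrite le_eqVlt => /orP[/eqP ->|st]; first by rewrite divff ?gt_eqF// mul1r.
have Kt : 0 <= H t - H 0 by rewrite subr_ge0 H_le// ltW.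
have bound n : H s - H 0 <= (s / t + n.+1%:R^-1) * (H t - H 0).
  have n0 : 0 < n.+1%:R :> R by [].
  pose d := t / n.+1%:R.
  have d0 : 0 < d by rewrite divr_gt0.
  have nd : n.+1%:R * d = t by rewrite /d; field; rewrite gt_eqF.
  pose K j := H (j%:R * d) - H 0.
  pose m := (Num.truncn (s / d)).+1.
  have sd0 : 0 <= s / d by rewrite divr_ge0// ltW.
  have /andP[m1 m2] := truncn_itv sd0.
  have smd : s <= m%:R * d by rewrite -ler_pdivrMr// ltW.
  have mn : (m <= n.+1)%N.
    rewrite /m ltnS -ltnS -(ltr_nat R) (le_lt_trans m1)//.
    by rewrite ltr_pdivrMr// nd.
  have mdt : m%:R * d <= t by rewrite -nd ler_wpM2r ?(ltW d0)// ler_nat.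
  have Kc : n.+1%:R * K m <= m%:R * K n.+1.
    apply: convex_seq_chord => //; first by rewrite /K mul0r subrr.
    move=> j jn; rewrite /K.
    have e1 : j.+1%:R * d = j%:R * d + d by rewrite -natr1 mulrDl mul1r.
    have e2 : j.+2%:R * d = j%:R * d + d + d by rewrite -natr1 mulrDl mul1r e1.
    have jd0 : 0 <= j%:R * d by rewrite mulr_ge0// ltW.
    have := @H_convex (j%:R * d) d jd0 (ltW d0); rewrite -e2 -e1.
    have : j.+2%:R * d <= t by rewrite -nd ler_wpM2r ?(ltW d0)// ler_nat.
    by move=> h /(_ h); lra.
  have K1 : H s - H 0 <= K m by rewrite /K lerD2r H_le.
  apply: (le_trans K1); rewrite -(ler_pM2l n0) (le_trans Kc)// /K nd mulrA.
  rewrite ler_wpM2r//.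
  have : m%:R <= s / d + 1 by rewrite /m -natr1 lerD2r.
  move/le_trans; apply; rewrite mulrDr divff ?gt_eqF// lerD2r.
  rewrite /d le_eqVlt; apply/orP; left; apply/eqP; field.
  by rewrite !gt_eqF.
have lim : (s / t + n.+1%:R^-1) * (H t - H 0) @[n --> \oo] --> (s / t) * (H t - H 0).
  apply: cvgM; last exact: cvg_cst.
  rewrite -[X in _ --> X]addr0; apply: cvgD; first exact: cvg_cst.
  exact: cvg_harmonic.
by apply: (cvgr_to_ge lim); exact: nearW.
Qed.

End entropy_path.

(** Jensen's inequality for the exponential, under the probability of density
    [w / W]: the tangent of [expR] at the mean [c] of [l = ln phi - ln w] gives
    [phi >= expR c * w * (1 + l - c)], and the expectation of the right-hand side
    is [expR c * W]. *)
Lemma gibbs t phi w x : pos_bounded_mfun phi -> pos_bounded_mfun w ->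
  ln (convop pi t w x) + (convop pi t w x)^-1 * convop pi t (fun y =>
    w y * (ln (phi y) - ln (w y))) x
  <= ln (convop pi t phi x).
Proof.
move=> pp pw; have bp := pbf_bmf pp; have bw := pbf_bmf pw.
have lp := pbf_ln pp; have lw := pbf_ln pw.
set W := convop pi t w x; set D := convop pi t _ x.
have W0 : 0 < W by apply: pbf_gt0; exact: pbf_convop.
set c := W^-1 * D.
have bwl : bounded_mfun (fun y => w y * (ln (phi y) - ln (w y))) by apply: bmfM => //;
  exact: bmfB.
have h : convop pi t (fun y => expR c * ((1 - c) * w y + w y * (ln (phi y) - ln (w y)))) x <=
  convop pi t phi x.
  apply: convop_le => //.
    apply: bmfM; first exact: bmf_cst.
    by apply: bmfD => //; apply: bmfM => //; exact: bmf_cst.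
  move=> y; have w0 := pbf_gt0 y pw; have p0 := pbf_gt0 y pp.
  set l := ln (phi y) - ln (w y).
  have -> : phi y = expR c * w y * expR (l - c).
    rewrite /l expRB expRB !lnK ?posrE//; field.
    by rewrite !gt_eqF ?expR_gt0.
  rewrite -mulrA ler_wpM2l ?expR_ge0// (_ : _ + _ = w y * (1 + (l - c))); last by ring.
  by rewrite ler_wpM2l ?(ltW w0)// expR_ge1Dx.
rewrite convop_Z in h; last by apply: bmfD => //; apply: bmfM => //; exact: bmf_cst.
rewrite convop_D// in h; last by apply: bmfM => //; exact: bmf_cst.
rewrite convop_Z// -/W -/D in h.
have e : (1 - c) * W + D = W by rewrite /c; field; rewrite gt_eqF.
rewrite e in h.
exact: ler_lnD_expR.
Qed.

(** [outer] is a Gibbs inequality up to time [s'] for the reweighting by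
    [gs / Z], and [inner] one on the remaining time [t - s'], conditionally on the
    position at time [s'].  Inserting [inner] into [outer] leaves
    [(q2 / q1) ln Z] and the combination
    [q2 (1 / q1 - 1) h t - (1 - q2) h s'] of entropies, which [entropy_chord] and
    the relation between [s'], [t] and the exponents make nonnegative.  The
    constants [k1], [g1], [g2] and the function [M] carry the cost of a change of
    clock; they are zero when the clock is kept. *)
Lemma variational_core s' t q1 q2 (f F M : MR -> R) x V k1 g1 g2 :
  0 <= s' -> s' <= t -> 0 < t -> 0 < q2 -> q2 <= 1 -> 0 < q1 ->
  q1 * (1 - q2) * s' = q2 * (1 - q1) * t ->
  pos_bounded_mfun f -> pos_bounded_mfun F -> bounded_mfun M ->
  let g := fun y => f y `^ q1 in
  let gs := convop pi (t - s') g in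
  let Z := convop pi t g x in
  ln Z - k1 + Z^-1 * (convop pi s' (fun y => gs y * (q2 * ln (F y) - ln (gs y))) x
      - g1 * convop pi s' M x) <= ln V ->
  (forall y, gs y * ln (gs y) + k1 * gs y
     + convop pi (t - s') (fun z => g z * (ln (f z) - ln (g z))) y - g2 * M y <=
       gs y * ln (F y)) ->
  (q2 / q1) * ln Z - k1 * (1 - q2) - Z^-1 * (convop pi s' M x * (g1 + q2 * g2)) <= ln V.
Proof.
move=> s0 st t0 q20 q21 q10 hq pf pF bM g gs Z outer inner.
have pg : pos_bounded_mfun g by exact: pbf_powR.
have bg := pbf_bmf pg.
have pgs : pos_bounded_mfun gs by exact: pbf_convop.
have bgs := pbf_bmf pgs; have lgs := pbf_ln pgs; have lF := pbf_ln pF.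
have Z0 : 0 < Z by apply: pbf_gt0; exact: pbf_convop.
have ts0 : 0 <= t - s' by rewrite subr_ge0.
have Lgs : convop pi s' gs x = Z by rewrite -LD//; congr (convop pi _ _ _); ring.
have bx := bmf_xlnx pgs.
set Hs := convop pi s' (fun y => xlnx (gs y)) x.
set Ht := convop pi t (fun z => xlnx (g z)) x.
have chord := @entropy_chord g x t pg s' t0 s0 st.
rewrite -/gs -/Hs -/Ht -/Z in chord.
set m := convop pi s' M x in outer *.
have lnf y : ln (f y) = q1^-1 * ln (g y).
  by rewrite /g ln_powR mulKf// gt_eqF.
have bI : bounded_mfun (fun z => g z * (ln (f z) - ln (g z))).
  by apply: bmfM => //; apply: bmfB; [exact: pbf_ln|exact: pbf_ln].
have e1 : convop pi t (fun z => g z * (ln (f z) - ln (g z))) x = (q1^-1 - 1) * Ht.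
  rewrite -convop_Z; last exact: bmf_xlnx.
  by congr (convop pi t _ x); apply/funext => z; rewrite lnf /xlnx; ring.
have bFg : bounded_mfun (fun y => gs y * ln (F y)) by exact: bmfM.
have b1 : bounded_mfun (fun y => k1 * gs y) by apply: bmfM => //; exact: bmf_cst.
have b2 : bounded_mfun (fun y => g2 * M y) by apply: bmfM => //; exact: bmf_cst.
have b3 := bmf_convop pi (t - s') bI.
have inner' : Hs + k1 * Z + (q1^-1 - 1) * Ht - g2 * m <=
  convop pi s' (fun y => gs y * ln (F y)) x.
  rewrite -e1 -[t in convop pi t](subrKC s') LD// -Lgs -(convop_Z _ _ _ bM) -(convop_Z _ _ _ bgs).
  rewrite -(convop_D _ _ bx b1) -(convop_D _ _ (bmfD bx b1) b3)
    -(convop_B _ _ (bmfD (bmfD bx b1) b3) b2).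
  by apply: convop_le => //; exact: (bmfB (bmfD (bmfD bx b1) b3) b2).
have e2 : convop pi s' (fun y => gs y * (q2 * ln (F y) - ln (gs y))) x =
    q2 * convop pi s' (fun y => gs y * ln (F y)) x - Hs.
  rewrite -convop_Z// -convop_B//; last by apply: bmfM => //; exact: bmf_cst.
  by congr (convop pi _ _ x); apply/funext => y; rewrite /xlnx; ring.
rewrite e2 in outer; apply: le_trans outer.
set J := convop pi s' (fun y => _) x in inner' *.
have Zi : 0 < Z^-1 by rewrite invr_gt0.
have key : q2 / q1 * (Z * ln Z) <= Z * ln Z + q2 * (Hs + (q1^-1 - 1) * Ht) - Hs.
  have hst : (1 - q2) * (s' / t) = q2 * (q1^-1 - 1).
    have q1n : q1 != 0 by rewrite gt_eqF.
    have tn : t != 0 by rewrite gt_eqF.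
    rewrite (_ : (1 - q2) * (s' / t) = (q1 * (1 - q2) * s') / (q1 * t)); last first.
      by field; apply/andP.
    by rewrite hq; field; apply/andP.
  have : (1 - q2) * (Hs - xlnx Z) <= q2 * (q1^-1 - 1) * (Ht - xlnx Z).
    by rewrite -hst -mulrA ler_wpM2l// subr_ge0.
  rewrite /xlnx; lra.
have i2 := ler_wpM2l (ltW q20) inner'.
rewrite -(ler_pM2l Z0).
rewrite [leLHS](_ : _ = q2 / q1 * (Z * ln Z) - k1 * (1 - q2) * Z - m * (g1 + q2 * g2));
  last first.
  by field; rewrite !gt_eqF.
rewrite [leRHS](_ : _ = Z * ln Z - k1 * Z + (q2 * J - Hs - g1 * m)); last first.
  by field; rewrite gt_eqF.
lra.
Qed.

End chord.

(** * From bounded to arbitrary positive functions *)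

(** [r <= r `^ q] on [0 <= r <= 1], at [r = a / (a + b)] and [r = b / (a + b)]. *)
Lemma powR_subadditive (R : realType) (a b q : R) : 0 <= a -> 0 < b -> 0 < q -> q <= 1 ->
  (a + b) `^ q <= a `^ q + b `^ q.
Proof.
move=> a0 b0 q0 q1.
have s0 : 0 < a + b by rewrite ltr_wpDl.
have h z : 0 <= z -> z <= a + b -> z / (a + b) * (a + b) `^ q <= z `^ q.
  rewrite le_eqVlt => /orP[/eqP <- _|z0 zs]; first by rewrite !mul0r powR_ge0.
  have r0 : 0 < z / (a + b) <= 1 by rewrite divr_gt0//= ler_pdivrMr// mul1r.
  have /andP[r1 _] := r0.
  have {2}-> : z = z / (a + b) * (a + b) by field; rewrite gt_eqF.
  by rewrite powRM ?(ltW r1) ?(ltW s0)// ler_wpM2r ?powR_ge0// ger1_powR.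
have ha := h a a0 _; have hb := h b (ltW b0) _.
have {ha hb} := lerD (ha _) (hb _); rewrite -mulrDl -mulrDl divff ?gt_eqF// mul1r.
by apply; rewrite ?lerDl ?lerDr// ltW.
Qed.

Section general_functions.
Context (R : realType).
Local Notation MR := (measurableTypeR R).
Variable P : R -> R.-pker MR ~> MR.

Lemma measurable_kernel_integral (t : R) (g : MR -> \bar R) :
  (forall y, 0 <= g y)%E -> measurable_fun setT g ->
  measurable_fun setT (fun x : MR => \int[P t x]_y g y)%E.
Proof.
move=> g0 mg; apply: (@measurable_fun_integral_kernel _ _ _ _ _ (P t)) => //.
by move=> U mU; exact: measurable_kernel.
Qed.

(** The bound is applied to [min (f, n) + e].  First [e] tends to [0], the cost on
    the right-hand side being at most [e `^ q2] by subadditivity of the power;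
    then [n] grows, by monotone convergence on the left-hand side and mere
    monotonicity on the right-hand side. *)
Lemma extend_to_positive (kappa s t q1 q2 : R) (x : MR) :
  0 < q2 -> q2 <= 1 -> 0 < q1 ->
  (forall f : MR -> R, pos_bounded_mfun f ->
    (\int[kernel_law (P t) x]_y (f y `^ q1)) `^ (q2 / q1) <=
    expR kappa * \int[kernel_law (P s) x]_y ((\int[kernel_law (P (t - s)) y]_z f z) `^ q2)) ->
  forall f : MR -> R, measurable_fun setT f -> (forall y, 0 < f y) ->
  (poweR (semigroup_op P t (fun y => (f y `^ q1)%:E) x) q1^-1
   <= poweR (semigroup_op P s
               (fun y => poweR (semigroup_op P (t - s) (EFin \o f) y) q2) x) q2^-1
      * (expR (kappa / q2))%:E)%E.
Proof.
move=> q20 q21 q10 H f mf f0.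
rewrite /semigroup_op.
set I2 := (\int[P s x]_y poweR _ q2)%E.
pose fn n y := Num.min (f y) n%:R.
have fn_itv n y : 0 <= fn n y <= n%:R.
  by rewrite /fn le_min (ltW (f0 y)) ler0n/= ge_min lexx orbT.
have mfn n : measurable_fun setT (fn n) by exact: measurable_minr.
have bfn n : bounded_mfun (fn n).
  split => //; exists n%:R => y; have /andP[h1 h2] := fn_itv n y.
  by rewrite ger0_norm.
have mF : measurable_fun setT (fun y : MR => poweR (\int[P (t - s) y]_z (f z)%:E) q2)%E.
  have h : measurable_fun setT (fun y : MR => \int[P (t - s) y]_z (f z)%:E)%E.
    apply: measurable_kernel_integral => [y|]; first by rewrite lee_fin ltW.
    exact/measurable_EFinP.
  exact: (measurableT_comp (measurable_poweR q2) h).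
have I20 : (0 <= I2)%E by apply: integral_ge0 => y _; exact: poweR_ge0.
have key n : (\int[kernel_law (P t) x]_y (fn n y `^ q1)) `^ (q2 / q1) <=
    expR kappa * \int[kernel_law (P s) x]_y ((\int[kernel_law (P (t - s)) y]_z fn n z) `^ q2).
  apply/ler_addgt0Pr => d d0.
  (* so that the cost [expR kappa * e `^ q2] of adding [e] is [d] *)
  pose e := (d / expR kappa) `^ q2^-1.
  have dk0 : 0 < d / expR kappa by rewrite divr_gt0 ?expR_gt0.
  have e0 : 0 < e by exact: powR_gt0.
  have eq2 : e `^ q2 = d / expR kappa by rewrite /e -powRrM mulVf ?gt_eqF// powRr1// ltW.
  have pg : pos_bounded_mfun (fun y => fn n y + e).
    split; first exact: measurable_funD.
    exists e, (n%:R + e); split => // y; have /andP[h1 h2] := fn_itv n y.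
    by rewrite lerDr h1 lerD2r.
  have bq1 (g : MR -> R) q : 0 < q -> measurable_fun setT g ->
      (exists M, forall y, 0 <= g y <= M) -> bounded_mfun (fun y => g y `^ q).
    move=> q0 mg [M hM]; split; first exact: (measurableT_comp (measurable_powR q)).
    exists (M `^ q) => y; have /andP[h1 h2] := hM y.
    by rewrite ger0_norm ?powR_ge0// ge0_ler_powR ?nnegrE ?(ltW q0)// (le_trans h1).
  have := H _ pg.
  have bI := bmf_kernel_law (P (t - s)) (bfn n).
  have Iitv y : 0 <= \int[kernel_law (P (t - s)) y]_z fn n z <= n%:R.
    by apply/andP; split; [apply: E_ge_cst|apply: E_le_cst] => // z; have /andP[] := fn_itv n z.
  have bF : bounded_mfun (fun y : MR => (\int[kernel_law (P (t - s)) y]_z fn n z) `^ q2).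
    apply: bq1 => //; first by case: bI.
    by exists n%:R.
  have l1 : (\int[kernel_law (P t) x]_y (fn n y `^ q1)) `^ (q2 / q1) <=
    (\int[kernel_law (P t) x]_y ((fn n y + e) `^ q1)) `^ (q2 / q1).
    rewrite ge0_ler_powR ?nnegrE//.
    - by rewrite divr_ge0// ltW.
    - by apply: Rintegral_ge0 => y _; exact: powR_ge0.
    - by apply: Rintegral_ge0 => y _; exact: powR_ge0.
    - apply: E_le.
      + by apply: bq1 => //; exists n%:R.
      + by apply: pbf_bmf; exact: pbf_powR.
      + move=> y; have /andP[h1 h2] := fn_itv n y.
        by rewrite ge0_ler_powR ?nnegrE ?(ltW q10)// ?lerDl ?addr_ge0// ltW.
  move=> h; apply: (le_trans l1); apply: (le_trans h).
  rewrite (_ : d = expR kappa * (e `^ q2)); last by rewrite eq2; field; rewrite gt_eqF// expR_gt0.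
  rewrite -mulrDr ler_wpM2l ?expR_ge0//.
  rewrite -[X in _ <= _ + X](Ecst (kernel_law (P s) x)) -ED//; last exact: bmf_cst.
  apply: E_le.
  - rewrite (_ : (fun y => _) = (fun y : MR =>
    (\int[kernel_law (P (t - s)) y]_z fn n z + e) `^ q2)); last first.
      by apply/funext => y; rewrite ED ?Ecst//; exact: bmf_cst.
    apply: bq1 => //.
      by apply: measurable_funD => //; case: bI.
    exists (n%:R + e) => y; have /andP[h1 h2] := Iitv y.
    by rewrite addr_ge0 ?(ltW e0)//= lerD2r.
  - by apply: bmfD => //; exact: bmf_cst.
  - move=> y; rewrite ED ?Ecst//; last exact: bmf_cst.
    by apply: powR_subadditive => //; have /andP[] := Iitv y.
have bfq n : bounded_mfun (fun y => fn n y `^ q1).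
  split; first exact: (measurableT_comp (measurable_powR q1)).
  exists (n%:R `^ q1) => y; have /andP[h1 h2] := fn_itv n y.
  by rewrite ger0_norm ?powR_ge0// ge0_ler_powR ?nnegrE ?(ltW q10).
have q12 : 0 <= q1 / q2 by rewrite divr_ge0// ltW.
set c := ((expR kappa)%:E * I2)%E.
have c0 : (0 <= c)%E by rewrite mule_ge0// lee_fin expR_ge0.
have inI (z : \bar R) : (0 <= z)%E -> z \in `[0%E, +oo%E]%O by move=> z0;
  rewrite in_itv/= z0 leey.
have key2 n : (\int[P t x]_y (fn n y `^ q1)%:E <= poweR c (q1 / q2))%E.
  have -> : (\int[P t x]_y (fn n y `^ q1)%:E =
      (\int[kernel_law (P t) x]_y (fn n y `^ q1))%:E)%E by rewrite -EFin_expectation.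
  set X := \int[_]_y _ in key *.
  have X0 : 0 <= X by apply: Rintegral_ge0 => y _; exact: powR_ge0.
  have -> : X%:E = poweR ((X `^ (q2 / q1))%:E) (q1 / q2).
    rewrite poweR_EFin -powRrM (_ : _ * _ = 1) ?powRr1//.
    by field; rewrite !gt_eqF.
  apply: gt0_ler_poweR => //; [by apply: inI; rewrite lee_fin powR_ge0|exact: inI|].
  apply: (@le_trans _ _ (expR kappa * \int[kernel_law (P s) x]_y
     ((\int[kernel_law (P (t - s)) y]_z fn n z) `^ q2))%:E); first by rewrite lee_fin; exact: key.
  rewrite EFinM /c lee_wpmul2l ?lee_fin ?expR_ge0//.
  have bI := bmf_kernel_law (P (t - s)) (bfn n).
  have Iitv y : 0 <= \int[kernel_law (P (t - s)) y]_z fn n z <= n%:R.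
    by apply/andP; split; [apply: E_ge_cst|apply: E_le_cst] => // z; have /andP[] := fn_itv n z.
  have bF : bounded_mfun (fun y : MR => (\int[kernel_law (P (t - s)) y]_z fn n z) `^ q2).
    split; first by apply: (measurableT_comp (measurable_powR q2)); case: bI.
    exists (n%:R `^ q2) => y; have /andP[h1 h2] := Iitv y.
    by rewrite ger0_norm ?powR_ge0// ge0_ler_powR ?nnegrE ?(ltW q20).
  rewrite -EFin_expectation//; apply: ge0_le_integral => //.
  - by move=> y _; rewrite lee_fin powR_ge0.
  - by apply/measurable_EFinP; case: bF.
  - move=> y _; rewrite -poweR_EFin; apply: gt0_ler_poweR; first exact: ltW.
    + by apply: inI; rewrite lee_fin; have /andP[] := Iitv y.
    + by apply: inI; apply: integral_ge0 => z _; rewrite lee_fin ltW.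
    + rewrite -EFin_expectation//; apply: ge0_le_integral => //.
      * by move=> z _; rewrite lee_fin; have /andP[] := fn_itv n z.
      * by apply/measurable_EFinP.
      * by apply/measurable_EFinP.
      * by move=> z _; rewrite lee_fin ge_min lexx.
have lim : (\int[P t x]_y (f y `^ q1)%:E <= poweR c (q1 / q2))%E.
  have -> : (\int[P t x]_y (f y `^ q1)%:E =
      limn (fun n => \int[P t x]_y (fn n y `^ q1)%:E))%E.
    rewrite -monotone_convergence//.
    - apply: eq_integral => y _; apply/esym/cvg_lim => //.
      apply: cvg_near_cst; near=> n; congr (_ `^ q1)%:E.
      apply/min_idPl/ltW; near: n; exact: nbhs_infty_gtr.
    - by move=> n; apply/measurable_EFinP; case: (bfq n).
    - by move=> n y _; rewrite lee_fin powR_ge0.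
    - move=> y _ m n mn; rewrite lee_fin ge0_ler_powR ?nnegrE ?(ltW q10)//.
      + by have /andP[] := fn_itv m y.
      + by have /andP[] := fn_itv n y.
      + by rewrite /fn le_min ge_min lexx/= ge_min ler_nat mn orbT.
  apply: lime_le; last exact: nearW.
  apply: ereal_nondecreasing_is_cvgn => m n mn.
  apply: ge0_le_integral => //.
  - by move=> z _; rewrite lee_fin powR_ge0.
  - by apply/measurable_EFinP; case: (bfq m).
  - by apply/measurable_EFinP; case: (bfq n).
  - move=> y _; rewrite lee_fin ge0_ler_powR ?nnegrE ?(ltW q10)//.
    + by have /andP[] := fn_itv m y.
    + by have /andP[] := fn_itv n y.
    + by rewrite /fn le_min ge_min lexx/= ge_min ler_nat mn orbT.
have q1i : 0 <= q1^-1 by rewrite invr_ge0 ltW.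
have := gt0_ler_poweR q1i _ _ lim; move/(_ _ _)/le_trans; apply.
- by apply: inI; apply: integral_ge0 => y _; rewrite lee_fin powR_ge0.
- by apply: inI; exact: poweR_ge0.
rewrite -poweRrM (_ : q1 / q2 / q1 = q2^-1); last by field; rewrite !gt_eqF.
by rewrite /c poweRM ?lee_fin ?expR_ge0// poweR_EFin -expRM muleC.
Unshelve. all: by end_near. Qed.

End general_functions.

(** * The first inequality for a convolution semigroup *)

Section levy_convolution_semigroup.
Context (R : realType).
Local Notation MR := (measurableTypeR R).
Context (nu : {measure set MR -> \bar R}) (P : R -> R.-pker MR ~> MR).
Hypotheses (hnu : levy_measure nu) (hP : markov_semigroup P)
    (hgen : has_generator P (levy_op nu)).

Definition law_at0 t : probability MR R := kernel_law (P t) 0.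

Lemma convop_law_at0 t f x : 0 <= t -> bounded_mfun f -> convop law_at0 t f x =
  \int[kernel_law (P t) x]_y f y.
Proof. by move=> t0 bf; rewrite /convop (translation_invariant hnu hP hgen). Qed.

Lemma conv_semigroup_law_at0 : conv_semigroup law_at0.
Proof.
split=> [f x bf|s t f x s0 t0 bf]; first by rewrite convop_law_at0// (expectation_at0 hP).
have bL := bmf_convop law_at0 t bf.
rewrite (convop_law_at0 x (addr_ge0 s0 t0) bf) (chapman_kolmogorov hP x s0 t0 bf)
  (convop_law_at0 x s0 bL).
by apply: eq_Rintegral => y _; rewrite (convop_law_at0 y t0 bf).
Qed.

End levy_convolution_semigroup.

Section first_inequality.
Context (R : realType).
Local Notation MR := (measurableTypeR R).
Variable pi : R -> probability MR R.
Hypothesis hpi : conv_semigroup pi.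

Lemma powR_of_ln (a b r k : R) : 0 < a -> 0 < b ->
  r * ln a - k <= ln b -> a `^ r <= expR k * b.
Proof.
move=> a0 b0 h; rewrite -[b]lnK ?posrE// -expRD /powR gt_eqF// ler_expR.
by rewrite -lerBlDl.
Qed.

(** [variational_core] with [s' = s]: both inputs are plain Gibbs inequalities.
    The factor [expR 0] gives this bound the shape of the one for finite
    Levy measures. *)
Lemma reverse_hypercontractivity s t q1 q2 (f : MR -> R) x :
  0 < s -> s <= t -> 0 < q2 -> q2 <= 1 -> 0 < q1 ->
  q1 * (1 - q2) * s = q2 * (1 - q1) * t -> pos_bounded_mfun f ->
  (convop pi t (fun y => f y `^ q1) x) `^ (q2 / q1) <=
  expR 0 * convop pi s (fun y => (convop pi (t - s) f y) `^ q2) x.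
Proof.
move=> s0 st q20 q21 q10 hq pf.
have pF := pbf_convop pi (t - s) pf; have pFq := pbf_powR pF q20.
have pg := pbf_powR pf q10; have pgs := pbf_convop pi (t - s) pg.
have b0 : bounded_mfun ((fun=> 0) : MR -> R) by exact: bmf_cst.
apply: powR_of_ln; [by apply: pbf_gt0; exact: pbf_convop|by apply: pbf_gt0; exact: pbf_convop|].
have L00 : convop pi s (fun=> 0) x = 0 by rewrite convop_cst.
have := @variational_core _ _ hpi s t q1 q2 f _ _ x
  (convop pi s (fun y => (convop pi (t - s) f y) `^ q2) x) 0 0 0 (ltW s0) st (lt_le_trans s0 st)
  q20 q21 q10 hq pf pF b0.
rewrite /= L00 !mul0r !mulr0 !subr0; apply.
- have h := @gibbs _ pi s _ _ x pFq pgs.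
  set g := fun y => f y `^ q1 in pg pgs h *.
  have e : (fun y => convop pi (t - s) g y * (ln (convop pi (t - s) f y `^ q2) -
    ln (convop pi (t - s) g y))) =
    (fun y => convop pi (t - s) g y * (q2 * ln (convop pi (t - s) f y) -
      ln (convop pi (t - s) g y))).
    by apply/funext => y; rewrite ln_powR.
  rewrite e in h.
  have eZ : convop pi s (convop pi (t - s) g) x = convop pi t g x.
    by rewrite -(hpi.2) ?subr_ge0 ?(ltW s0)//; [congr (convop pi _ _ x); ring|exact: pbf_bmf].
  by rewrite eZ in h.
- move=> y; have gs0 := pbf_gt0 y pgs.
  have := @gibbs _ pi (t - s) _ _ y pf pg; rewrite -(ler_pM2l gs0) => h.
  rewrite mul0r addr0 subr0; apply: le_trans h.
  by rewrite mulrDr mulVKf// gt_eqF.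
Qed.

End first_inequality.

(** * The exponential series of a linear system of phases *)

Section rotation_series.
Context (R : realType).
Variables (p q : R) (al : nat -> R -> R).
Hypothesis al0 : forall c, al 0%N c = cos c.
Hypothesis alS : forall k c, al k.+1 c = p * al k c + q * al k (c + pi / 2).
Hypothesis al1 : forall k c, `|al k c| <= 1.

Let alpi k : forall c, al k (c + pi / 2 + pi / 2) = - al k c.
Proof.
elim: k => [|k IHk] c; first by rewrite !al0 cosDpihalf sinDpihalf.
by rewrite !alS !IHk; ring.
Qed.

Let aS m c (k : nat) : R := k`!%:R^-1 * al (m + k) c.

Let cvg_aS m c x : cvgn (pseries (aS m c) x).
Proof.
apply: normed_cvg; apply: (@series_le_cvg _ _ (exp_coeff `|x|)).
- by move=> n; exact: normr_ge0.
- by move=> n; apply: exp_coeff_ge0.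
- move=> n; rewrite /= /aS 2!normrM normrX exp_coeffE.
  rewrite ger0_norm ?invr_ge0// -mulrA ler_wpM2l ?invr_ge0//.
  by rewrite ler_piMl// exprn_ge0.
- exact: is_cvg_series_exp_coeff.
Qed.

Let diffs_aS m c : pseries_diffs (aS m c) = aS m.+1 c.
Proof.
apply/funext => i; rewrite /pseries_diffs /aS addnS addSn mulrA; congr (_ * _).
by rewrite factS natrM invfM mulVKf// pnatr_eq0.
Qed.

Let S (c x : R) : R := limn (pseries (aS 0 c) x).

Let is_derive_S (c x : R) : is_derive x 1 (S c) (p * S c x + q * S (c + pi / 2) x).
Proof.
have H : is_derive x (1 : R) (S c) (limn (pseries (pseries_diffs (aS 0 c)) x)).
  apply: (@pseries_snd_diffs _ _ (`|x| + 1)); rewrite ?diffs_aS //.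
  by rewrite [ltRHS]ger0_norm// ltrDl.
have e : limn (pseries (pseries_diffs (aS 0 c)) x) = p * S c x + q * S (c + pi / 2) x.
  rewrite diffs_aS; apply/cvg_lim => //.
  have -> : pseries (aS 1 c) x =
      (fun n => p * pseries (aS 0 c) x n + q * pseries (aS 0 (c + pi / 2)) x n).
    apply/funext => n; rewrite /pseries /series/= !mulr_sumr -big_split/=.
    by apply: eq_bigr => i _; rewrite /aS add1n add0n alS; ring.
  by apply: cvgD; apply: cvgM; [exact: cvg_cst|exact: cvg_aS|exact: cvg_cst|exact: cvg_aS].
by rewrite -e.
Qed.

Let Spi c x : S (c + pi / 2 + pi / 2) x = - S c x.
Proof.
rewrite /S; apply/cvg_lim => //.
have -> : pseries (aS 0 (c + pi / 2 + pi / 2)) x = (fun n => - pseries (aS 0 c) x n).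
  apply/funext => n; rewrite /pseries /series/= -sumrN.
  by apply: eq_bigr => i _; rewrite /aS alpi; ring.
by apply: cvgN; exact: cvg_aS.
Qed.

Let S0 c : S c 0 = cos c.
Proof.
rewrite /S; apply/cvg_lim => //; apply: cvg_near_cst; near=> n.
have n0 : (0 < n)%N by near: n; exact: nbhs_infty_gt.
rewrite -(prednK n0) /pseries /series/= big_nat_recl//= big1; last first.
  by move=> i _; rewrite expr0n mulr0.
by rewrite /aS fact0 invr1 mul1r expr0 mulr1 addr0 al0.
Unshelve. all: by end_near. Qed.

(** [al k c] is the [k]-th derivative at [0] of [expR (p x) cos (c + q x)].  The
    sum [S] of the Taylor series and this function solve the same linear system
    for the phases [c] and [c + pi / 2].  The matrix of the system is [p] plus [q]
    times a rotation by a right angle, so for the difference [D] of two solutions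
    [exp (- 2 p x) (D_c^2 + D_(c + pi/2)^2)] is constant, and it vanishes at [0]. *)
Lemma rotation_series c t :
  series (fun k => k`!%:R^-1 * al k c * t ^+ k) @ \oo --> expR (p * t) * cos (c + q * t).
Proof.
pose W (c x : R) : R := expR (p * x) * cos (c + q * x).
have Wpi b x : W (b + pi / 2 + pi / 2) x = - W b x.
  rewrite /W (_ : b + _ + _ + _ = b + q * x + pi / 2 + pi / 2); last by ring.
  by rewrite cosDpihalf sinDpihalf mulrN.
have is_derive_W (b x : R) : is_derive x 1 (W b) (p * W b x + q * W (b + pi / 2) x).
  have h1 : is_derive x 1 (fun y => p * y) p.
    by apply: is_derive_eq; rewrite /GRing.scale/=; ring.
  have h2 : is_derive x 1 (fun y => b + q * y) q.
    by apply: is_derive_eq; rewrite /GRing.scale/=; ring.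
  have h3 : is_derive x 1 (fun y => expR (p * y)) (expR (p * x) * p).
    exact: (@is_derive1_comp _ expR (fun y => p * y) x (expR (p * x)) p (is_derive_expR _) h1).
  have h4 : is_derive x 1 (fun y => cos (b + q * y)) (- sin (b + q * x) * q).
    exact: (@is_derive1_comp _ cos (fun y => b + q * y) x (- sin (b + q * x)) q
      (is_derive_cos _) h2).
  rewrite /W (_ : b + pi / 2 + q * x = b + q * x + pi / 2); last by ring.
  rewrite cosDpihalf; apply: is_derive_eq; rewrite /GRing.scale/=; ring.
pose D (b x : R) : R := S b x - W b x.
have is_derive_D (b x : R) : is_derive x 1 (D b) (p * D b x + q * D (b + pi / 2) x).
  have h1 := is_derive_S b x; have h2 := is_derive_W b x.
  rewrite /D; apply: is_derive_eq; ring.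
have Dpi b x : D (b + pi / 2 + pi / 2) x = - D b x.
  by rewrite /D Spi Wpi; ring.
pose G (x : R) : R := expR (- (2 * p) * x) * (D c x ^+ 2 + D (c + pi / 2) x ^+ 2).
have is_derive_G (x : R) : is_derive x 1 G 0.
  have h1 := is_derive_D c x; have h2 := is_derive_D (c + pi / 2) x.
  rewrite Dpi in h2.
  have h0 : is_derive x 1 (fun y => - (2 * p) * y) (- (2 * p)).
    by apply: is_derive_eq; rewrite /GRing.scale/=; ring.
  have h3 : is_derive x 1 (fun y => expR (- (2 * p) * y)) (expR (- (2 * p) * x) * - (2 * p)).
    exact: (@is_derive1_comp _ expR (fun y => - (2 * p) * y) x (expR (- (2 * p) * x)) _
      (is_derive_expR _) h0).
  rewrite /G; apply: is_derive_eq; rewrite /GRing.scale/= ?expr1; ring.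
have Gt : G t = 0.
  rewrite (is_derive_0_is_cst t 0 is_derive_G) /G /D /W !S0 !mulr0 expR0 !addr0 !mul1r.
  by rewrite !subrr !expr0n/= addr0.
have Dt : D c t = 0.
  move/eqP : Gt; rewrite /G mulf_eq0 gt_eqF ?expR_gt0//=.
  by rewrite paddr_eq0 ?sqr_ge0// => /andP[]; rewrite sqrf_eq0 => /eqP.
have -> : expR (p * t) * cos (c + q * t) = S c t.
  by apply/eqP; rewrite eq_sym -subr_eq0; apply/eqP.
exact: (@cvg_aS 0%N c t).
Qed.

End rotation_series.

(** * Countable mixtures of probabilities *)

Section mixture.
Context d (T : measurableType d) (R : realType).
Variables (w : nat -> {nonneg R}) (m : nat -> probability T R).
Hypothesis w1 : series (fun k => (w k)%:num) @ \oo --> (1 : R).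

Definition mixture : set T -> \bar R := mseries (fun k => mscale (w k) (m k)) 0.

HB.instance Definition _ := Measure.on mixture.

Lemma mixture_ge0_integral (f : T -> R) : bounded_mfun f -> (forall x, 0 <= f x) ->
  (\int[mixture]_x (f x)%:E = \sum_(0 <= k <oo) ((w k)%:num * \int[m k]_x f x)%:E)%E.
Proof.
move=> bf f0; have [mf _] := bf.
rewrite ge0_integral_measure_series//.
- apply: eq_eseriesr => k _.
  rewrite ge0_integral_mscale//; last by move=> x _; rewrite lee_fin.
    by rewrite EFin_expectation// EFinM.
  exact/measurable_EFinP.
- by move=> x _; rewrite lee_fin.
- exact/measurable_EFinP.
Qed.

Lemma mixture_setT : mixture setT = 1%E.
Proof.
have b1 : bounded_mfun ((fun=> 1) : T -> R) by exact: bmf_cst.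
have := mixture_ge0_integral b1 (fun=> ler01).
rewrite integral_cst// mul1e => ->.
apply/cvg_lim => //.
have -> : (fun n : nat => \sum_(0 <= k < n | true) ((w k)%:num * \int[m k]_x 1)%:E)%E =
    EFin \o (series (fun k => (w k)%:num)).
  apply/funext => n; rewrite /= /series/= sumEFin; congr EFin.
  by apply: eq_bigr => k _; rewrite Ecst mulr1.
by apply: cvg_EFin => //; exact: nearW.
Qed.

End mixture.

Section mixture_probability.
Context d (T : measurableType d) (R : realType).

(** Bundled with their normalisation, so that a mixture is a probability by
    inference alone. *)
Record weights := Weights {
  wt :> nat -> {nonneg R};
  wt1 : series (fun k => (wt k)%:num) @ \oo --> (1 : R) }.

Variables (w : weights) (m : nat -> probability T R).

Definition pmixture : set T -> \bar R := mixture w m.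

HB.instance Definition _ := Measure.on pmixture.
HB.instance Definition _ :=
  Measure_isProbability.Build _ _ _ pmixture (mixture_setT m (wt1 w)).

(** Linear in [f], hence reduced to [f + M >= 0], which is integrated term by
    term against a series of measures. *)
Lemma Emixture (f : T -> R) : bounded_mfun f ->
  series (fun k => (w k)%:num * \int[m k]_x f x) @ \oo --> \int[pmixture]_x f x.
Proof.
have pos (g : T -> R) : bounded_mfun g -> (forall x, 0 <= g x) ->
    series (fun k => (w k)%:num * \int[m k]_x g x) @ \oo --> \int[pmixture]_x g x.
  move=> bg g0.
  have h := mixture_ge0_integral w m bg g0.
  have c : (EFin \o series (fun k => (w k)%:num * \int[m k]_x g x)) @ \oo -->
      (\int[pmixture]_x (g x)%:E)%E.
    rewrite h (_ : EFin \o _ = (fun n : nat => \sum_(0 <= k < n | true)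
       ((w k)%:num * \int[m k]_x g x)%:E)%E); last first.
      by apply/funext => n; rewrite /= /series/= sumEFin.
    apply: is_cvg_nneseries => k _ _; rewrite lee_fin mulr_ge0//.
    exact: Rintegral_ge0.
  by rewrite EFin_expectation// in c; move/fine_cvg : c.
move=> bf; have [mf [M hM]] := bf.
have bM : bounded_mfun ((fun=> M) : T -> R) by exact: bmf_cst.
have bfM : bounded_mfun (fun x => f x + M) by exact: bmfD.
have : series (fun k => (w k)%:num * \int[m k]_x (f x + M)) @ \oo --> \int[pmixture]_x (f x + M).
  by apply: pos => // x; rewrite -lerBlDr sub0r; have := hM x; rewrite ler_norml => /andP[].
rewrite ED// Ecst => h2.
have h3 : M * series (fun k => (w k)%:num) n @[n --> \oo] --> M * 1.
  by apply: cvgM; [exact: cvg_cst|exact: wt1].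
have -> : series (fun k => (w k)%:num * \int[m k]_x f x) =
    (fun n => series (fun k => (w k)%:num * \int[m k]_x (f x + M)) n -
              M * series (fun k => (w k)%:num) n).
  apply/funext => n; rewrite /series/= mulr_sumr -sumrB.
  by apply: eq_bigr => k _; rewrite ED// Ecst; ring.
by have := cvgB h2 h3; rewrite mulr1 addrK; exact.
Qed.

End mixture_probability.

(** * The second inequality, from a Gibbs inequality with change of clock *)

Section tilted.
Context (R : realType).
Local Notation MR := (measurableTypeR R).
Variable pi : R -> probability MR R.
Hypothesis hpi : conv_semigroup pi.
Variables (rho : probability MR R) (C : R).
Hypothesis C0 : 0 <= C.

(** The Gibbs inequality for a process run until time [s], tested against the same
    process run until time [r s] and reweighted by [w].  If the jumps form a
    Poisson process of intensity [C] with jump law [rho], the number [k] of jumps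
    has density [exp (- C (s - r s)) r^(-k)] under the former with respect to the
    latter.  Its logarithm contributes [- C (s - r s)] and the mean of
    [- k ln r]; the last is expressed by the Palm formula, in which the expectation
    of [k w] is [C r s] times that of [w] after one additional jump. *)
Definition tilted_gibbs_property : Prop :=
  forall s r (phi w : MR -> R) x, 0 <= s -> 0 < r -> pos_bounded_mfun phi -> pos_bounded_mfun w ->
  ln (convop pi (r * s) w x) - C * (s - r * s) +
    (convop pi (r * s) w x)^-1 *
      (convop pi (r * s) (fun y => w y * (ln (phi y) - ln (w y))) x
       - C * (r * s) * ln r * convop pi (r * s) (fun y => \int[rho]_z w (y + z)) x)
  <= ln (convop pi s phi x).

Hypothesis htilt : tilted_gibbs_property.

Lemma convop_jump_commute t (g : MR -> R) y : bounded_mfun g ->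
  \int[rho]_z convop pi t g (y + z) = convop pi t (fun y => \int[rho]_z g (y + z)) y.
Proof.
move=> bg; rewrite /convop (Efubini _ _ (f := fun p : MR * MR => g (y + p.1 + p.2))).
  by apply: eq_Rintegral => z _; apply: eq_Rintegral => u _; rewrite addrAC.
apply: (@bmf_comp _ _ _ _ _ (fun p : MR * MR => (y + p.1 + p.2 : MR))) bg.
apply: measurable_funD; last exact: measurable_snd.
by apply: measurable_funD => //; exact: measurable_fst.
Qed.

(** [variational_core] at [s' = (q2 / q1) s], the time for which its relation
    between the exponents holds.  The clock is multiplied by [q2 / q1] before the
    cut and by [1 / q1] after it, as [t - s' = (t - s) / q1].  The terms in the
    number of jumps add up to a multiple of [s ln (q2 / q1) + (t - s) ln (1 / q1)],
    which is nonpositive: [ln y <= y - 1] bounds it by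
    [(t - s + s q2) / q1 - t = 0]. *)
Lemma reverse_hypercontractivity_tilted s t q1 q2 (f : MR -> R) x :
  0 < s -> s <= t -> 0 < q2 -> q2 <= q1 -> q1 < 1 ->
  s * (q2 - 1) = t * (q1 - 1) -> pos_bounded_mfun f ->
  (convop pi t (fun y => f y `^ q1) x) `^ (q2 / q1) <=
  expR (C * (s - q2 / q1 * s) * (1 - q2)) *
  convop pi s (fun y => (convop pi (t - s) f y) `^ q2) x.
Proof.
move=> s0 st q20 q21 q11 hq pf.
have q10 : 0 < q1 by rewrite (lt_le_trans q20).
have q1n : q1 != 0 by rewrite gt_eqF.
have t0 : 0 < t by rewrite (lt_le_trans s0).
have ts0 : 0 <= t - s by rewrite subr_ge0.
have q2l1 : q2 <= 1 by rewrite (le_trans q21)// ltW.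
have hq' : t * q1 = t - s + s * q2 by lra.
pose s' := q2 / q1 * s.
have s'0 : 0 <= s' by rewrite mulr_ge0 ?divr_ge0// ltW.
have s's : s' <= s by rewrite /s' ler_piMl ?(ltW s0)// ler_pdivrMr// mul1r.
have s't : s' <= t by rewrite (le_trans s's).
have ts'0 : 0 <= t - s' by rewrite subr_ge0.
have ts' : t - s' = q1^-1 * (t - s).
  apply: (mulfI q1n); rewrite mulrA divff// mul1r mulrBr (mulrC q1) hq' /s'.
  by field.
have hq3 : q1 * (1 - q2) * s' = q2 * (1 - q1) * t.
  rewrite (_ : q1 * (1 - q2) * s' = - q2 * (s * (q2 - 1))); last by rewrite /s'; field.
  by rewrite hq; ring.
pose F := convop pi (t - s) f.
have pF : pos_bounded_mfun F by exact: pbf_convop. have pFq := pbf_powR pF q20.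
pose g := fun y => f y `^ q1.
have pg : pos_bounded_mfun g by exact: pbf_powR. have bg := pbf_bmf pg.
pose gs := convop pi (t - s') g.
have pgs : pos_bounded_mfun gs by exact: pbf_convop.
pose Ag := fun y : MR => \int[rho]_z g (y + z).
have bAg : bounded_mfun Ag by exact: bmf_Eshift.
have Ag0 y : 0 <= Ag y by apply: Rintegral_ge0 => z _; exact: powR_ge0.
pose M := convop pi (t - s') Ag.
have bM : bounded_mfun M by exact: bmf_convop.
pose V := convop pi s (fun y => (F y) `^ q2) x.
have V0 : 0 < V by apply: pbf_gt0; exact: pbf_convop.
pose Z := convop pi t g x.
have Z0 : 0 < Z by apply: pbf_gt0; exact: pbf_convop.
have eZ : convop pi s' gs x = Z.
  by have := hpi.2 s' (t - s') g x s'0 ts'0 bg; rewrite subrKC => e; exact: (esym e).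
apply: powR_of_ln => //; rewrite -/Z.
pose m := convop pi s' M x.
have m0 : 0 <= m.
  by apply: Rintegral_ge0 => y _; apply: Rintegral_ge0 => z _; exact: Ag0.
have outer : ln Z - C * (s - s') +
    Z^-1 * (convop pi s' (fun y => gs y * (q2 * ln (F y) - ln (gs y))) x -
      C * s' * ln (q2 / q1) * m) <= ln V.
  have h := htilt x (ltW s0) (divr_gt0 q20 q10) pFq pgs.
  rewrite -/s' eZ in h.
  have e1 : (fun y => gs y * (ln (F y `^ q2) - ln (gs y))) =
     (fun y => gs y * (q2 * ln (F y) - ln (gs y))).
    by apply/funext => y; rewrite ln_powR.
  have e2 : (fun y => \int[rho]_z gs (y + z)) = M.
    by apply/funext => y; rewrite /gs convop_jump_commute.
  by rewrite e1 e2 in h.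
have inner y : gs y * ln (gs y) + C * (s - s') * gs y +
    convop pi (t - s') (fun z => g z * (ln (f z) - ln (g z))) y -
    C * (t - s') * ln q1^-1 * M y <= gs y * ln (F y).
  have gs0 := pbf_gt0 y pgs.
  have q1i : 0 < q1^-1 by rewrite invr_gt0.
  have h := htilt y ts0 q1i pf pg.
  rewrite -ts' -/gs -/M -(ler_pM2l gs0) in h.
  apply: le_trans h; rewrite le_eqVlt; apply/orP; left; apply/eqP.
  by rewrite -/(gs y) -/(M y) -/(F y); field; rewrite gt_eqF.
have := variational_core hpi s'0 s't t0 q20 q2l1 q10 hq3 pf pF bM outer inner.
rewrite -/g -/Z -/m; apply: le_trans.
rewrite -/s' -[leLHS]subr0 lerD2l lerN2 mulr_ge0_le0// ?invr_ge0 ?(ltW Z0)//.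
rewrite mulr_ge0_le0//.
have -> : C * s' * ln (q2 / q1) + q2 * (C * (t - s') * ln q1^-1) =
    C * (q2 / q1) * (s * ln (q2 / q1) + (t - s) * ln q1^-1).
  by rewrite ts' /s'; field.
rewrite mulr_ge0_le0 ?mulr_ge0 ?invr_ge0 ?(ltW q20) ?(ltW q10)//.
have l1 : s * ln (q2 / q1) <= s * (q2 / q1 - 1).
  by rewrite ler_wpM2l ?(ltW s0)// ln_le_sub1// divr_gt0.
have l2 : (t - s) * ln q1^-1 <= (t - s) * (q1^-1 - 1).
  by rewrite ler_wpM2l// ln_le_sub1// invr_gt0.
apply: (le_trans (lerD l1 l2)).
have -> : s * (q2 / q1 - 1) + (t - s) * (q1^-1 - 1) = (t - s + s * q2) / q1 - t by field.
by rewrite -hq' mulfK// subrr.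
Qed.

End tilted.

(** * Compound Poisson laws *)

Section compound_poisson.
Context (R : realType).
Local Notation MR := (measurableTypeR R).
Variables (rho : probability MR R) (C : R).
Hypothesis C0 : 0 <= C.

Fixpoint conv_power (k : nat) : probability MR R :=
  if k is j.+1 then convolution (conv_power j) rho else (dirac (0 : MR) : probability MR R).

(** The absolute value makes this a probability for every real [t], as a family
    of probabilities indexed by the reals must be. *)
Definition poisson_wt (t : R) (k : nat) : R :=
  expR (- (C * `|t|)) * exp_coeff (C * `|t|) k.

Lemma poisson_wt_ge0 t k : 0 <= poisson_wt t k.
Proof. by rewrite mulr_ge0 ?expR_ge0// exp_coeff_ge0// mulr_ge0. Qed.

Definition poisson_nng t k : {nonneg R} := NngNum (poisson_wt_ge0 t k).

Lemma poisson_wt1 t : series (fun k => (poisson_nng t k)%:num) @ \oo --> (1 : R).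
Proof.
have -> : series (fun k => (poisson_nng t k)%:num) =
    (fun n => expR (- (C * `|t|)) * series (exp_coeff (C * `|t|)) n).
  by apply/funext => n; rewrite /series/= mulr_sumr.
rewrite -[X in _ --> X](_ : expR (- (C * `|t|)) * expR (C * `|t|) = 1).
  by apply: cvgM; [exact: cvg_cst|exact: is_cvg_series_exp_coeff].
by rewrite -expRD addNr expR0.
Qed.

Definition poisson_weights t := Weights (poisson_wt1 t).

Definition cpoisson (t : R) : probability MR R := pmixture (poisson_weights t) conv_power.

Lemma Ecpoisson t (f : MR -> R) : bounded_mfun f ->
  series (fun k => poisson_wt t k * \int[conv_power k]_x f x) @ \oo --> \int[cpoisson t]_x f x.
Proof. exact: Emixture. Qed.

Lemma Econv_power0 (f : MR -> R) : bounded_mfun f -> \int[conv_power 0]_x f x = f 0.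
Proof. exact: Edirac. Qed.

Lemma Econv_powerS k (f : MR -> R) : bounded_mfun f ->
  \int[conv_power k.+1]_x f x = \int[conv_power k]_x \int[rho]_z f (x + z).
Proof. exact: Econv. Qed.

(** An additional jump acts on [E cos (xi x + c)] by combining the phases [c] and
    [c + pi / 2] with coefficients [E cos (xi z)] and [E sin (xi z)], and
    [rotation_series] sums over the number of jumps. *)
Lemma cpoisson_char xi c t : 0 <= t ->
  \int[cpoisson t]_x cos (xi * x + c) =
  expR (C * t * (\int[rho]_z cos (xi * z) - 1)) *
  cos (c + C * t * \int[rho]_z sin (xi * z)).
Proof.
move=> t0.
set p := \int[rho]_z cos (xi * z); set q := \int[rho]_z sin (xi * z).
pose al k c := \int[conv_power k]_x cos (xi * x + c).
have bc c' : bounded_mfun (fun x : MR => cos (xi * x + c')) by exact: bmf_cos.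
have bs : bounded_mfun (fun x : MR => sin (xi * x)).
  rewrite (_ : (fun x => _) = (fun x => cos (xi * x + - (pi / 2)))) ?bc//.
  by apply/funext => x; rewrite cosBpihalf.
have bc0 : bounded_mfun (fun x : MR => cos (xi * x)).
  by rewrite (_ : (fun x => _) = (fun x => cos (xi * x + 0))) ?bc//; apply/funext => x;
    rewrite addr0.
have al0 c' : al 0%N c' = cos c' by rewrite /al Econv_power0// mulr0 add0r.
have alS k c' : al k.+1 c' = p * al k c' + q * al k (c' + pi / 2).
  rewrite /al Econv_powerS// -!EZ// -ED; [|by apply: bmfM => //; exact: bmf_cst..].
  apply: eq_Rintegral => x _.
  rewrite addrA cosDpihalf -/p mulrC [q * _]mulrC mulNr -!EZ//.
  rewrite -EB; [|by apply: bmfM => //; exact: bmf_cst..].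
  apply: eq_Rintegral => z _.
  by rewrite (_ : xi * (x + z) + c' = (xi * x + c') + xi * z) ?cosD//; ring.
have al1 k c' : `|al k c'| <= 1.
  by apply: E_norm_le => // x; exact: cos_max.
have h := @rotation_series _ _ _ _ al0 alS al1 c (C * t).
have h2 : expR (- (C * t)) * series (fun k => k`!%:R^-1 * al k c * (C * t) ^+ k) n @[n --> \oo]
    --> expR (- (C * t)) * (expR (p * (C * t)) * cos (c + q * (C * t))).
  by apply: cvgM => //; exact: cvg_cst.
have h3 := @Ecpoisson t _ (bc c).
have e1 : expR (- (C * t)) * (expR (p * (C * t)) * cos (c + q * (C * t))) =
    expR (C * t * (p - 1)) * cos (c + C * t * q).
  by rewrite mulrA -expRD; congr (expR _ * cos _); ring.
have e2 : series (fun k => poisson_wt t k * al k c) = (fun n => expR (- (C * t)) *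
    series (fun k => k`!%:R^-1 * al k c * (C * t) ^+ k) n).
  apply/funext => n; rewrite /series/= mulr_sumr; apply: eq_bigr => k _.
  by rewrite /poisson_wt /exp_coeff/= ger0_norm//; ring.
rewrite -e1; rewrite -e2 in h2.
exact: (cvg_unique _ h3 h2).
Qed.

(** As in [gibbs], the tangent of [expR] is used, but for each number [k] of jumps
    at a point that depends on [k]; the weights [r^k] turn the Poisson law of
    parameter [C s] into the one of parameter [C r s].  The number [c] is the mean
    for which the linear terms add up to [W]. *)
Lemma tilted_gibbs : tilted_gibbs_property cpoisson rho C.
Proof.
move=> s r phi w x s0 r0 pp pw; set W := convop cpoisson (r * s) w x.
have bp := pbf_bmf pp; have bw := pbf_bmf pw.
have lp := pbf_ln pp; have lw := pbf_ln pw.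
have rs0 : 0 <= r * s by rewrite mulr_ge0// ltW.
have W0 : 0 < W by apply: pbf_gt0; exact: pbf_convop.
set D := convop cpoisson (r * s) _ x.
set m := convop cpoisson (r * s) (fun y => \int[rho]_z w (y + z)) x.
set c := W^-1 * _.
have bD : bounded_mfun (fun y => w y * (ln (phi y) - ln (w y))) by apply: bmfM => //; exact: bmfB.
have bA : bounded_mfun (fun y : MR => \int[rho]_z w (y + z)) by exact: bmf_Eshift.
pose E k (f : MR -> R) := \int[conv_power k]_y f (x + y).
have sh (f : MR -> R) : bounded_mfun f -> bounded_mfun (fun y : MR => f (x + y)) by move=> bf;
  exact: bmf_shift.
pose K := expR (c - C * (s - r * s)).
(* on the event of exactly [k] jumps, the tangent of [expR] at [c + k ln r] *)
have term k : K * (poisson_wt (r * s) k *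
  ((1 - c) * E k w + E k (fun y => w y * (ln (phi y) - ln (w y))))
     - ln r * (k%:R * (poisson_wt (r * s) k * E k w))) <= poisson_wt s k * E k phi.
  have ewt : poisson_wt s k * r ^+ k = expR (- (C * (s - r * s))) * poisson_wt (r * s) k.
    have E1 : expR (- (C * s)) = expR (- (C * (s - r * s))) * expR (- (C * (r * s))).
      by rewrite -expRD; congr expR; ring.
    rewrite /poisson_wt /exp_coeff/= !ger0_norm//
      E1 (_ : (C * (r * s)) ^+ k = r ^+ k * (C * s) ^+ k).
      by ring.
    by rewrite -exprMn; congr (_ ^+ k); ring.
  have ew : E k (fun y => (expR c * r ^+ k) * ((1 - c - k%:R * ln r) * w y +
    w y * (ln (phi y) - ln (w y)))) <= E k phi.
    apply: E_le; [|exact: sh|].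
      apply: (sh (fun y => (expR c * r ^+ k) * ((1 - c - k%:R * ln r) * w y +
        w y * (ln (phi y) - ln (w y))))).
      apply: bmfM; first exact: bmf_cst.
      by apply: bmfD => //; apply: bmfM => //; exact: bmf_cst.
    move=> y; set y' := x + y; have w0 := pbf_gt0 y' pw; have p0 := pbf_gt0 y' pp.
    have rk0 : 0 < r ^+ k by rewrite exprn_gt0.
    have e3 : phi y' = expR c * r ^+ k * w y' * expR (ln (phi y') - ln (w y') - c - k%:R * ln r).
      rewrite !expRB expRM_natl !lnK ?posrE//; field.
      by rewrite !gt_eqF ?expR_gt0.
    rewrite [leRHS]e3 -[leRHS]mulrA ler_wpM2l ?mulr_ge0 ?expR_ge0 ?(ltW rk0)//.
    rewrite [leLHS](_ : _ = w y' * (1 + (ln (phi y') - ln (w y') - c - k%:R * ln r)));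
      last by ring.
    by rewrite ler_wpM2l ?(ltW w0)// expR_ge1Dx.
  rewrite /E EZ in ew; last first.
    apply: (sh (fun y => (1 - c - k%:R * ln r) * w y + w y * (ln (phi y) - ln (w y)))).
    by apply: bmfD => //; apply: bmfM => //; exact: bmf_cst.
  rewrite ED in ew; [|by apply: (sh (fun y => _ * w y)); apply: bmfM => //; exact: bmf_cst
     |exact: (sh _ bD)].
  rewrite EZ in ew; last exact: sh.
  have {}ew := ler_wpM2l (poisson_wt_ge0 s k) ew.
  apply: le_trans ew.
  rewrite /K expRD -/(E k w) -/(E k (fun y => w y * (ln (phi y) - ln (w y)))).
  set e2 := E k (fun y => w y * (ln (phi y) - ln (w y))).
  rewrite [leRHS](_ : _ = expR c * (poisson_wt s k * r ^+ k) * ((1 - c - k%:R * ln r) * E k w +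
    e2)); last by ring.
  by rewrite ewt le_eqVlt; apply/orP; left; apply/eqP; ring.
have s1 : series (fun k => poisson_wt s k * E k phi) @ \oo --> convop cpoisson s phi x.
  exact: Ecpoisson (sh _ bp).
have s2 : series (fun k => poisson_wt (r * s) k * E k w) @ \oo --> W.
  exact: Ecpoisson (sh _ bw).
have s3 : series (fun k => poisson_wt (r * s) k * E k (fun y => w y * (ln (phi y) - ln (w y))))
  @ \oo --> D.
  exact: Ecpoisson (sh _ bD).
(* the Palm formula: [k] times the weight of [k] jumps is [C r s] times the weight
   of [k - 1] jumps, and one jump is split off the sum *)
have s4 : series (fun k => k%:R * (poisson_wt (r * s) k * E k w)) @ \oo --> C * (r * s) * m.
  have s5 : series (fun k => poisson_wt (r * s) k * E k (fun y => \int[rho]_z w (y + z))) @ \oo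
    --> m.
    exact: Ecpoisson (sh _ bA).
  rewrite -cvg_shiftS.
  rewrite (_ : (fun n => _) = (fun n => C * (r * s) *
     series (fun k => poisson_wt (r * s) k * E k (fun y => \int[rho]_z w (y + z))) n)).
    by apply: cvgM => //; exact: cvg_cst.
  apply/funext => n; rewrite /series/= big_nat_recl//= mul0r add0r mulr_sumr.
  apply: eq_bigr => k _.
  have -> : E k.+1 w = E k (fun y => \int[rho]_z w (y + z)).
    rewrite /E Econv_powerS; last exact: sh.
    by apply: eq_Rintegral => y _; apply: eq_Rintegral => z _; rewrite addrA.
  rewrite /poisson_wt /exp_coeff/= ger0_norm// factS natrM exprS.
  field.
  by rewrite addrC natr1 !pnatr_eq0 -lt0n fact_gt0.
have slim : series (fun k => K * (poisson_wt (r * s) k *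
  ((1 - c) * E k w + E k (fun y => w y * (ln (phi y) - ln (w y))))
     - ln r * (k%:R * (poisson_wt (r * s) k * E k w)))) @ \oo -->
     K * ((1 - c) * W + D - ln r * (C * (r * s) * m)).
  rewrite (_ : series _ = (fun n => K * ((1 - c) * series (fun k =>
    poisson_wt (r * s) k * E k w) n +
      series (fun k => poisson_wt (r * s) k * E k (fun y => w y * (ln (phi y) - ln (w y)))) n
      - ln r * series (fun k => k%:R * (poisson_wt (r * s) k * E k w)) n))).
    apply: cvgM; first exact: cvg_cst.
    apply: cvgB; last by apply: cvgM => //; exact: cvg_cst.
    by apply: cvgD => //; apply: cvgM => //; exact: cvg_cst.
  apply/funext => n; rewrite /series/= !mulr_sumr -big_split/= -sumrB mulr_sumr.
  by apply: eq_bigr => k _; ring.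
have main : K * ((1 - c) * W + D - ln r * (C * (r * s) * m)) <= convop cpoisson s phi x.
  apply: (ler_cvg_to slim s1); apply: nearW => n.
  by apply: ler_sum => k _; exact: term.
have alg (W' D' m' k l : R) : W' != 0 ->
    (1 - W'^-1 * (D' - k * l * m')) * W' + D' - l * (k * m') = W'.
  by move=> W'0; field.
have e : (1 - c) * W + D - ln r * (C * (r * s) * m) = W.
  by rewrite /c; exact: (alg W D m (C * (r * s)) (ln r) (negbT (gt_eqF W0))).
rewrite e in main.
by have := ler_lnD_expR W0 main; rewrite addrA addrAC.
Qed.

End compound_poisson.

(** * Finite Levy measures and the theorem *)

Section finite_activity.
Context (R : realType).
Local Notation MR := (measurableTypeR R).
Context (nu : {measure set MR -> \bar R}) (C : R).
Hypothesis nuC : nu [set: MR] = C%:E.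

(** For [nu = 0] the normalisation is the Dirac mass at [0]; as [C = 0] then,
    the compound Poisson process is constant whatever the jump law. *)
Definition jump_law : probability MR R := mnormalize nu (dirac (0 : MR) : probability MR R).

Lemma intensity_ge0 : 0 <= C.
Proof. by rewrite -lee_fin -nuC measure_ge0. Qed.

Lemma nu_jump_law A : measurable A -> nu A = (C%:E * jump_law A)%E.
Proof.
move=> mA; change (nu A = (C%:E * (if (nu [set: MR] == 0%E) || (nu [set: MR] == +oo%E)
  then fun U => dirac (0%R : MR) U
  else fun U => nu U * ((fine (nu [set: MR]))^-1)%:E) A))%E.
rewrite nuC.
have [C0|C0] := eqVneq C%:E 0%E; rewrite /=.
  move: C0 => [C0]; rewrite C0 mul0e; apply/eqP; rewrite eq_le measure_ge0 andbT.
  have n0 : nu [set: MR] = 0%E := etrans nuC (congr1 EFin C0).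
  by rewrite -n0 le_measure ?inE.
have C0' : C != 0 by apply: contra_neq C0 => ->.
by rewrite muleCA -EFinM divff// mule1.
Qed.

Lemma Ejump_law (f : MR -> R) : bounded_mfun f -> \int[nu]_z f z = C * \int[jump_law]_z f z.
Proof.
move=> bf; have [mf [M hM]] := bf.
have inu (g : MR -> R) : bounded_mfun g -> nu.-integrable setT (EFin \o g).
  move=> [mg [N hN]]; apply: measurable_bounded_integrable => //.
    by rewrite nuC ltry.
  exists N; split; first exact: num_real.
  by move=> N' NN' x _ /=; rewrite (le_trans (hN x))// ltW.
have bM : bounded_mfun ((fun=> M) : MR -> R) by exact: bmf_cst.
have bfM : bounded_mfun (fun x => f x + M) by exact: bmfD.
have fM0 x : 0 <= f x + M by rewrite -lerBlDr sub0r; have := hM x; rewrite ler_norml => /andP[].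
have : \int[nu]_z (f z + M) = C * \int[jump_law]_z (f z + M).
  rewrite {1}/Rintegral (eq_measure_integral (mscale (NngNum intensity_ge0) jump_law));
    last first.
    by move=> A mA _; rewrite /mscale/=; exact: nu_jump_law.
  rewrite ge0_integral_mscale//.
    by rewrite EFin_expectation.
    by apply/measurable_EFinP; case: bfM.
  by move=> x _; rewrite lee_fin.
rewrite ED// RintegralD//; [|exact: inu|exact: inu].
rewrite Rintegral_cst// Ecst nuC/= mulrDr (mulrC M).
by move/addIr.
Qed.

Section identification.
Context (P : R -> R.-pker MR ~> MR).
Hypotheses (hnu : levy_measure nu) (hP : markov_semigroup P)
    (hgen : has_generator P (levy_op nu)).

(** The total compensator: a finite Levy measure does not need one, and the
    process is compound Poisson with speed [- drift]. *)
Definition drift : R := C * \int[jump_law]_z (z * levy_trunc z).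

Let N := cpoisson jump_law intensity_ge0.

Lemma bmf_trunc : bounded_mfun (fun z : MR => z * levy_trunc z).
Proof.
split; first by apply: measurable_funM => //; exact: measurable_levy_trunc.
exists 1 => z; have h0 := levy_trunc_gt0 z.
have hz : levy_trunc z * (1 + `|z| ^+ 2) = 1.
  by rewrite mulVf// gt_eqF// ltr_wpDr// sqr_ge0.
rewrite normrM (gtr0_norm h0).
have z0 := normr_ge0 z; have : 0 <= (`|z| - 1) ^+ 2 by rewrite sqr_ge0.
nra.
Qed.

(** Both laws have the same trigonometric integrals: for finite [nu] the Levy
    exponent splits into [C (E exp (i xi z) - 1)] and [- i xi drift]. *)
Lemma law_at0_cpoisson t (f : MR -> R) x : 0 <= t -> bounded_mfun f ->
  convop (law_at0 P) t f x = convop N t f (x - drift * t).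
Proof.
move=> t0 bf; rewrite /convop.
rewrite (@eq_law _ (law_at0 P t) (convolution (dirac (- (drift * t) : MR)) (N t))); last first.
  apply: trig_unique => xi c.
  rewrite [LHS](characteristic_function hnu hP hgen)// Econv; last exact: bmf_cos.
  rewrite Edirac; last by apply: (@bmf_Eshift _ _ (fun y => cos (xi * y + c))); exact: bmf_cos.
  under [RHS]eq_Rintegral do rewrite mulrDr -addrA addrCA.
  rewrite cpoisson_char//.
  have bc : bounded_mfun (fun z : MR => cos (xi * z)).
    rewrite (_ : (fun x => _) = (fun x => cos (xi * x + 0))); first exact: bmf_cos.
    by apply/funext => y; rewrite addr0.
  have bs : bounded_mfun (fun z : MR => sin (xi * z)).
    rewrite (_ : (fun x => _) = (fun x => cos (xi * x + - (pi / 2)))); first exact: bmf_cos.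
    by apply/funext => y; rewrite cosBpihalf.
  have -> : symbol_re nu xi = C * (\int[jump_law]_z cos (xi * z) - 1).
    rewrite /symbol_re Ejump_law; last by apply: bmfB => //; exact: bmf_cst.
    by rewrite EB ?Ecst//; exact: bmf_cst.
  have -> : symbol_im nu xi = C * \int[jump_law]_z sin (xi * z) - xi * drift.
    rewrite /symbol_im (_ : (fun z => _) = (fun z => sin (xi * z) - xi * (z * levy_trunc z)));
      last first.
      by apply/funext => z; rewrite mulrA.
    have bt := bmf_trunc.
    rewrite Ejump_law; last by apply: bmfB => //; apply: bmfM => //; exact: bmf_cst.
    rewrite EB//; last by apply: bmfM => //; exact: bmf_cst.
    by rewrite EZ// /drift; ring.
  by congr (expR _ * cos _); ring.
rewrite Econv; last exact: bmf_shift.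
rewrite Edirac; last by apply: (@bmf_Eshift _ _ (fun y => f (x + y))); exact: bmf_shift.
by apply: eq_Rintegral => y _; rewrite addrA.
Qed.

Lemma convop_cpoisson t (f : MR -> R) x : 0 <= t -> bounded_mfun f ->
  convop N t f x = convop (law_at0 P) t f (x + drift * t).
Proof. by move=> t0 bf; rewrite law_at0_cpoisson// addrK. Qed.

(** Inherited from the semigroup [P] by removal of the drift, which commutes with
    convolution. *)
Lemma conv_semigroup_cpoisson : conv_semigroup N.
Proof.
have hl := conv_semigroup_law_at0 hnu hP hgen.
split=> [f x bf|s t f x s0 t0 bf].
  by rewrite convop_cpoisson// mulr0 addr0 hl.1.
rewrite (convop_cpoisson x (addr_ge0 s0 t0) bf) (hl.2 _ _ _ _ s0 t0 bf).
rewrite (convop_cpoisson x s0 (bmf_convop _ _ bf)).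
apply: eq_convop_shift => y.
by rewrite convop_cpoisson//; congr (convop _ _ _ _); ring.
Qed.

(** The drift only displaces the starting point, and by [drift * t] on both
    sides. *)
Lemma reverse_hypercontractivity_finite s t q1 q2 (f : MR -> R) x :
  0 < s -> s <= t -> 0 < q2 -> q2 <= q1 -> q1 < 1 ->
  s * (q2 - 1) = t * (q1 - 1) -> pos_bounded_mfun f ->
  (convop (law_at0 P) t (fun y => f y `^ q1) x) `^ (q2 / q1) <=
  expR (C * (s - q2 / q1 * s) * (1 - q2)) *
  convop (law_at0 P) s (fun y => (convop (law_at0 P) (t - s) f y) `^ q2) x.
Proof.
move=> s0 st q20 q21 q11 hq pf.
have q10 : 0 < q1 by rewrite (lt_le_trans q20).
have ts0 : 0 <= t - s by rewrite subr_ge0.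
have bg : bounded_mfun (fun y => f y `^ q1) by apply: pbf_bmf; exact: pbf_powR.
have bF : bounded_mfun (fun y => (convop (law_at0 P) (t - s) f y) `^ q2).
  by apply: pbf_bmf; apply: pbf_powR => //; exact: pbf_convop.
have eL : convop (law_at0 P) t (fun y => f y `^ q1) x =
  convop N t (fun y => f y `^ q1) (x - drift * t).
  by rewrite law_at0_cpoisson// (le_trans (ltW s0)).
have eR : convop (law_at0 P) s (fun y => (convop (law_at0 P) (t - s) f y) `^ q2) x =
    convop N s (fun y => (convop N (t - s) f y) `^ q2) (x - drift * t).
  rewrite (law_at0_cpoisson x (ltW s0) bF).
  apply: eq_convop_shift => y.
  rewrite (law_at0_cpoisson (x - drift * s + y) ts0 (pbf_bmf pf)).
  by congr ((convop _ _ _ _) `^ _); ring.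
rewrite eL eR.
exact: (reverse_hypercontractivity_tilted conv_semigroup_cpoisson intensity_ge0
  (tilted_gibbs jump_law intensity_ge0)).
Qed.

End identification.
End finite_activity.

Theorem theorem6p1 (R : realType)
    (nu : {measure set (measurableTypeR R) -> \bar R})
    (P : R -> R.-pker (measurableTypeR R) ~> (measurableTypeR R))
    (hnu : levy_measure nu) (hP : markov_semigroup P)
    (hgen : has_generator P (levy_op nu)) :
  (forall s t q1 q2 : R,
     0 < s -> s <= t -> 0 < q2 -> q2 <= q1 -> q1 < 1 ->
     q2 - 1 = q2 / q1 * (t / s) * (q1 - 1) ->
     forall f : R -> R,
       measurable_fun [set: measurableTypeR R] (f : measurableTypeR R -> measurableTypeR R) ->
       (forall x, 0 < f x) ->
       forall x : R,
         (poweR (semigroup_op P t (fun y => (f y `^ q1)%:E) x) q1^-1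
          <= poweR (semigroup_op P s
                      (fun y => poweR (semigroup_op P (t - s) (EFin \o f) y) q2) x)
               q2^-1)%E) /\
  (forall (C s t q1 q2 : R),
     nu [set: measurableTypeR R] = C%:E ->
     0 < s -> s <= t -> 0 < q2 -> q2 <= q1 -> q1 < 1 ->
     q2 - 1 = t / s * (q1 - 1) ->
     forall f : R -> R,
       measurable_fun [set: measurableTypeR R] (f : measurableTypeR R -> measurableTypeR R) ->
       (forall x, 0 < f x) ->
       forall x : R,
         (poweR (semigroup_op P t (fun y => (f y `^ q1)%:E) x) q1^-1
          <= poweR (semigroup_op P s
                      (fun y => poweR (semigroup_op P (t - s) (EFin \o f) y) q2) x)
               q2^-1
             * (expR (C * (s * (t - s) * (1 - q2) ^+ 2
                           / (q2 * (s * q2 + t - s)))))%:E)%E).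
Proof.
have ker (s t q1 q2 : R) (g : measurableTypeR R -> R) x : 0 < s -> s <= t -> 0 < q2 ->
  0 < q1 -> pos_bounded_mfun g ->
    \int[kernel_law (P t) x]_y (g y `^ q1) = convop (law_at0 P) t (fun y => g y `^ q1) x /\
    \int[kernel_law (P s) x]_y ((\int[kernel_law (P (t - s)) y]_z g z) `^ q2) =
      convop (law_at0 P) s (fun y => (convop (law_at0 P) (t - s) g y) `^ q2) x.
  move=> s0 st q20 q10 pg; have ts0 : 0 <= t - s by rewrite subr_ge0.
  have bF : bounded_mfun (fun y => (convop (law_at0 P) (t - s) g y) `^ q2).
    by apply: pbf_bmf; apply: pbf_powR => //; exact: pbf_convop.
  have bg : bounded_mfun (fun y => g y `^ q1) by apply: pbf_bmf; exact: pbf_powR.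
  split; first exact: esym (convop_law_at0 hnu hP hgen x (le_trans (ltW s0) st) bg).
  rewrite (convop_law_at0 hnu hP hgen x (ltW s0) bF); apply: eq_Rintegral => y _.
  by rewrite (convop_law_at0 hnu hP hgen y ts0 (pbf_bmf pg)).
split=> [s t q1 q2 s0 st q20 q21 q11 hq f mf f0 x|C s t q1 q2 nuC s0 st q20 q21 q11 hq f mf f0 x].
- have q10 : 0 < q1 by rewrite (lt_le_trans q20).
  have q2l1 : q2 <= 1 by rewrite (le_trans q21)// ltW.
  (* no exponential factor here: the constant of [extend_to_positive] is [0] *)
  rewrite -[leRHS]mule1 -[X in (_ * X%:E)%E]expR0 -(mul0r q2^-1).
  apply: extend_to_positive => // g pg.
  have [-> ->] := ker s t q1 q2 g x s0 st q20 q10 pg.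
  apply: (reverse_hypercontractivity (conv_semigroup_law_at0 hnu hP hgen)) => //.
  apply/eqP; rewrite -subr_eq0; apply/eqP.
  have -> : 1 - q2 = - (q2 - 1) by ring.
  by rewrite hq; field; rewrite !gt_eqF.
- have q10 : 0 < q1 by rewrite (lt_le_trans q20).
  have q2l1 : q2 <= 1 by rewrite (le_trans q21)// ltW.
  have hq' : s * (q2 - 1) = t * (q1 - 1) by rewrite hq; field; rewrite gt_eqF.
  have t0 : 0 < t by rewrite (lt_le_trans s0).
  have e1 : q1 = (s * q2 + t - s) / t.
    rewrite (_ : s * q2 + t - s = t * q1); last by lra.
    by rewrite mulrC mulKf// gt_eqF.
  have d0 : 0 < s * q2 + t - s.
    by rewrite (_ : _ - _ = t * q1) ?mulr_gt0//; lra.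
  (* with [s' = (q2 / q1) s], the constant is [C (s - s') (1 - q2) / q2] *)
  have -> : C * (s * (t - s) * (1 - q2) ^+ 2 / (q2 * (s * q2 + t - s))) =
      C * (s - q2 / q1 * s) * (1 - q2) / q2.
    by rewrite e1; field; rewrite !gt_eqF.
  apply: extend_to_positive => // g pg.
  have [-> ->] := ker s t q1 q2 g x s0 st q20 q10 pg.
  exact: (reverse_hypercontractivity_finite nuC hnu hP hgen).
Qed.
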